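(* There exists an algorithm that, given a graph $G$ on $n$ vertices together with a $k$-expression of $G$ (for some integer $k$) and a positive integer $t$, computes the number of feedback vertex sets of $G$ of size exactly $t$ modulo $2$, in time $\mathcal{O}(6^k n^c)$ for some constant $c$ independent of $k$.
   Context: All graphs are finite, simple and undirected. A feedback vertex set of a graph $G=(V,E)$ is a set $X\subseteq V$ such that $G-X$ is acyclic (a forest). A $k$-labeled graph is a graph together with a labeling function assigning to each vertex a label in $\{1,\dots,k\}$. A clique expression is a well-formed expression built from the operations: $i(v)$ (create a single vertex $v$ with label $i$); $\rho_{i\to j}(H)$ (relabel all vertices with label $i$ to label $j$); $\eta_{i,j}(H)$ for $i\neq j$ (add all edges between vertices labeled $i$ and vertices labeled $j$); and $H_1\oplus H_2$ (disjoint union). It defines a labeled graph; it is a $k$-expression of $G$ if every intermediate labeled graph uses only labels in $\{1,\dots,k\}$ and the resulting graph (forgetting labels) is isomorphic to $G$. The clique-width of $G$ is the least $k$ for which a $k$-expression of $G$ exists.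
   Formalization: The k-expression is assumed to have at most d(nk)^d operations, for an arbitrary fixed d on which c and the O-constant (not the algorithm) may depend; expressions padded with unboundedly many redundant operations cannot even be read in time O(6^k n^c). *)

(* Defs.v *)
From mathcomp Require Import all_boot.

Set Implicit Arguments.
Unset Strict Implicit.
Unset Printing Implicit Defensive.

(** * Finite simple graphs and feedback vertex sets *)

Record sgraph := SGraph {
  vert :> finType;
  adj : rel vert;
  adj_sym : symmetric adj;
  adj_irr : irreflexive adj }.

Definition iso (G H : sgraph) : Prop :=
  exists2 f : G -> H, bijective f & forall x y, adj (f x) (f y) = adj x y.

(* A cycle of a simple graph is a closed walk through at least three pairwise
   distinct vertices; [ucycleb] also accepts the empty sequence and the
   two-element sequences given by an edge.  The length is bounded by #|G| only
   to make the predicate boolean, see [acyclicP]. *)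
Definition acyclic (G : sgraph) : bool :=
  [forall m : 'I_#|G|.+1, forall p : m.-tuple G,
     ucycleb (@adj G) p ==> (size p <= 2)].

Lemma acyclicP (G : sgraph) :
  reflect (forall p : seq G, ucycle (@adj G) p -> size p <= 2) (acyclic G).
Proof.
apply: (iffP forallP) => [H p /andP[cp up]|H m].
- have sp : size p < #|G|.+1.
    by rewrite ltnS -(card_uniqP up) max_card.
  have /forallP/(_ (in_tuple p))/implyP := H (Ordinal sp).
  by apply; rewrite /ucycleb /= cp up.
- by apply/forallP => p; apply/implyP => ucp; apply: H.
Qed.

Section DeleteVertices.
Variables (G : sgraph) (X : {set G}).

Definition del_vert : finType := {x : G | x \in ~: X}.
Definition del_adj : rel del_vert := fun x y => adj (val x) (val y).

Lemma del_adj_sym : symmetric del_adj.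
Proof. by move=> x y; apply: adj_sym. Qed.

Lemma del_adj_irr : irreflexive del_adj.
Proof. by move=> x; apply: adj_irr. Qed.

Definition del_vertices : sgraph := SGraph del_adj_sym del_adj_irr.
End DeleteVertices.

Definition feedback_vertex_set (G : sgraph) (X : {set G}) : bool :=
  acyclic (del_vertices X).

Definition num_fvs (G : sgraph) (t : nat) : nat :=
  #|[set X : {set G} | feedback_vertex_set X && (#|X| == t)]|.

(** * Labeled graphs and clique expressions *)

Record lgraph := LGraph { lbase :> sgraph; label : lbase -> nat }.

Section SingleVertex.
Definition single_adj : rel unit := fun _ _ => false.

Lemma single_adj_sym : symmetric single_adj. Proof. by []. Qed.
Lemma single_adj_irr : irreflexive single_adj. Proof. by []. Qed.

Definition lsingle (i : nat) : lgraph :=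
  @LGraph (SGraph single_adj_sym single_adj_irr) (fun=> i).
End SingleVertex.

Definition lrelabel (i j : nat) (H : lgraph) : lgraph :=
  @LGraph H (fun x => if label x == i then j else label x).

Section Join.
Variables (i j : nat) (neq_ij : i != j) (H : lgraph).

Definition join_adj : rel H := fun x y =>
  [|| adj x y, (label x == i) && (label y == j)
    | (label x == j) && (label y == i)].

Lemma join_adj_sym : symmetric join_adj.
Proof.
move=> x y; rewrite /join_adj adj_sym.
by rewrite [(label x == i) && _]andbC [(label x == j) && _]andbC
           [X in _ || X]orbC.
Qed.

Lemma join_adj_irr : irreflexive join_adj.
Proof.
move=> x; rewrite /join_adj adj_irr /= [X in _ || X]andbC orbb.
apply/negbTE/negP => /andP[/eqP xi /eqP xj].
by move: neq_ij; rewrite -xi -xj eqxx.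
Qed.

Definition ljoin : lgraph :=
  @LGraph (SGraph join_adj_sym join_adj_irr) (@label H).
End Join.

Section DisjointUnion.
Variables H1 H2 : lgraph.

Definition union_adj : rel (H1 + H2) := fun x y =>
  match x, y with
  | inl x1, inl y1 => adj x1 y1
  | inr x2, inr y2 => adj x2 y2
  | _, _ => false
  end.

Lemma union_adj_sym : symmetric union_adj.
Proof. by case=> x [] y //=; apply: adj_sym. Qed.

Lemma union_adj_irr : irreflexive union_adj.
Proof. by case=> x /=; apply: adj_irr. Qed.

Definition lunion : lgraph :=
  @LGraph (SGraph union_adj_sym union_adj_irr)
    (fun x => match x with inl x1 => label x1 | inr x2 => label x2 end).
End DisjointUnion.

(* Introduced vertices are anonymous: each leaf creates its own vertex, and the
   constructed graph only matters up to isomorphism. *)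
Inductive cexpr : Type :=
| Intro of nat
| Relabel of nat & nat & cexpr
| Join (i j : nat) of i != j & cexpr
| Union of cexpr & cexpr.

Fixpoint eval (e : cexpr) : lgraph :=
  match e with
  | Intro i => lsingle i
  | Relabel i j e1 => lrelabel i j (eval e1)
  | Join _ _ neq_ij e1 => ljoin neq_ij (eval e1)
  | Union e1 e2 => lunion (eval e1) (eval e2)
  end.

Definition k_labeled (k : nat) (H : lgraph) : Prop :=
  forall x : H, 1 <= label x <= k.

Fixpoint all_k_labeled (k : nat) (e : cexpr) : Prop :=
  k_labeled k (eval e) /\
  match e with
  | Intro _ => True
  | Relabel _ _ e1 => all_k_labeled k e1
  | Join _ _ _ e1 => all_k_labeled k e1
  | Union e1 e2 => all_k_labeled k e1 /\ all_k_labeled k e2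
  end.

Definition k_expression (k : nat) (e : cexpr) (G : sgraph) : Prop :=
  all_k_labeled k e /\ iso (eval e) G.

Fixpoint num_ops (e : cexpr) : nat :=
  match e with
  | Intro _ => 1
  | Relabel _ _ e1 => (num_ops e1).+1
  | Join _ _ _ e1 => (num_ops e1).+1
  | Union e1 e2 => (num_ops e1 + num_ops e2).+1
  end.

(** * A word RAM

    Programs are structured commands over registers and a random access memory,
    both holding natural numbers; every elementary command and every test takes
    one time unit.  Machine words are bounded by a parameter [W]: a program that
    produces a value above [W] is stuck, so unit cost is not exploitable through
    arithmetic on huge numbers. *)

Inductive binop := Add | Sub | Mul | Div.

Definition binop_eval (o : binop) : nat -> nat -> nat :=
  match o with
  | Add => addn
  | Sub => subn
  | Mul => muln
  | Div => divn
  end.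

Inductive cmd : Type :=
| Skip
| Const (x c : nat)
| Op (o : binop) (x y z : nat)
| Read (x y : nat)
| Write (x y : nat)
| Seq (c1 c2 : cmd)
| If (x : nat) (c1 c2 : cmd)
| While (x : nat) (c : cmd).

Record state := State { reg : nat -> nat; mem : nat -> nat }.

Definition upd (f : nat -> nat) (a v : nat) : nat -> nat :=
  fun b => if b == a then v else f b.

Definition set_reg (s : state) (x v : nat) : state :=
  State (upd (reg s) x v) (mem s).
Definition set_mem (s : state) (a v : nat) : state :=
  State (reg s) (upd (mem s) a v).

(* [exec W c s T s']: started in [s], the command [c] terminates in [s'] after
   exactly [T] time units without exceeding the word bound. *)
Inductive exec (W : nat) : cmd -> state -> nat -> state -> Prop :=
| exec_skip s :
    exec W Skip s 1 s
| exec_const s x c of c <= W :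
    exec W (Const x c) s 1 (set_reg s x c)
| exec_op s o x y z of binop_eval o (reg s y) (reg s z) <= W :
    exec W (Op o x y z) s 1 (set_reg s x (binop_eval o (reg s y) (reg s z)))
| exec_read s x y :
    exec W (Read x y) s 1 (set_reg s x (mem s (reg s y)))
| exec_write s x y :
    exec W (Write x y) s 1 (set_mem s (reg s x) (reg s y))
| exec_seq s s' s'' c1 c2 T1 T2
    of exec W c1 s T1 s' & exec W c2 s' T2 s'' :
    exec W (Seq c1 c2) s (T1 + T2) s''
| exec_if_nonzero s s' x c1 c2 T of reg s x != 0 & exec W c1 s T s' :
    exec W (If x c1 c2) s T.+1 s'
| exec_if_zero s s' x c1 c2 T of reg s x == 0 & exec W c2 s T s' :
    exec W (If x c1 c2) s T.+1 s'
| exec_while_zero s x c of reg s x == 0 :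
    exec W (While x c) s 1 s
| exec_while_nonzero s s' s'' x c T1 T2
    of reg s x != 0 & exec W c s T1 s' & exec W (While x c) s' T2 s'' :
    exec W (While x c) s (T1 + T2).+1 s''.

Definition init_state (input : seq nat) : state :=
  State (fun=> 0) (fun a => nth 0 input a).

(* Words hold every input word plus O(log B) further bits. *)
Definition word_bound (input : seq nat) (B : nat) : nat :=
  \max_(w <- input) w + B.

(* The answer is read off register 0. *)
Definition computes_within (P : cmd) (input : seq nat) (out B : nat) : Prop :=
  exists T s', [/\ exec (word_bound input B) P (init_state input) T s',
                   T <= B & reg s' 0 = out].

(* Postfix notation; an opcode is never 0, and the memory after the input is
   zero, so the end of the expression can be detected. *)
Fixpoint encode_expr (e : cexpr) : seq nat :=
  match e with
  | Intro i => [:: 1; i]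
  | Relabel i j e1 => encode_expr e1 ++ [:: 2; i; j]
  | Join i j _ e1 => encode_expr e1 ++ [:: 3; i; j]
  | Union e1 e2 => encode_expr e1 ++ encode_expr e2 ++ [:: 4]
  end.

Definition encode_graph (G : sgraph) : seq nat :=
  #|G| :: [seq nat_of_bool (adj x y) | x <- enum G, y <- enum G].

Definition encode_input (G : sgraph) (k t : nat) (e : cexpr) : seq nat :=
  [:: k; t] ++ encode_graph G ++ encode_expr e.

(* Main.v *)
Require Import Defs.
From mathcomp Require Import all_boot all_algebra.
From mathcomp Require Import zify ring.
From Stdlib Require Import FunctionalExtensionality.

(* Take N = n + 1 and work with polynomials in X over F_2, where u = X^N plays the
   role of a second variable.  For a vertex set S, sum over the 2-colourings of S
   without bichromatic edges the product of the weights of the vertices, 1 or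
   1 + u^2 by colour, and of the monochromatic edges, (u + u^2)^2 or u^2.  Removing
   a vertex of degree at most 1 divides this sum by u^2 (1 + O(u)), and if all
   degrees are at least 2 then exchanging the colours shows that the sum vanishes
   modulo u^(2|S| + 1).  Hence its coefficient at u^(2|S|) is 1 if S induces a
   forest and 0 otherwise.  If each deleted vertex weighs X u^2, the total over all
   S has the parity of the number of feedback vertex sets of size t as coefficient
   at X^(2Nn + t).

   The total is computed along the expression.  When two label classes of a forest
   are joined, one of them has at most one vertex in S, and a class with several
   vertices cannot be joined again with a nonempty class, unless the edges are
   added again by a later join, which makes the earlier one redundant.  So at each
   point a class need only be tested by six functionals that are multiplicative in
   its vertices: it is empty; all its vertices have a given colour, with each
   vertex weighing a high power h of u (used to recognise a single vertex) or the
   weight of an edge (used for the edges of a star); or no condition.  Tables are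
   indexed by k digits in base 6, disjoint union is the pointwise product,
   relabelling is a substitution of digits, and a join is a linear combination of
   a bounded number of entries, exact up to multiples of h.

   For k >= n the given expression is replaced by one with a label per vertex,
   read off the adjacency matrix; this bounds the size of the expression by a
   polynomial in n. *)

Set Implicit Arguments.
Unset Strict Implicit.
Unset Printing Implicit Defensive.

(** Without weights, a nonempty set has 2 to the power of its number of components consistent
    2-colourings, which is 0 modulo 2. The weights break the symmetry of the colours just enough:
    vertex weight times edge weight is u^2 (1 + u^2) for both colours, so a pendant vertex factors
    out whatever the colour of its neighbour, and an isolated one leaves 1 + (1 + u^2) = u^2. The
    order in u thus replaces a count of components and edges. The weight X u^2 of a deleted vertex
    moves every forest to u^(2n), so that a single coefficient suffices; t <= n < N keeps X and u =
    X^N apart, and h = u^(2N) lies beyond that coefficient.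

    The delicate point is the division by h^2 at each join, the price of recognising a single vertex
    through powers of h: an arbitrary error divisible by h would not survive it. The errors are
    therefore shown to be combinations of the same multiplicative functionals ([span]). On these
    every join yields a multiple of h^2, so the factor h in front of the error is kept. *)

Section Cycles.
Variables (V : finType) (E : rel V).
Hypotheses (Esym : symmetric E) (Eirr : irreflexive E).

Definition acyc (S : {set V}) : Prop :=
  forall p : seq V, all (mem S) p -> uniq p -> cycle E p -> size p <= 2.

Definition nbr (S : {set V}) (v : V) : {set V} := [set w in S | E v w].

Lemma acycS (S1 S2 : {set V}) : S1 \subset S2 -> acyc S2 -> acyc S1.
Proof.
move=> sub ac p pS; apply: ac; apply/allP => x /(allP pS); exact: (subsetP sub).
Qed.

(** Once the cycle is rotated to start at [v], its second and its last vertex are two neighbours of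
    [v], distinct because the length exceeds 2. *)
Lemma cycle_nbrs (S : {set V}) p v :
  all (mem S) p -> uniq p -> cycle E p -> 2 < size p -> v \in p ->
  1 < #|nbr S v|.
Proof.
move=> pS up cp sp vp.
have [i q def_p] := rot_to vp.
have cq : cycle E (rot i p) by rewrite rot_cycle.
have uq : uniq (rot i p) by rewrite rot_uniq.
have qS : all (mem S) (rot i p) by apply/allP => x; rewrite mem_rot => /(allP pS).
have sq : 2 < size (rot i p) by rewrite size_rot.
move: cq uq qS sq; rewrite {}def_p => {pS cp up sp vp i}.
case: q => [//|a [//|c q]] /=.
rewrite rcons_path => /and3P[va ac /andP[_ bv]] /and3P[_ aq _].
move=> /and4P[vS aS cS qS] _.
have bS : last c q \in c :: q by exact: mem_last.
have bS' : last c q \in S.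
  by move: bS; rewrite inE => /predU1P[->//|]; apply: (allP qS).
have ab : a != last c q by apply: contra aq => /eqP->.
have -> : 1 = #|[set a; last c q]|.-1 by rewrite cards2 ab.
have: #|[set a; last c q]| <= #|nbr S v|.
  apply/subset_leq_card/subsetP => x; rewrite !inE => /orP[] /eqP->.
    by rewrite va andbT.
  by rewrite Esym bv andbT.
by rewrite cards2 ab.
Qed.

Lemma acyc_leaf (S : {set V}) v :
  #|nbr S v| <= 1 -> acyc (S :\ v) -> acyc S.
Proof.
move=> dv ac p pS up cp; have [vp|vp] := boolP (v \in p).
  rewrite leqNgt; apply/negP => sp.
  by have := cycle_nbrs pS up cp sp vp; rewrite ltnNge dv.
apply: ac => //; apply/allP => x xp; rewrite /= !inE.
have := allP pS _ xp; rewrite /= => ->; rewrite andbT.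
by apply: contra vp => /eqP <-.
Qed.

(** The path is extended at its head as long as the head has a neighbour off the path. When this
    stops, a neighbour [w] of the head other than the second vertex lies on the path, and the
    segment up to [w] closes to a cycle of length at least 3. *)
Lemma path_in_cycle (S : {set V}) x p :
  (forall v, v \in S -> 1 < #|nbr S v|) ->
  all (mem S) (x :: p) -> uniq (x :: p) -> path E x p -> ~ acyc S.
Proof.
move=> deg; have [m] := ubnP (#|V| - size p); elim: m x p => // m IH x p.
rewrite ltnS => lem pS up xp ac.
have xS : x \in S by case/andP: pS.
have [/subsetP sub|] := boolP (nbr S x \subset (x :: p)); last first.
  case/subsetPn=> w; rewrite inE => /andP[wS xw] wp.
  have up' : uniq (w :: x :: p) by rewrite [uniq _]/= wp.
  apply: (IH w (x :: p)) => //.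
  - have := max_card (mem (w :: x :: p)); rewrite (card_uniqP up') /= => sz; apply: leq_trans lem; apply: ltn_sub2l => //; exact: ltnW.
  - by rewrite [all _ _]/= wS.
  - by rewrite /= Esym xw.
have nx : x \notin nbr S x by rewrite inE Eirr andbF.
have [w wN wh] : exists2 w, w \in nbr S x & w != head x p.
  have /card_gt1P[a [b [aN bN ab]]] := deg x xS.
  have [ah|ah] := eqVneq a (head x p); last by exists a.
  by exists b => //; rewrite -ah eq_sym.
have wp : w \in p.
  have := sub w wN; rewrite inE => /predU1P[wx|//].
  by move: wN; rewrite wx (negPf nx).
set q := take (index w p).+1 p.
have iw : 0 < index w p.
  by case: (p) wh wp => //= a r; rewrite eq_sym => /negPf ->.
have sq : size q = (index w p).+1 by rewrite size_takel // index_mem.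
have := ac (x :: q); rewrite /= sq => H.
suff: (index w p).+2 <= 2 by rewrite !ltnS leqNgt iw.
have sub' : {subset q <= p} by move=> z; apply: mem_take.
apply: H.
- move: pS => /= /andP[xS' /allP pS]; rewrite xS' /=.
  by apply/allP => z /sub'; exact: pS.
- case/andP: up => xNp up; rewrite take_uniq // andbT.
  by apply: contra xNp => /sub'.
rewrite rcons_path take_path //=.
have -> : last x q = w.
  rewrite /q (take_nth w) ?index_mem // last_rcons nth_index //.
by rewrite Esym; case/setIdP: wN.
Qed.

Lemma acyc_low_degree (S : {set V}) v0 :
  v0 \in S -> acyc S -> exists2 v, v \in S & #|nbr S v| <= 1.
Proof.
move=> v0S ac; have [/existsP[v /andP[vS dv]]|H] :=
  boolP [exists v, (v \in S) && (#|nbr S v| <= 1)]; first by exists v.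
exfalso; apply: (@path_in_cycle S v0 [::]) => //=; last by rewrite v0S.
move=> v vS; rewrite ltnNge; apply: contra H => dv.
by apply/existsP; exists v; rewrite vS.
Qed.

End Cycles.

(** * Consistent cuts in characteristic two *)

Section CutSum.
Import GRing.Theory.
Local Open Scope ring_scope.
Variables (V : finType) (E : rel V) (R : comNzRingType) (u : R).
Hypotheses (Esym : symmetric E) (Eirr : irreflexive E).
Hypothesis char2 : 1 + 1 = 0 :> R.

Lemma addrr2 (a : R) : a + a = 0.
Proof. by rewrite -[a]mul1r -mulrDl char2 mul0r. Qed.

Implicit Types (kp : {ffun V -> option bool}) (S : {set V}).

(** A map [kp] encodes a vertex set together with a colouring: [None] marks a deleted vertex,
    [Some c] a kept one of colour [c]. *)
Definition supp kp : {set V} := [set v | isSome (kp v)].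

(* The products below run over ordered pairs, so an edge of colour [c] weighs
   [half_edge c ^+ 2]. *)
Definition half_edge (c : bool) : R := if c then u else u + u ^+ 2.

(** Chosen so that in characteristic 2 the product [vert_weight (Some c) * half_edge c ^+ 2] is u^2
    (1 + u^2) for both colours, while the two vertex weights add up to u^2. *)
Definition vert_weight (o : option bool) : R :=
  if o is Some true then 1 + u ^+ 2 else 1.

Definition pair_weight (o o' : option bool) : R :=
  if o is Some c then (if o' is Some _ then half_edge c else 1) else 1.

Definition agree (o o' : option bool) : bool :=
  if o is Some c then (if o' is Some d then c == d else true) else true.

Definition consistent (kp : V -> option bool) : bool :=
  [forall a, forall b, E a b ==> agree (kp a) (kp b)].

Definition cut_weight (kp : V -> option bool) : R :=
  (\prod_a vert_weight (kp a)) *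
  \prod_a \prod_b (if E a b then pair_weight (kp a) (kp b) else 1).

Definition cut_sum S : R :=
  \sum_(kp : {ffun V -> option bool} | (supp kp == S) && consistent kp)
     cut_weight kp.

Lemma agree_sym o o' : agree o o' = agree o' o.
Proof. by case: o o' => [c|] [d|] //=; rewrite eq_sym. Qed.

Definition ext (v : V) kp (c : bool) : {ffun V -> option bool} :=
  [ffun w => if w == v then Some c else kp w].

Lemma sum_ext S v (F : {ffun V -> option bool} -> R) : v \in S ->
  \sum_(kp | supp kp == S) F kp =
  \sum_(kp | supp kp == S :\ v) \sum_(c : bool) F (ext v kp c).
Proof.
move=> vS; rewrite pair_big /=.
pose g kp : {ffun V -> option bool} * bool :=
  ([ffun w => if w == v then None else kp w], odflt false (kp v)).
rewrite (reindex_onto (fun p : _ * bool => ext v p.1 p.2) g) /=; last first.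
  move=> kp /eqP kS; apply/ffunP => w; rewrite !ffunE /=.
  case: eqP => // ->; have: v \in supp kp by rewrite kS.
  by rewrite inE; case: (kp v).
apply: eq_bigl => -[kp c] /=; apply/andP/idP => [[/eqP kS /eqP[k1 k2]]|].
  rewrite andbT -kS -{1}k1; apply/eqP/setP => w; rewrite !inE !ffunE.
  by case: eqP.
rewrite andbT => /eqP kS; split.
  apply/eqP/setP => w; rewrite inE ffunE; have := congr1 (fun A : {set V} => w \in A) kS.
  by rewrite !inE; case: eqP => //= ->; rewrite vS.
apply/eqP; congr pair; last by rewrite ffunE eqxx.
apply/ffunP => w; rewrite !ffunE; case: eqP => // ->.
have := congr1 (fun A : {set V} => v \in A) kS.
by rewrite !inE eqxx; case: (kp v).
Qed.

Lemma consistent_ext S v kp c : v \in S -> supp kp == S :\ v ->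
  consistent (ext v kp c) =
  consistent kp && [forall w in nbr E S v, kp w == Some c].
Proof.
move=> vS /eqP kS.
have kv : kp v = None.
  have := congr1 (fun A : {set V} => v \in A) kS.
  by rewrite !inE eqxx; case: (kp v).
have kw w : w != v -> isSome (kp w) = (w \in S).
  move=> wv; have := congr1 (fun A : {set V} => w \in A) kS.
  by rewrite !inE wv.
have EN w : E v w -> w != v by apply: contraTneq => ->; rewrite Eirr.
apply/forallP/andP => [H|[/forallP H1 /forall_inP H2] a].
  split.
    apply/forallP => a; apply/forallP => b; apply/implyP => ab.
    have := forallP (H a) b; rewrite ab /= !ffunE.
    case: eqP => [->|_]; first by rewrite kv.
    by case: eqP => // ->; rewrite kv; case: (kp a).
  apply/forall_inP => w; rewrite inE => /andP[wS vw].
  have := forallP (H v) w; rewrite vw /= !ffunE eqxx (negPf (EN _ vw)).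
  by have := kw w (EN _ vw); rewrite wS; case: (kp w) => //= d _ /eqP->.
apply/forallP => b; apply/implyP => ab; rewrite !ffunE.
have K w : E v w -> agree (Some c) (kp w).
  move=> vw; have := kw w (EN _ vw); case wS: (w \in S) => kwS.
    by have /eqP-> := H2 w (introT setIdP (conj wS vw)); rewrite /= eqxx.
  by case: (kp w) kwS.
have [av|av] := eqVneq a v; have [bv|bv] := eqVneq b v.
- by rewrite /= eqxx.
- by apply: K; rewrite -av.
- by rewrite agree_sym; apply: K; rewrite Esym -bv.
- exact: (implyP (forallP (H1 a) b)).
Qed.

(** By consistency all kept neighbours of [v] have colour [c], so the row and the column of [v] in
    the double product each contribute one [half_edge c] per neighbour. *)
Lemma cut_weight_ext S v kp c : v \in S -> supp kp == S :\ v ->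
  consistent (ext v kp c) ->
  cut_weight (ext v kp c) =
  cut_weight kp * (vert_weight (Some c) * (half_edge c ^+ 2) ^+ #|nbr E S v|).
Proof.
move=> vS kS; rewrite (consistent_ext _ vS kS) => /andP[ck /forall_inP H].
move/eqP: kS => kS.
have kv : kp v = None.
  have := congr1 (fun A : {set V} => v \in A) kS.
  by rewrite !inE eqxx; case: (kp v).
have kw w : w != v -> isSome (kp w) = (w \in S).
  move=> wv; have := congr1 (fun A : {set V} => w \in A) kS.
  by rewrite !inE wv.
have EN w : E v w -> w != v by apply: contraTneq => ->; rewrite Eirr.
have eN w : w != v -> ext v kp c w = kp w by rewrite ffunE => /negPf->.
have ev : ext v kp c v = Some c by rewrite ffunE eqxx.
set T := half_edge c ^+ #|nbr E S v|.
pose Y := \prod_(a | a != v)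
  \prod_(b | b != v) (if E a b then pair_weight (kp a) (kp b) else 1).
have PR : \prod_a \prod_b (if E a b then pair_weight (kp a) (kp b) else 1) = Y.
  rewrite (bigD1 v) //= big1 ?mul1r => [|b _]; last by rewrite kv /=; case: ifP.
  apply: eq_bigr => a av; rewrite (bigD1 v) //= kv.
  have -> : (if E a v then pair_weight (kp a) None else 1) = 1.
    by case: ifP => //; case: (kp a).
  by rewrite mul1r.
have rowT : \prod_b (if E v b then pair_weight (Some c) (ext v kp c b) else 1) = T.
  rewrite /T -prodr_const [RHS]big_mkcond /=; apply: eq_bigr => w _.
  case: ifP => vw; last by rewrite inE vw andbF.
  have wv := EN _ vw; rewrite eN // inE vw andbT -(kw w wv).
  by case: (kp w).
have colT : \prod_(a | a != v)
    (if E a v then pair_weight (ext v kp c a) (Some c) else 1) = T.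
  rewrite big_mkcond /T -prodr_const [RHS]big_mkcond /=; apply: eq_bigr => w _.
  have [->|wv] := eqVneq w v; first by rewrite inE Eirr andbF.
  rewrite eN // Esym; case: ifP => vw; last by rewrite inE vw andbF.
  case wN: (w \in nbr E S v); first by rewrite (eqP (H w wN)).
  move: wN; rewrite inE vw andbT -(kw w wv) => kN.
  by case: (kp w) kN.
have PL : \prod_a \prod_b
    (if E a b then pair_weight (ext v kp c a) (ext v kp c b) else 1) = T * (T * Y).
  rewrite (bigD1 v) //= ev rowT; congr (_ * _).
  rewrite -colT -big_split /=; apply: eq_bigr => a av.
  rewrite (bigD1 v) //= ev; congr (_ * _).
  by apply: eq_bigr => b bv; rewrite !eN.
rewrite /cut_weight PL PR (bigD1 v) //= [in RHS](bigD1 v) //= ev kv mul1r.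
rewrite (eq_bigr (fun a => vert_weight (kp a))); last by move=> a av; rewrite eN.
rewrite -exprM mulnC exprM -/T /=; ring.
Qed.

(** The cofactor that remains after the lowest power of [u] has been taken out; the congruence
    modulo [u] makes sense in any ring, without a notion of order or of power series. *)
Definition near1 (a : R) := exists g, a = 1 + u * g.

Lemma near1_1 : near1 1. Proof. by exists 0; ring. Qed.

Lemma near1M a b : near1 a -> near1 b -> near1 (a * b).
Proof. by case=> g -> [g' ->]; exists (g + g' + u * (g * g')); ring. Qed.

Lemma near1_prod (I : finType) (P : pred I) (F : I -> R) :
  (forall i, P i -> near1 (F i)) -> near1 (\prod_(i | P i) F i).
Proof. by move=> H; apply: big_ind => //; [exact: near1_1 | exact: near1M]. Qed.

Lemma near1_vert o : near1 (vert_weight o).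
Proof. by case: o => [[]|]; [exists u; rewrite /=; ring | exact: near1_1..]. Qed.

Lemma prod_half_edges (I : finType) (P : pred I) (F : I -> bool) :
  exists2 a, near1 a & \prod_(i | P i) half_edge (F i) = u ^+ #|P| * a.
Proof.
pose h c := if c then 1 else 1 + u : R.
exists (\prod_(i | P i) h (F i)).
  by apply: near1_prod => i _; case: (F i); [exact: near1_1 | exists 1; rewrite /= mulr1].
rewrite -prodr_const -big_split /=; apply: eq_bigr => i _.
by case: (F i); rewrite /half_edge /h; ring.
Qed.

(** For a fixed colouring of the rest, an isolated [v] contributes 1 + (1 + u^2) = u^2. With one
    neighbour the colour of [v] is forced, and the choice of the weights makes the contribution u^2
    (1 + u^2) in either colour. *)
Lemma cut_sum_leaf S v : v \in S -> (#|nbr E S v| <= 1)%N ->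
  exists2 a, near1 a & cut_sum S = u ^+ 2 * a * cut_sum (S :\ v).
Proof.
move=> vS dv.
pose W kp c := if consistent (ext v kp c)
  then vert_weight (Some c) * (half_edge c ^+ 2) ^+ #|nbr E S v| else 0.
suff [a n1a H] : exists2 a, near1 a & forall kp,
    supp kp == S :\ v -> consistent kp -> \sum_c W kp c = u ^+ 2 * a.
  exists a => //; rewrite /cut_sum big_mkcondr /= (sum_ext _ vS) mulr_sumr.
  rewrite [RHS]big_mkcondr /=; apply: eq_bigr => kp kS; case: ifP => ck; last first.
    by apply: big1 => c _; rewrite (consistent_ext _ vS kS) ck.
  rewrite -(H kp kS ck) mulr_suml; apply: eq_bigr => c _; rewrite /W.
  by case: ifP => ce; [rewrite (cut_weight_ext vS kS ce) mulrC | rewrite mul0r].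
case dE: #|nbr E S v| dv => [|[]] // _.
  exists 1; first exact: near1_1.
  move=> kp kS ck; rewrite big_bool /W !(consistent_ext _ vS kS) ck dE.
  have/eqP NE : nbr E S v == set0 by rewrite -cards_eq0 dE.
  have T c : [forall w in nbr E S v, kp w == Some c].
    by apply/forall_inP => w; rewrite NE inE.
  by rewrite !T /= !expr0 !mulr1 addrAC char2 add0r.
have /cards1P[w NE] : #|nbr E S v| == 1%N by rewrite dE.
exists (1 + u ^+ 2); first by exists u; ring.
move=> kp kS ck.
have T c : [forall w in nbr E S v, kp w == Some c] = (kp w == Some c).
  rewrite NE; apply/forall_inP/idP => [/(_ w)|kw x /set1P->//].
  by rewrite inE eqxx; apply.
have : w \in supp kp.
  rewrite (eqP kS); have: w \in nbr E S v by rewrite NE inE.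
  rewrite !inE => /andP[-> vw]; rewrite andbT.
  by apply: contraTneq vw => ->; rewrite Eirr.
rewrite inE big_bool /W !(consistent_ext _ vS kS) ck dE !T !expr1.
case: (kp w) => // -[] _ /=; rewrite ?add0r ?addr0; first by ring.
have -> : 1 * (u + u ^+ 2) ^+ 2 = u ^+ 2 * (1 + u ^+ 2) + (u ^+ 3 + u ^+ 3) by ring.
by rewrite addrr2 addr0.
Qed.

(* At least 2 #|S| half-edges divide every term by u^(2 #|S|), and the terms of
   lowest order cancel in pairs under the exchange of the two colours. *)
Lemma cut_sum_min_degree2 S v0 : v0 \in S ->
  (forall v, v \in S -> (1 < #|nbr E S v|)%N) ->
  exists g, cut_sum S = u ^+ (2 * #|S|).+1 * g.
Proof.
move=> v0S deg.
pose P := (\sum_(v in S) #|nbr E S v|)%N.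
have PE : (2 * #|S| <= P)%N.
  by rewrite mulnC -sum_nat_const; apply: leq_sum => v /deg.
have W kp : supp kp == S -> exists g, cut_weight kp = u ^+ P * (1 + u * g).
  move/eqP=> kS.
  suff [a [g ->] ->] : exists2 a, near1 a & cut_weight kp = u ^+ P * a by exists g.
  pose F a := \prod_b (if E a b then pair_weight (kp a) (kp b) else 1).
  have FE a : exists2 b, near1 b & F a = u ^+ (if a \in S then #|nbr E S a| else 0%N) * b.
    rewrite /F; have aS : (a \in S) = isSome (kp a) by rewrite -kS inE.
    case ka: (kp a) aS => [c|] /= ->; last first.
      by exists 1; [exact: near1_1|rewrite expr0 mulr1 big1 // => b _; case: ifP].
    have [x n1x xE] := @prod_half_edges V (mem (nbr E S a)) (fun=> c).
    exists x => //; rewrite -xE [RHS]big_mkcond /=; apply: eq_bigr => b _.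
    by rewrite inE -kS inE; case: (kp b) => [d|]; case: ifP.
  have [G GE] : exists G : V -> R, forall a, near1 (G a) /\
     F a = u ^+ (if a \in S then #|nbr E S a| else 0%N) * G a.
    apply: (@fin_all_exists V (fun=> R) (fun a g => near1 g /\ F a = u ^+ (if a \in S then #|nbr E S a| else 0%N) * g)) => a; by have [b ? ?] := FE a; exists b.
  exists ((\prod_a vert_weight (kp a)) * \prod_a G a).
    apply: near1M; apply: near1_prod => a _; first exact: near1_vert.
    by case: (GE a).
  rewrite /cut_weight (eq_bigr _ (fun a _ => (GE a).2)) big_split /=.
  rewrite prodrXr -big_mkcond -/P; ring.
pose A c := \sum_(kp : {ffun V -> option bool} | (supp kp == S) && consistent kp && (kp v0 == Some c)) (1 : R).
have Z0 : \sum_(kp : {ffun V -> option bool} | (supp kp == S) && consistent kp) 1 = A true + A false.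
  rewrite (bigID (fun kp => kp v0 == Some true)) /=; congr (_ + _).
  apply: eq_bigl => kp; case kS: (supp kp == S) => //=.
  have: v0 \in supp kp by rewrite (eqP kS).
  by rewrite inE; case: (kp v0) => [[]|].
pose fl kp : {ffun V -> option bool} := [ffun v => omap negb (kp v)].
have flK : involutive fl.
  by move=> kp; apply/ffunP => v; rewrite !ffunE; case: (kp v) => //= c; rewrite negbK.
have AA : A true = A false.
  rewrite /A (reindex_inj (inv_inj flK)); apply: eq_bigl => kp.
  congr (_ && _ && _).
  - congr (_ == S); apply/setP => v; rewrite !inE !ffunE; by case: (kp v).
  - apply: eq_forallb => a; apply: eq_forallb => b; rewrite !ffunE.
    by case: (kp a) (kp b) => [[]|] [[]|].
  - by rewrite ffunE; case: (kp v0) => [[]|].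
rewrite AA addrr2 in Z0.
have [G GE] : exists G : {ffun V -> option bool} -> R, forall kp,
   supp kp == S -> cut_weight kp = u ^+ P * (1 + u * G kp).
  apply: (@fin_all_exists _ (fun=> R)
    (fun kp g => supp kp == S -> cut_weight kp = u ^+ P * (1 + u * g))) => kp.
  by case kS: (supp kp == S); [have [g ?] := W kp kS; exists g | exists 0].
have ZE : cut_sum S = u ^+ P * (u * \sum_(kp | (supp kp == S) && consistent kp) G kp).
  rewrite /cut_sum (eq_bigr (fun kp => u ^+ P * (1 + u * G kp))).
    by rewrite -mulr_sumr big_split /= Z0 add0r -mulr_sumr.
  by move=> kp /andP[kS _]; exact: GE.
exists (u ^+ (P - 2 * #|S|) * \sum_(kp | (supp kp == S) && consistent kp) G kp).
rewrite ZE -{1}(subnK PE) exprD exprS; ring.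
Qed.

(** Removing vertices of degree at most 1 changes neither acyclicity nor the coefficient in
    question. The process ends with the empty set, whose sum is 1, or with a nonempty set of minimum
    degree 2, which contains a cycle and whose coefficient vanishes. *)
Lemma cut_sum_acyc S : exists (b : bool) (g : R),
  (b <-> acyc E S) /\ cut_sum S = b%:R * u ^+ (2 * #|S|)%N + u ^+ (2 * #|S|).+1 * g.
Proof.
have [m] := ubnP #|S|; elim: m S => // m IH S; rewrite ltnS => Sm.
have [->|[v0 v0S]] := set_0Vmem S.
  exists true, 0; split.
    by split=> // _ [|x p] //=; rewrite inE.
  rewrite cards0 muln0 expr0 mulr0 addr0 mulr1 /cut_sum.
  rewrite (big_pred1 [ffun=> None]) => [|kp].
    rewrite /cut_weight big1 => [|a _]; last by rewrite ffunE.
    rewrite big1 ?mulr1 // => a _; rewrite big1 // => b _.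
    by rewrite ffunE /=; case: ifP.
  apply/andP/eqP => [[/eqP k0 _]|->].
    apply/ffunP => v; have := congr1 (fun A : {set V} => v \in A) k0.
    by rewrite !inE ffunE; case: (kp v).
  split; first by apply/eqP/setP => v; rewrite !inE ffunE.
  by apply/forallP => a; apply/forallP => b; rewrite !ffunE implybT.
have [/existsP[v /andP[vS dv]]|H] := boolP [exists v, (v \in S) && (#|nbr E S v| <= 1)%N].
  have cS : #|S| = #|S :\ v|.+1 by rewrite (cardsD1 v) vS.
  have [|b [g [bE ZE]]] := IH (S :\ v); first by rewrite -cS.
  have [a [ga aE] ->] := cut_sum_leaf vS dv.
  exists b, (b%:R * ga + a * g); split.
    rewrite bE; split; first exact: acyc_leaf.
    by apply: acycS; rewrite subsetDl.
  rewrite ZE cS aE mulnS !exprS; ring.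
have deg v : v \in S -> (1 < #|nbr E S v|)%N.
  move=> vS; rewrite ltnNge; apply: contra H => dv.
  by apply/existsP; exists v; rewrite vS.
have [g ->] := cut_sum_min_degree2 v0S deg.
exists false, g; split; last by rewrite mul0r add0r.
split=> // ac; have [v vS] := acyc_low_degree Esym Eirr v0S ac.
by rewrite leqNgt deg.
Qed.
End CutSum.

(** * The table recurrences *)

(* [(a, b, c)] stands for X^a u^(2b) h^c, with u = X^N and h = u^(2N). *)
Definition mono := (nat * nat * nat)%type.
Definition mmul (m m' : mono) : mono :=
  (m.1.1 + m'.1.1, m.1.2 + m'.1.2, m.2 + m'.2).
Definition pmul (l l' : seq mono) : seq mono := [seq mmul m m' | m <- l, m' <- l'].

Definition one_l : seq mono := [:: (0, 0, 0)].
Definition h_l : seq mono := [:: (0, 0, 1)].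
Definition hh_l : seq mono := [:: (0, 0, 2)].
Definition edge_l (c : bool) : seq mono :=
  if c then [:: (0, 1, 0)] else [:: (0, 1, 0); (0, 2, 0)].
(* The weight of a vertex of colour [c] under digit [d] of a table index: digit 0
   only admits empty classes, digits [1 + c] and [3 + c] only vertices of colour
   [c], of weight [h] and of the weight of an edge, and digit 5 admits all
   vertices with weight 1. *)
Definition w_l (d : nat) (c : bool) : seq mono :=
  if d == 5 then one_l else if d == 1 + c then h_l
  else if d == 3 + c then edge_l c else [::].
(* A deleted vertex weighs X u^2. *)
Definition leaf_l (d : nat) : seq mono :=
  (1, 1, 0) :: w_l d false ++ pmul (w_l d true) [:: (0, 0, 0); (0, 1, 0)].

(* In characteristic 2 the four terms make up the product of the functionals
   [a + 0] and [b + 0], where adding digit 0 discards the empty class. *)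
Definition cross (a b : nat) (w : seq mono) : seq (nat * nat * seq mono) :=
  [:: (a, b, w); (a, 0, w); (0, b, w); (0, 0, w)].

(* Applied to [m] vertices, [1 + c] gives [h ^ m] and hence, after division by
   [h], detects [m = 1] up to a multiple of [h]; the edges between this vertex and
   [m'] vertices weigh what [3 + c] gives for the other class.  If both classes
   are single vertices, the first [cross] accounts for their edge, and the last
   one of each list cancels the star counted before it. *)
Definition join_color (d d' : nat) (c : bool) : seq (nat * nat * seq mono) :=
  cross (1 + c) (1 + c) (pmul (pmul (w_l d c) (w_l d' c)) (edge_l c)) ++
  (if d' == 5 then cross (1 + c) (3 + c) (pmul h_l (w_l d c)) ++
     cross (1 + c) (1 + c) (pmul (edge_l c) (w_l d c)) else [::]) ++
  (if d == 5 then cross (3 + c) (1 + c) (pmul h_l (w_l d' c)) ++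
     cross (1 + c) (1 + c) (pmul (edge_l c) (w_l d' c)) else [::]).

(** The first three entries are for joins with an empty class, which change nothing: digit 0 tests
    emptiness, and if both classes are empty then 1 + 1 + 1 = 1. Their weight h^2 anticipates the
    division by h^2. *)
Definition join_l (d d' : nat) : seq (nat * nat * seq mono) :=
  [:: (d, 0, hh_l); (0, d', hh_l); (0, 0, hh_l)] ++
  join_color d d' false ++ join_color d d' true.

(** A relation on the labels after an operation is pulled back to the labels before it. *)
Definition later_relabel (P : rel nat) (i j : nat) : rel nat :=
  fun a b => P (if a == i then j else a) (if b == i then j else b).
Definition later_join (P : rel nat) (i j : nat) : rel nat :=
  fun a b => [|| P a b, (a == i) && (b == j) | (a == j) && (b == i)].

(** When all labels occurring are at most [k], an operation that fails this test has no effect: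
    [i = j], or a class concerned is empty ([label_absent]). *)
Definition active (k i j : nat) : bool := [&& i <= k, j <= k & i != j].

Section Table.
Import GRing.Theory.
Local Open Scope ring_scope.
Variable N : nat.
Notation R := {poly 'F_2}.

(** For [N = n + 1] and [t <= n] this exceeds [2 * N * n + t], the exponent of the coefficient read
    at the end, which is therefore blind to multiples of [h]. *)
Definition hexp : nat := (2 * N * N)%N.
Definition mexp (m : mono) : nat := (m.1.1 + 2 * N * m.1.2 + hexp * m.2)%N.
Definition peval (l : seq mono) : R := \sum_(m <- l) 'X^(mexp m).

Definition table := (nat -> nat) -> R.

(** Dropping [2 * hexp] coefficients is the division by h^2; it is exact on the tables that arise
    ([tjoin_expand]). *)
Definition tjoin (F : table) (i j : nat) : table := fun q =>
  drop_poly (2 * hexp) (\sum_(t <- join_l (q i) (q j))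
    peval t.2 * F (upd (upd q i t.1.1) j t.1.2)).

(* [P] relates the labels whose classes are joined later in the expression: such
   a join is skipped, so that every edge is counted once, at its last join. *)
Fixpoint dp (k : nat) (P : rel nat) (e : cexpr) : table :=
  match e with
  | Intro i => fun q => peval (leaf_l (q i))
  | Relabel i j e1 => fun q =>
      dp k (later_relabel P i j) e1 (if active k i j then upd q i (q j) else q)
  | Join i j _ e1 =>
      let F := dp k (later_join P i j) e1 in
      if active k i j && ~~ P i j then tjoin F i j else F
  | Union e1 e2 => fun q => dp k P e1 q * dp k P e2 q
  end.

Lemma char2 : 1 + 1 = 0 :> R.
Proof. by rewrite -polyCD -[RHS]polyC0; congr (_%:P); apply/val_inj. Qed.

(** The tactic [ring] does not use 1 + 1 = 0, so the terms that cancel are supplied as [t]. *)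
Lemma char2_eq (t a b : R) : a + b = t + t -> a = b.
Proof.
rewrite (addrr2 char2) => ab; rewrite -[a]addr0 -(addrr2 char2 b) addrA ab.
exact: add0r.
Qed.

Lemma mexpM m m' : mexp (mmul m m') = (mexp m + mexp m')%N.
Proof. by rewrite /mexp /=; lia. Qed.

Lemma pevalM l l' : peval (pmul l l') = peval l * peval l'.
Proof.
rewrite /peval /pmul big_allpairs_dep mulr_suml; apply: eq_bigr => m _.
by rewrite mulr_sumr; apply: eq_bigr => m' _; rewrite mexpM exprD.
Qed.

Lemma peval_cat l l' : peval (l ++ l') = peval l + peval l'.
Proof. by rewrite /peval big_cat. Qed.

Definition u : R := 'X^N.
Definition h : R := 'X^hexp.
Definition ewt (c : bool) : R := half_edge u c ^+ 2.

Lemma peval_one : peval one_l = 1.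
Proof. by rewrite /peval big_seq1 /mexp !muln0 expr0. Qed.

Lemma peval_h : peval h_l = h.
Proof. by rewrite /peval big_seq1 /mexp muln0 muln1. Qed.

Lemma peval_hh : peval hh_l = h ^+ 2.
Proof. by rewrite /peval big_seq1 /mexp muln0 /= add0n exprM. Qed.

Lemma peval_edge c : peval (edge_l c) = ewt c.
Proof.
have X k : 'X^(2 * N * k) = u ^+ (2 * k) :> R.
  by rewrite -exprM; congr ('X^_); lia.
rewrite /peval /ewt /half_edge; case: c; rewrite /edge_l ?big_cons big_nil addr0 /mexp /=;
  rewrite !muln0 !addn0 !add0n !X //.
by apply: (@char2_eq (u ^+ 2 + u ^+ 3 + u ^+ 4)); rewrite (_ : 2 * 1 = 2)%N // (_ : 2 * 2 = 4)%N //; ring.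
Qed.

Definition wt (d : nat) (c : bool) : R := peval (w_l d c).

(* The state of a label class: its numbers of vertices of the two colours, and a
   flag for a class with several vertices which has taken part in a join. *)
Definition st := (nat * nat * bool)%type.
Definition st0 : st := (0, 0, false)%N.
(** The value on a class of the functional named by digit [d]. A flagged class passes only the
    unconditional test, with value 1: all other digits serve to prepare a join, which is forbidden
    to it, or to test emptiness. *)
Definition phi (d : nat) (s : st) : R :=
  if (d == 5) || ~~ s.2 then wt d false ^+ s.1.1 * wt d true ^+ s.1.2 else 0.
Definition st_add (s s' : st) : st :=
  ((s.1.1 + s'.1.1)%N, (s.1.2 + s'.1.2)%N, s.2 || s'.2).

Lemma phiD d s s' : phi d (st_add s s') = phi d s * phi d s'.
Proof.
rewrite /phi /= negb_or; case: (d == 5) => /=.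
  by rewrite !exprD; ring.
by case: s.2 s'.2 => [] [] /=; rewrite ?mul0r ?mulr0 // !exprD; ring.
Qed.

Lemma phi_st0 d : phi d st0 = 1.
Proof. by rewrite /phi orbT !expr0 mulr1. Qed.

Definition pst (c : bool) (a : nat) : st :=
  if c then (0%N, a, false) else (a, 0%N, false).
Definition sfin (s : st) : st := (s.1, true).

Definition pure (s : st) : option (bool * nat) :=
  let: (a, b, f) := s in
  if f then None else
  match a, b with
  | a'.+1, 0 => Some (false, a)
  | 0, b'.+1 => Some (true, b)
  | _, _ => None
  end.

Lemma pureP s c a : pure s = Some (c, a) -> s = pst c a /\ (0 < a)%N.
Proof. by case: s => [[[|x] [|y]] []] //= [<- <-]. Qed.

Lemma wt5 c : wt 5 c = 1. Proof. exact: peval_one. Qed.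
Lemma wt0 c : wt 0 c = 0. Proof. by rewrite /wt /peval big_nil. Qed.

Lemma phi0 s : s != st0 -> phi 0 s = 0.
Proof.
case: s => [[a b] f]; rewrite /phi !wt0 /= => s0.
case: f s0 => //= s0; case: a s0 => [|a]; last by rewrite exprS !mul0r.
by case: b => // b; rewrite exprS mul0r mulr0.
Qed.

Lemma wt_h (c c' : bool) : wt (1 + c) c' = if c == c' then h else 0.
Proof.
have -> : wt (1 + c) c' = peval (if c == c' then h_l else [::]).
  by case: c; case: c'.
by case: eqP; rewrite ?peval_h // /peval big_nil.
Qed.

Lemma wt_M (c c' : bool) : wt (3 + c) c' = if c == c' then ewt c else 0.
Proof.
have -> : wt (3 + c) c' = peval (if c == c' then edge_l c else [::]).
  by case: c; case: c'.
by case: eqP; rewrite ?peval_edge // /peval big_nil.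
Qed.

(** A functional that admits a single colour is 1 on the empty class. Adding [phi 0], the indicator
    of the empty class, cancels this value in characteristic 2. *)
Lemma phi_pure (w : R) d c s :
  (forall c', wt d c' = if c == c' then w else 0) -> d != 5 ->
  phi d s + phi 0 s = if pure s is Some (c', a) then if c == c' then w ^+ a else 0 else 0.
Proof.
move=> wE /negPf d5; rewrite /phi d5 /= !wE !wt0.
case: s => [[a b] []] /=; first by rewrite addr0.
case: a b c {wE} => [|a] [|b] [] /=; rewrite ?expr0 ?[0 ^+ _.+1]expr0n ?mul0r ?mulr0 ?mul1r ?mulr1 ?addr0 ?char2 //.
Qed.

(* The intended effect of a join on the states of the two classes: a forest
   forbids to join two classes with several vertices each, and to join a flagged
   class again. *)
Definition mt (s s' : st) : R * st * st :=
  if (s == st0) || (s' == st0) then (1, s, s') else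
  match pure s, pure s' with
  | Some (c, a), Some (c', b) =>
      if c != c' then (0, s, s')
      else if (a == 1)%N then (ewt c ^+ b, s, if (b == 1)%N then s' else sfin s')
      else if (b == 1)%N then (ewt c ^+ a, sfin s, s')
      else (0, s, s')
  | _, _ => (0, s, s')
  end.

Definition jval (d d' : nat) (t : R * st * st) : R :=
  t.1.1 * (phi d t.1.2 * phi d' t.2).

Lemma sum_cross a b w s s' :
  \sum_(t <- cross a b w) peval t.2 * (phi t.1.1 s * phi t.1.2 s') =
  peval w * ((phi a s + phi 0 s) * (phi b s' + phi 0 s')).
Proof. by rewrite /cross !big_cons big_nil /= addr0; ring. Qed.

Definition pw (w : R) (c : bool) (s : st) : R :=
  if pure s is Some (c', a) then if c == c' then w ^+ a else 0 else 0.

Lemma phi_h (c : bool) s : phi (1 + c) s + phi 0 s = pw h c s.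
Proof. by apply: phi_pure; [exact: wt_h | case: c]. Qed.

Lemma phi_M (c : bool) s : phi (3 + c) s + phi 0 s = pw (ewt c) c s.
Proof. by apply: phi_pure; [exact: wt_M | case: c]. Qed.

Lemma sum_join_color d d' c s s' :
  \sum_(t <- join_color d d' c) peval t.2 * (phi t.1.1 s * phi t.1.2 s') =
  wt d c * wt d' c * ewt c * (pw h c s * pw h c s') +
  (d' == 5)%:R * (h * wt d c * (pw h c s * pw (ewt c) c s') +
                ewt c * wt d c * (pw h c s * pw h c s')) +
  (d == 5)%:R * (h * wt d' c * (pw (ewt c) c s * pw h c s') +
                ewt c * wt d' c * (pw h c s * pw h c s')).
Proof.
rewrite /join_color !big_cat sum_cross !pevalM peval_edge -!/(wt _ _) !phi_h.
rewrite -addrA; congr (_ + _); congr (_ + _).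
  case: (d' == 5); last by rewrite big_nil mul0r.
  rewrite big_cat !sum_cross !pevalM peval_edge peval_h -!/(wt _ _) !phi_h !phi_M.
  by rewrite mul1r.
case: (d == 5); last by rewrite big_nil mul0r.
rewrite big_cat !sum_cross !pevalM peval_edge peval_h -!/(wt _ _) !phi_h !phi_M.
by rewrite mul1r.
Qed.

Lemma sum_join_l d d' s s' :
  \sum_(t <- join_l d d') peval t.2 * (phi t.1.1 s * phi t.1.2 s') =
  h ^+ 2 * (phi d s * phi 0 s' + phi 0 s * phi d' s' + phi 0 s * phi 0 s') +
  (\sum_(t <- join_color d d' false) peval t.2 * (phi t.1.1 s * phi t.1.2 s') +
   \sum_(t <- join_color d d' true) peval t.2 * (phi t.1.1 s * phi t.1.2 s')).
Proof.
rewrite /join_l big_cat; congr (_ + _); last by rewrite big_cat.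
by rewrite !big_cons big_nil /= peval_hh addr0; ring.
Qed.

Lemma phi_pst1 d c : phi d (pst c 1) = wt d c.
Proof. by case: c; rewrite /phi orbT /= expr0 expr1 ?mul1r ?mulr1. Qed.

Lemma phi_fin d s : phi d (sfin s) = (d == 5)%:R.
Proof.
rewrite /phi orbF; case: eqP => // ->.
by rewrite !wt5 !expr1n mulr1.
Qed.

Lemma pw_st0 w c : pw w c st0 = 0. Proof. by []. Qed.

Lemma pw_pst w (c c' : bool) a : (0 < a)%N ->
  pw w c (pst c' a) = if c == c' then w ^+ a else 0.
Proof. by case: c'; case: a. Qed.

(** For monochromatic classes of equal colour with [a] and [b] vertices, the lists contribute
    multiples of h^(a+b), h^(1+a) and h^(1+b). All are divisible by h^2, and the quotients survive
    modulo [h] only for a = b = 1, a = 1 and b = 1, respectively. The error is written through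
    [jval] again, so that it can undergo later operations. *)
Lemma join_local s s' : exists J : seq (R * st * st), forall d d',
  \sum_(t <- join_l d d') peval t.2 * (phi t.1.1 s * phi t.1.2 s') =
  h ^+ 2 * (jval d d' (mt s s') + h * \sum_(t <- J) jval d d' t).
Proof.
have [s0|s0] := eqVneq s st0.
  exists [::] => d d'; rewrite big_nil mulr0 addr0 sum_join_l !sum_join_color.
  rewrite /mt s0 eqxx /= /jval /= !pw_st0 !phi_st0.
  rewrite [X in h ^+ 2 * X](_ : _ = phi d' s' + (phi 0 s' + phi 0 s')); last by ring.
  by rewrite (addrr2 char2); ring.
have [s'0|s'0] := eqVneq s' st0.
  exists [::] => d d'; rewrite big_nil mulr0 addr0 sum_join_l !sum_join_color.
  rewrite /mt s'0 eqxx orbT /= /jval /= !pw_st0 !phi_st0.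
  rewrite [X in h ^+ 2 * X](_ : _ = phi d s + (phi 0 s + phi 0 s)); last by ring.
  by rewrite (addrr2 char2); ring.
have base d d' : \sum_(t <- join_l d d') peval t.2 * (phi t.1.1 s * phi t.1.2 s') =
   \sum_(t <- join_color d d' false) peval t.2 * (phi t.1.1 s * phi t.1.2 s') +
   \sum_(t <- join_color d d' true) peval t.2 * (phi t.1.1 s * phi t.1.2 s').
  by rewrite sum_join_l !phi0 //; ring.
rewrite /mt (negPf s0) (negPf s'0) /=.
have zero d d' : (forall c w w', pw w c s * pw w' c s' = 0) ->
  \sum_(t <- join_l d d') peval t.2 * (phi t.1.1 s * phi t.1.2 s') = 0.
  by move=> pw0; rewrite base !sum_join_color !pw0; ring.
have nojoin : (forall c w w', pw w c s * pw w' c s' = 0) ->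
  exists J : seq (R * st * st), forall d d',
  \sum_(t <- join_l d d') peval t.2 * (phi t.1.1 s * phi t.1.2 s') =
  h ^+ 2 * (jval d d' (0, s, s') + h * \sum_(t <- J) jval d d' t).
  move=> pw0; exists [::] => d d'; rewrite (zero _ _ pw0) big_nil /jval /=; ring.
case ps: (pure s) => [[c a]|]; last first.
  by apply: nojoin => c w w'; rewrite /pw ps mul0r.
case ps': (pure s') => [[c' b]|]; last first.
  by apply: nojoin => c0 w w'; rewrite /pw ps' mulr0.
have [cc|cc] /= := eqVneq c c'; last first.
  apply: nojoin => c0 w w'; rewrite /pw ps ps'.
  case: (eqVneq c0 c) => [->|_]; last by rewrite mul0r.
  by rewrite (negPf cc) mulr0.
have [sE a0] := pureP ps; have [sE' b0] := pureP ps'; subst c'.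
pose W d d' := wt d c * wt d' c * ewt c * (h ^+ a * h ^+ b) +
  (d' == 5)%:R * (h * wt d c * (h ^+ a * ewt c ^+ b) + ewt c * wt d c * (h ^+ a * h ^+ b)) +
  (d == 5)%:R * (h * wt d' c * (ewt c ^+ a * h ^+ b) + ewt c * wt d' c * (h ^+ a * h ^+ b)).
have {base} base d d' : \sum_(t <- join_l d d') peval t.2 * (phi t.1.1 s * phi t.1.2 s') = W d d'.
  rewrite base !sum_join_color sE sE' !pw_pst //.
  rewrite /W; case: (c) => /=;
    move: (nat_of_bool _) (nat_of_bool _) => m m'; move: (m%:R) (m'%:R) => x y; ring.
rewrite {}/W in base.
case: a b a0 b0 base {ps ps' s0 s'0 zero nojoin} sE sE' => [|a] [|b] // _ _ base sE sE'.
case: a sE base => [|a] sE base; case: b sE' base => [|b] sE' base /=.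
(* Two single vertices: their edge comes from the first [cross], and in each of the two other lists
   the star and its correction coincide and cancel. *)
- exists [::] => d d'; rewrite base big_nil /jval /= sE sE' !phi_pst1 !expr1.
  move: (wt d c) (wt d' c) (ewt c) ((d == 5)%:R : R) ((d' == 5)%:R : R) h => A B e y x h.
  rewrite [LHS](_ : _ = h ^+ 2 * (e * (A * B) + h * 0) +
    (h ^+ 2 * (x * A * e + y * B * e) + h ^+ 2 * (x * A * e + y * B * e))); last by ring.
  by rewrite (addrr2 char2) addr0.
(* The states in the witness only encode factors: [pst c 1] evaluates to [wt d c], and [sfin s'] to
   the indicator of digit 5. *)
- exists [:: (ewt c * h ^+ b, pst c 1, pst c 1); (ewt c * h ^+ b, s, sfin s')] => d d'.
  rewrite base !big_cons big_nil /jval /= sE !phi_fin !phi_pst1 !expr1.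
  move: (wt d c) (wt d' c) (ewt c) ((d == 5)%:R : R) ((d' == 5)%:R : R) h => A B e y x h.
  rewrite [LHS](_ : _ = h ^+ 2 * (e ^+ b.+2 * (A * x) +
     h * (e * h ^+ b * (A * B) + (e * h ^+ b * (A * x) + 0))) +
    (y * h ^+ 2 * B * e * h ^+ b.+1 + y * h ^+ 2 * B * e * h ^+ b.+1)); last by rewrite !exprS; ring.
  by rewrite (addrr2 char2) addr0.
- exists [:: (ewt c * h ^+ a, pst c 1, pst c 1); (ewt c * h ^+ a, sfin s, s')] => d d'.
  rewrite base !big_cons big_nil /jval /= sE' !phi_fin !phi_pst1 !expr1.
  move: (wt d c) (wt d' c) (ewt c) ((d == 5)%:R : R) ((d' == 5)%:R : R) h => A B e y x h.
  rewrite [LHS](_ : _ = h ^+ 2 * (e ^+ a.+2 * (y * B) +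
     h * (e * h ^+ a * (A * B) + (e * h ^+ a * (y * B) + 0))) +
    (x * h ^+ 2 * A * e * h ^+ a.+1 + x * h ^+ 2 * A * e * h ^+ a.+1)); last by rewrite !exprS; ring.
  by rewrite (addrr2 char2) addr0.
(* With several vertices on both sides every summand is divisible by h^3, so that only errors
   remain. *)
exists [:: (ewt c * h ^+ (a + b).+1, pst c 1, pst c 1);
  (h ^+ a * ewt c ^+ b.+2 + ewt c * h ^+ (a + b).+1, pst c 1, sfin s');
  (h ^+ b * ewt c ^+ a.+2 + ewt c * h ^+ (a + b).+1, sfin s, pst c 1)] => d d'.
rewrite base !big_cons big_nil /jval /= !phi_fin !phi_pst1.
move: (wt d c) (wt d' c) (ewt c) ((d == 5)%:R : R) ((d' == 5)%:R : R) h => A B e y x h.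
rewrite !exprS exprD; ring.
Qed.

End Table.

(** * Expanding the tables over coloured vertex sets *)

Section Expansion.
Import GRing.Theory.
Local Open Scope ring_scope.
Variables N k : nat.
Notation R := {poly 'F_2}.
Notation u := (u N).
Notation h := (h N).
Notation phi := (@phi N).

Definition pf (tau : nat -> st) (q : nat -> nat) : R :=
  \prod_(l <- iota 0 k.+1) phi (q l) (tau l).

Definition term := (R * (nat -> st))%type.
Definition tv (t : term) (q : nat -> nat) : R := t.1 * pf t.2 q.

(** The invariant of the error terms: a function of this form is divisible by h^2 after a raw join,
    which fails for arbitrary functions of the index. *)
Definition span (f : (nat -> nat) -> R) : Prop :=
  exists J : seq term, forall q, f q = \sum_(t <- J) tv t q.

Lemma span0 : span (fun=> 0).
Proof. by exists [::] => q; rewrite big_nil. Qed.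

Lemma span_tv t : span (tv t).
Proof. by exists [:: t] => q; rewrite big_seq1. Qed.

Lemma spanD f g : span f -> span g -> span (fun q => f q + g q).
Proof. by case=> J fJ [J' gJ]; exists (J ++ J') => q; rewrite big_cat fJ gJ. Qed.

Lemma spanZ c f : span f -> span (fun q => c * f q).
Proof.
case=> J fJ; exists [seq (c * t.1, t.2) | t <- J] => q.
by rewrite fJ big_map mulr_sumr; apply: eq_bigr => t _; rewrite /tv /= mulrA.
Qed.

Lemma span_sum (I : Type) (r : seq I) (f : I -> (nat -> nat) -> R) :
  (forall i, span (f i)) -> span (fun q => \sum_(i <- r) f i q).
Proof.
move=> fS; elim: r => [|i r IH].
  by exists [::] => q; rewrite !big_nil.
by case: (spanD (fS i) IH) => J JE; exists J => q; rewrite big_cons JE.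
Qed.

Lemma eq_span f g : f =1 g -> span f -> span g.
Proof. by move=> fg [J JE]; exists J => q; rewrite -fg. Qed.

Lemma pfD tau tau' q :
  pf (fun l => st_add (tau l) (tau' l)) q = pf tau q * pf tau' q.
Proof. by rewrite /pf -big_split; apply: eq_bigr => l _; rewrite phiD. Qed.

Lemma spanM f g : span f -> span g -> span (fun q => f q * g q).
Proof.
case=> J fJ [J' gJ].
apply: (@eq_span (fun q => \sum_(t <- J) \sum_(t' <- J')
   tv (t.1 * t'.1, fun l => st_add (t.2 l) (t'.2 l)) q)).
  move=> q; rewrite fJ gJ mulr_suml; apply: eq_bigr => t _.
  by rewrite mulr_sumr; apply: eq_bigr => t' _; rewrite /tv /= pfD; ring.
by apply: span_sum => t; apply: span_sum => t'; apply: span_tv.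
Qed.

Definition st_relabel (i j : nat) (tau : nat -> st) : nat -> st := fun l =>
  if l == i then st0 else if l == j then st_add (tau i) (tau j) else tau l.

Definition upd_st (tau : nat -> st) (a : nat) (s : st) : nat -> st :=
  fun b => if b == a then s else tau b.

Definition pf_rest (i j : nat) (tau : nat -> st) (q : nat -> nat) : R :=
  \prod_(l <- iota 0 k.+1 | (l != i) && (l != j)) phi (q l) (tau l).

Lemma pf_split i j tau q : active k i j ->
  pf tau q = phi (q i) (tau i) * phi (q j) (tau j) * pf_rest i j tau q.
Proof.
case/and3P=> ik jk ij; rewrite /pf (bigD1_seq i) ?iota_uniq ?mem_iota //=.
rewrite -mulrA; congr (_ * _).
have ji : j \in [seq l <- iota 0 k.+1 | l != i] by rewrite mem_filter eq_sym ij mem_iota.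
have fu : uniq [seq l <- iota 0 k.+1 | l != i] by rewrite filter_uniq // iota_uniq.
rewrite -big_filter (bigD1_seq j ji fu); congr (_ * _); rewrite big_filter_cond; exact: eq_bigl.
Qed.

Lemma pf_rest_upd i j tau q a b s s' :
  pf_rest i j (upd_st (upd_st tau i s) j s') (upd (upd q i a) j b) = pf_rest i j tau q.
Proof.
by apply: eq_bigr => l /andP[li lj]; rewrite /upd /upd_st (negPf li) (negPf lj).
Qed.

(** Testing class [i] with the digit of [j] amounts to testing the merged class with it, because the
    functionals are multiplicative in the vertices. *)
Lemma pf_relabel i j tau q : active k i j ->
  pf tau (upd q i (q j)) = pf (st_relabel i j tau) q.
Proof.
move=> act; rewrite !(pf_split _ _ act) {1}/upd eqxx /st_relabel eqxx phi_st0 mul1r.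
have /negPf ji : j != i by case/and3P: act => _ _; rewrite eq_sym.
rewrite /upd ji eqxx phiD; congr (_ * _).
by apply: eq_bigr => l /andP[li lj]; rewrite (negPf li) (negPf lj).
Qed.

Lemma span_relabel i j f : active k i j -> span f ->
  span (fun q => f (upd q i (q j))).
Proof.
move=> act [J fJ].
apply: (@eq_span (fun q => \sum_(t <- J) tv (t.1, st_relabel i j t.2) q)).
  by move=> q; rewrite fJ; apply: eq_bigr => t _; rewrite /tv /= pf_relabel.
by apply: span_sum => t; apply: span_tv.
Qed.

Definition raw_join (i j : nat) (f : (nat -> nat) -> R) (q : nat -> nat) : R :=
  \sum_(t <- join_l (q i) (q j))
    peval N t.2 * f (upd (upd q i t.1.1) j t.1.2).

Definition join_term (i j : nat) (t : term) : term :=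
  let: (w, s, s') := mt N (t.2 i) (t.2 j) in (t.1 * w, upd_st (upd_st t.2 i s) j s').

(** This is [join_local] multiplied by the factors of the labels other than [i] and [j], which the
    join leaves alone. *)
Lemma raw_join_tv i j t : active k i j ->
  exists2 g, span g & forall q,
    raw_join i j (tv t) q = h ^+ 2 * (tv (join_term i j t) q + h * g q).
Proof.
move=> act; have [J JE] := join_local N (t.2 i) (t.2 j).
exists (fun q => \sum_(t' <- J) tv (t.1 * t'.1.1, upd_st (upd_st t.2 i t'.1.2) j t'.2) q).
  by apply: span_sum => t'; apply: span_tv.
move=> q.
have /negPf ji : j != i by case/and3P: act => _ _; rewrite eq_sym.
have /negPf ij : i != j by case/and3P: act.
have E w s s' : tv (t.1 * w, upd_st (upd_st t.2 i s) j s') q =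
   t.1 * pf_rest i j t.2 q * jval N (q i) (q j) (w, s, s').
  have updq : upd (upd q i (q i)) j (q j) = q.
    by apply: functional_extensionality => l; rewrite /upd; case: eqP => [->//|_]; case: eqP => [->|].
  rewrite /tv (pf_split _ _ act) /= -[X in pf_rest _ _ _ X]updq pf_rest_upd.
  by rewrite /jval /= /upd_st !eqxx ij; ring.
rewrite [X in X + h * _](_ : _ = t.1 * pf_rest i j t.2 q * jval N (q i) (q j) (mt N (t.2 i) (t.2 j))); last first.
  by rewrite /join_term; case: (mt _ _ _) => [[w s] s']; exact: E.
rewrite [in X in _ + X](eq_bigr (fun t' => t.1 * pf_rest i j t.2 q * jval N (q i) (q j) t')); last first.
  by move=> [[w s] s'] _; exact: E.
rewrite -mulr_sumr.
rewrite [RHS](_ : _ = t.1 * pf_rest i j t.2 q * (h ^+ 2 *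
   (jval N (q i) (q j) (mt N (t.2 i) (t.2 j)) + h * \sum_(t <- J) jval N (q i) (q j) t))); last by ring.
rewrite -JE mulr_sumr; apply: eq_bigr => -[[a b] w] _ /=.
have upd_id : upd_st (upd_st t.2 i (t.2 i)) j (t.2 j) = t.2.
  by apply: functional_extensionality => l; rewrite /upd_st; case: eqP => [->//|_]; case: eqP => [->|].
rewrite /tv (pf_split _ _ act) -[in pf_rest _ _ _ _]upd_id pf_rest_upd.
rewrite /upd !eqxx ij; ring.
Qed.

Lemma raw_join_sum (I : Type) (r : seq I) i j (f : I -> (nat -> nat) -> R) q :
  raw_join i j (fun q => \sum_(x <- r) f x q) q = \sum_(x <- r) raw_join i j (f x) q.
Proof.
by rewrite /raw_join exchange_big; apply: eq_bigr => t _; rewrite mulr_sumr.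
Qed.

Lemma raw_joinD i j f g q :
  raw_join i j (fun q => f q + g q) q = raw_join i j f q + raw_join i j g q.
Proof. by rewrite /raw_join -big_split; apply: eq_bigr => t _; rewrite mulrDr. Qed.

Lemma raw_joinZ i j c f q :
  raw_join i j (fun q => c * f q) q = c * raw_join i j f q.
Proof. by rewrite /raw_join mulr_sumr; apply: eq_bigr => t _; rewrite mulrCA. Qed.

(** Applied to the cofactor of [h] in an error term, it shows that dividing by h^2 does not consume
    that factor. *)
Lemma raw_join_span i j f : active k i j -> span f ->
  exists2 g, span g & forall q, raw_join i j f q = h ^+ 2 * g q.
Proof.
move=> act [J fJ].
have -> : f = (fun q => \sum_(t <- J) tv t q) by exact: functional_extensionality.
elim: J {f fJ} => [|t J [g gS gE]].
  exists (fun=> 0); first exact: span0.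
  by move=> q; rewrite raw_join_sum big_nil mulr0.
have [g' g'S g'E] := raw_join_tv t act.
exists (fun q => tv (join_term i j t) q + h * g' q + g q).
  apply: spanD => //; apply: spanD; first exact: span_tv.
  exact: spanZ.
move=> q; rewrite raw_join_sum big_cons g'E -raw_join_sum gE; ring.
Qed.

Lemma raw_join_expand (I : finType) (tm : I -> term) i j f g :
  active k i j -> span g ->
  (forall q, f q = \sum_x tv (tm x) q + h * g q) ->
  exists2 g', span g' & forall q,
    raw_join i j f q = h ^+ 2 * (\sum_x tv (join_term i j (tm x)) q + h * g' q).
Proof.
move=> act gS fE.
have -> : f = (fun q => \sum_x tv (tm x) q + h * g q) by exact: functional_extensionality.
have [g1 g1P] : exists g1 : I -> (nat -> nat) -> R, forall x, span (g1 x) /\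
   forall q, raw_join i j (tv (tm x)) q = h ^+ 2 * (tv (join_term i j (tm x)) q + h * g1 x q).
  apply: (@fin_all_exists _ (fun=> (nat -> nat) -> R) (fun x g1 => span g1 /\
   forall q, raw_join i j (tv (tm x)) q = h ^+ 2 * (tv (join_term i j (tm x)) q + h * g1 q))).
  by move=> x; have [g1 ? ?] := raw_join_tv (tm x) act; exists g1.
have [g2 g2S g2E] := raw_join_span act gS.
exists (fun q => \sum_x g1 x q + g2 q).
  by apply: spanD => //; apply: span_sum => x; case: (g1P x).
move=> q; rewrite raw_joinD raw_joinZ g2E raw_join_sum.
rewrite (eq_bigr _ (fun x _ => (g1P x).2 q)) -mulr_sumr big_split -mulr_sumr /=; ring.
Qed.

Lemma tjoin_expand (I : finType) (tm : I -> term) i j f g :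
  active k i j -> span g ->
  (forall q, f q = \sum_x tv (tm x) q + h * g q) ->
  exists2 g', span g' & forall q,
    tjoin N f i j q = \sum_x tv (join_term i j (tm x)) q + h * g' q.
Proof.
move=> act gS fE; have [g' g'S g'E] := raw_join_expand act gS fE.
exists g' => // q; rewrite /tjoin -/(raw_join i j f q) g'E.
by rewrite /h -exprM mulnC mulrC drop_polyMXn_id.
Qed.

Definition vert_term (o : option bool) : R :=
  if o is Some _ then vert_weight u o else 'X * u ^+ 2.

Definition vert_state (o : option bool) : st :=
  if o is Some c then pst c 1 else st0.

(** The main term contributed by a single colouring: the recurrence of [dp] with all multiples of
    [h] discarded, and with class states in place of table indices. *)
Fixpoint trm (P : rel nat) (e : cexpr) : (eval e -> option bool) -> term :=
  match e return (eval e -> option bool) -> term with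
  | Intro i => fun kp => (vert_term (kp tt), fun l => if l == i then vert_state (kp tt) else st0)
  | Relabel i j e1 => fun kp =>
      let t := @trm (later_relabel P i j) e1 kp in
      (t.1, if active k i j then st_relabel i j t.2 else t.2)
  | Join i j _ e1 => fun kp =>
      let t := @trm (later_join P i j) e1 kp in
      if active k i j && ~~ P i j then join_term i j t else t
  | Union e1 e2 => fun kp =>
      let t1 := @trm P e1 (fun x => kp (inl x)) in
      let t2 := @trm P e2 (fun x => kp (inr x)) in
      (t1.1 * t2.1, fun l => st_add (t1.2 l) (t2.2 l))
  end.

(** Unlike [all_k_labeled] this admits label 0, because [graph_expr] numbers the vertices from 0. *)
Fixpoint labels_le (e : cexpr) : Prop :=
  (forall x : eval e, label x <= k)%N /\
  match e with
  | Intro _ => True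
  | Relabel _ _ e1 => labels_le e1
  | Join _ _ _ e1 => labels_le e1
  | Union e1 e2 => labels_le e1 /\ labels_le e2
  end.

Lemma peval_leaf d : peval N (leaf_l d) =
  \sum_(o : option bool) vert_term o * phi d (vert_state o).
Proof.
rewrite /leaf_l -cat1s !peval_cat pevalM.
rewrite (bigD1 None) //= (bigD1 (Some true)) //= (bigD1 (Some false)) //=.
rewrite big1 ?addr0; last by case=> [[]|].
rewrite phi_st0 !(@phi_pst1 N d true, @phi_pst1 N d false) -!/(wt _ _ _) /peval !big_cons !big_nil /mexp /=.
rewrite !muln0 !addn0 !muln1 expr0 add0n exprD expr1 -!exprM [(N * 2)%N]mulnC.
ring.
Qed.

Lemma sum_ffun_union (V1 V2 T : finType) (F : (V1 + V2 -> T) -> R) :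
  \sum_(kp : {ffun V1 + V2 -> T}) F kp =
  \sum_(k1 : {ffun V1 -> T}) \sum_(k2 : {ffun V2 -> T})
    F (fun x => match x with inl a => k1 a | inr b => k2 b end).
Proof.
rewrite pair_big /=.
rewrite (reindex (fun p : {ffun V1 -> T} * {ffun V2 -> T} =>
   [ffun x : V1 + V2 => match x with inl a => p.1 a | inr b => p.2 b end])) /=.
  apply: eq_bigr => p _; congr F; apply: functional_extensionality => x.
  by rewrite ffunE.
exists (fun kp : {ffun V1 + V2 -> T} => ([ffun a => kp (inl a)], [ffun b => kp (inr b)])).
  move=> [k1 k2] _ /=; congr pair; apply/ffunP => a; by rewrite !ffunE.
by move=> kp _; apply/ffunP => -[a|b]; rewrite !ffunE.
Qed.

Lemma dp_expand e P : labels_le e -> exists2 g, span g & forall q,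
  dp N k P e q = \sum_(kp : {ffun eval e -> option bool}) tv (trm P kp) q + h * g q.
Proof.
elim: e P => [i|i j e1 IH|i j ij e1 IH|e1 IH1 e2 IH2] P /=.
- case=> /(_ tt) /= ik _; exists (fun=> 0); first exact: span0.
  move=> q; rewrite mulr0 addr0 peval_leaf.
  rewrite (reindex (fun kp : {ffun unit -> option bool} => kp tt)) /=; last first.
    exists (fun o => [ffun=> o]) => [kp _|o _]; last by rewrite ffunE.
    by apply/ffunP => -[]; rewrite ffunE.
  apply: eq_bigr => kp _; rewrite /tv /=; congr (_ * _).
  rewrite /pf (bigD1_seq i) ?iota_uniq ?mem_iota //= eqxx big1 ?mulr1 // => l /negPf->.
  exact: phi_st0.
- case=> _ /(IH (later_relabel P i j))[g gS gE].
  case act: (active k i j); last by exists g.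
  exists (fun q => g (upd q i (q j))); first exact: span_relabel.
  move=> q; rewrite gE; congr (_ + _); apply: eq_bigr => kp _.
  by rewrite /tv /= pf_relabel.
- case=> _ /(IH (later_join P i j))[g gS gE].
  case: ifP => [/andP[act _]|_]; last by exists g.
  exact: tjoin_expand gE.
case=> _ [/(IH1 P)[g1 g1S g1E] /(IH2 P)[g2 g2S g2E]].
pose A q := \sum_(kp : {ffun eval e1 -> option bool}) tv (trm P kp) q.
pose B q := \sum_(kp : {ffun eval e2 -> option bool}) tv (trm P kp) q.
exists (fun q => A q * g2 q + g1 q * B q + h * (g1 q * g2 q)).
  have AS : span A by apply: span_sum => kp; apply: span_tv.
  have BS : span B by apply: span_sum => kp; apply: span_tv.
  by apply: spanD; [apply: spanD; apply: spanM | apply: spanZ; apply: spanM].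
move=> q; rewrite g1E g2E -/(A q) -/(B q).
rewrite [X in _ = X + _](_ : _ = A q * B q); first by ring.
etransitivity; first exact: (sum_ffun_union (fun kp => tv (@trm P (Union e1 e2) kp) q)).
rewrite mulr_suml; apply: eq_bigr => k1 _; rewrite mulr_sumr; apply: eq_bigr => k2 _.
by rewrite /tv /= pfD; ring.
Qed.

End Expansion.

(** * Coefficients of the expansion *)

Section ColorCount.
Variables (V : finType) (lab : V -> nat).

Definition ccount (kp : V -> option bool) (c : bool) (l : nat) : nat :=
  #|[pred x | (kp x == Some c) && (lab x == l)]|.
Definition scount (S : V -> bool) (l : nat) : nat :=
  #|[pred x | S x && (lab x == l)]|.

Lemma scountE kp l :
  scount (fun x => isSome (kp x)) l = ccount kp false l + ccount kp true l.
Proof.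
rewrite /scount -(cardID [pred x | kp x == Some false]); congr (_ + _).
  by apply: eq_card => x; rewrite !inE; case: (kp x) => [[]|]; rewrite ?andbF ?andbT.
by apply: eq_card => x; rewrite !inE; case: (kp x) => [[]|]; rewrite ?andbF ?andbT.
Qed.

Definition new_pair (i j : nat) (x y : V) : bool :=
  ((lab x == i) && (lab y == j)) || ((lab x == j) && (lab y == i)).

Lemma new_consistent i j kp :
  consistent (new_pair i j) kp =
  ((ccount kp false i == 0) || (ccount kp true j == 0)) &&
  ((ccount kp true i == 0) || (ccount kp false j == 0)).
Proof.
apply/idP/idP => [/forallP H|H].
  have K c : (ccount kp c i == 0) || (ccount kp (~~ c) j == 0).
    rewrite -implyNb -lt0n; apply/implyP => /card_gt0P[x]; rewrite inE => /andP[/eqP kx xi].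
    apply: contraT; rewrite -lt0n => /card_gt0P[y]; rewrite inE => /andP[/eqP ky yj].
    have := forallP (H x) y; rewrite /new_pair xi yj /= kx ky /=.
    by case: c {kx ky}.
  by rewrite (K false) (K true).
have K c x y : lab x == i -> lab y == j -> kp x = Some c -> kp y = Some (~~ c) -> False.
  move=> xi yj kx ky.
  have a0 : 0 < ccount kp c i by apply/card_gt0P; exists x; rewrite inE kx eqxx.
  have b0 : 0 < ccount kp (~~ c) j by apply/card_gt0P; exists y; rewrite inE ky eqxx.
  by move: H; case: c a0 b0 {kx ky} => /=; lia.
apply/forallP => x; apply/forallP => y; apply/implyP => /orP[] /andP[xl yl].
  case kx: (kp x) => [c|] //; case ky: (kp y) => [d|] //=.
  by case: eqP => // cd; case: (K c x y xl yl kx); rewrite ky; move: cd; case: c d {kx ky} => [] [].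
case kx: (kp x) => [c|] //; case ky: (kp y) => [d|] //=.
by case: eqP => // cd; case: (K d y x yl xl ky); rewrite kx; move: cd; case: c d {kx ky} => [] [].
Qed.

Import GRing.Theory.
Local Open Scope ring_scope.

Lemma new_weight (R : comNzRingType) (u : R) i j kp c : i != j ->
  ccount kp (~~ c) i = 0%N -> ccount kp (~~ c) j = 0%N ->
  \prod_x \prod_y (if new_pair i j x y then pair_weight u (kp x) (kp y) else 1) =
  (half_edge u c ^+ 2) ^+ (ccount kp c i * ccount kp c j).
Proof.
move=> ij ci cj.
(* One of the two orientations of the new pairs. As [i != j], the orientations are disjoint, and
   together they supply the square of the half edge. *)
have half a b : a != b -> ccount kp (~~ c) a = 0%N -> ccount kp (~~ c) b = 0%N ->
  \prod_x \prod_y (if (lab x == a) && (lab y == b) then pair_weight u (kp x) (kp y) else 1)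
  = half_edge u c ^+ (ccount kp c a * ccount kp c b).
  move=> ab ca cb.
  have only l x : ccount kp (~~ c) l = 0%N -> lab x == l -> isSome (kp x) -> kp x = Some c.
    move=> /eqP cl xl; case kx: (kp x) => [d|] // _; congr Some.
    apply/eqP; apply: contraTT cl => dc; rewrite -lt0n; apply/card_gt0P; exists x.
    by rewrite inE kx xl andbT; move: dc; case: c d {kx ca cb ci cj} => [] [].
  rewrite mulnC exprM -[RHS]prodr_const [RHS]big_mkcond; apply: eq_bigr => x _ /=.
  rewrite inE; case xa: (lab x == a); last first.
    by rewrite andbF big1.
  case kx: (kp x) => [d|]; last by rewrite big1 // => y _; case: ifP.
  have [->] : Some d = Some c by rewrite -kx; apply: (only a); rewrite ?kx.
  rewrite eqxx -prodr_const [RHS]big_mkcond; apply: eq_bigr => y _ /=.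
  rewrite inE; case yb: (lab y == b); last by rewrite andbF.
  case ky: (kp y) => [d'|] //=.
  have [->] : Some d' = Some c by rewrite -ky; apply: (only b); rewrite ?ky.
  by rewrite eqxx.
rewrite -exprM [(2 * _)%N]mulnC exprM expr2.
rewrite -{1}(half i j) // [X in _ ^+ X]mulnC -(half j i) 1?eq_sym //.
rewrite -big_split; apply: eq_bigr => x _; rewrite -big_split; apply: eq_bigr => y _ /=.
rewrite /new_pair; case xi: (lab x == i) => /=.
  have /negPf -> : lab x != j by rewrite (eqP xi).
  by rewrite /= orbF mulr1.
by rewrite mul1r.
Qed.

End ColorCount.

(** * Main terms as weights of consistent colourings *)

Section Semantics.
Import GRing.Theory.
Local Open Scope ring_scope.
Variables N k : nat.
Notation R := {poly 'F_2}.
Notation u := (u N).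
Notation h := (h N).
Notation trm := (@trm N k).

Lemma mt_counts s s' : ((mt N s s').1.2.1 = s.1) * ((mt N s s').2.1 = s'.1).
Proof.
rewrite /mt; case: ifP => // _; case: (pure s) => [[c a]|] //.
case: (pure s') => [[c' b]|] //; case: ifP => // _.
by case: ifP => _; [case: ifP | case: ifP].
Qed.

(** The hypotheses on the flags make [st0] the only state without vertices, which is what [mt] tests
    for. *)
Lemma mt_empty (s s' : st) : (s.2 -> 1 < s.1.1 + s.1.2)%N -> (s'.2 -> 1 < s'.1.1 + s'.1.2)%N ->
  (s.1.1 + s.1.2 == 0)%N || (s'.1.1 + s'.1.2 == 0)%N -> mt N s s' = (1, s, s').
Proof.
rewrite /mt; case: s s' => [[a a'] f] [[b b'] f'] /= H H' H0.
suff -> : ((a, a', f) == st0) || ((b, b', f') == st0) by [].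
case: f H => H; case: f' H' => H'; case/orP: H0 => H0;
  do ?[by have := H isT; rewrite (eqP H0)]; do ?[by have := H' isT; rewrite (eqP H0)];
  by move: H0; rewrite addn_eq0 => /andP[/eqP-> /eqP->]; rewrite eqxx ?orbT.
Qed.

(** For nonempty classes, [nc] (no bichromatic edge between them) forces both to be monochromatic of
    the same colour, which [0 < s.1.2] reads off. *)
Lemma mt_join (s s' : st) : (0 < s.1.1 + s.1.2)%N -> (0 < s'.1.1 + s'.1.2)%N ->
  let nc := ((s.1.1 == 0) || (s'.1.2 == 0)) && ((s.1.2 == 0) || (s'.1.1 == 0)) in
  let a := (s.1.1 + s.1.2)%N in let b := (s'.1.1 + s'.1.2)%N in
  if [&& nc, ~~ s.2, ~~ s'.2 & (a == 1) || (b == 1)] then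
    [/\ (mt N s s').1.1 = ewt N (0 < s.1.2)%N ^+ (a * b)%N,
        (mt N s s').1.2.2 = (1 < a)%N & (mt N s s').2.2 = (1 < b)%N]
  else (mt N s s').1.1 = 0.
Proof.
rewrite /mt; case: s s' => [[a a'] f] [[b b'] f'] /= ha hb.
have -> : ((a, a', f) == st0) || ((b, b', f') == st0) = false.
  by apply/negP => /orP[] /eqP[] *; subst.
case: f; first by rewrite andbF.
case: f'.
  rewrite /= !andbF; case: a a' {ha} => [|a] [|a'] //=.
case: a a' b b' ha hb => [|a] [|a'] // [|b] [|b'] //= _ _; rewrite ?addn0 ?add0n //.
- by case: a' => [|a'] /=; case: b' => [|b'] //=; rewrite ?mul1n ?muln1.
- by case: a => [|a] /=; case: b => [|b] //=; rewrite ?mul1n ?muln1.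
Qed.

(* What the recurrence does to the vertex set [S] independently of the colours:
   whether [S] survives all joins, and which classes get flagged. *)
Fixpoint okf (P : rel nat) (e : cexpr) : (eval e -> bool) -> bool * (nat -> bool) :=
  match e return (eval e -> bool) -> bool * (nat -> bool) with
  | Intro i => fun S => (true, fun l => false)
  | Relabel i j e1 => fun S =>
      let r := @okf (later_relabel P i j) e1 S in
      (r.1, if active k i j then
        fun l => if l == i then false else if l == j then r.2 i || r.2 j else r.2 l
        else r.2)
  | Join i j _ e1 => fun S =>
      let r := @okf (later_join P i j) e1 S in
      let a := scount (@label (eval e1)) S i in
      let b := scount (@label (eval e1)) S j in
      if [|| ~~ active k i j, P i j, a == 0%N | b == 0%N] then r else
      ([&& r.1, ~~ r.2 i, ~~ r.2 j & (a == 1%N) || (b == 1%N)],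
       fun l => if l == i then (1 < a)%N || r.2 i
                else if l == j then (1 < b)%N || r.2 j else r.2 l)
  | Union e1 e2 => fun S =>
      let r1 := @okf P e1 (fun x => S (inl x)) in
      let r2 := @okf P e2 (fun x => S (inr x)) in
      (r1.1 && r2.1, fun l => r1.2 l || r2.2 l)
  end.

(** The edges already accounted for at this node: those between classes that are joined again later
    are left to the last such join. At the root [P] is empty and all edges count. *)
Definition edgeP (P : rel nat) (e : cexpr) : rel (eval e) :=
  fun x y => adj x y && ~~ P (label x) (label y).

Definition pair_prod (V : finType) (E : rel V) (kp : V -> option bool) : R :=
  \prod_x \prod_y (if E x y then pair_weight u (kp x) (kp y) else 1).

Definition full_weight (V : finType) (E : rel V) (kp : V -> option bool) : R :=
  (\prod_x vert_term N (kp x)) * pair_prod E kp.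

Lemma scount_relabel (V : finType) (lab : V -> nat) (S : V -> bool) i j l : i != j ->
  scount (fun x => if lab x == i then j else lab x) S l =
  (if l == i then 0 else if l == j then scount lab S i + scount lab S j
   else scount lab S l)%N.
Proof.
move=> ij; rewrite /scount; case: (eqVneq l i) => [->|li].
  apply: eq_card0 => x; rewrite !inE; case: (eqVneq (lab x) i) => [_|/negPf xi].
    by rewrite eq_sym (negPf ij) andbF.
  by rewrite xi andbF.
case: (eqVneq l j) => [->|lj]; last first.
  apply: eq_card => x; rewrite !inE; case: (eqVneq (lab x) i) => [->|//].
  by rewrite eq_sym (negPf lj) eq_sym (negPf li).
rewrite -[LHS](cardID [pred x | lab x == i]); congr (_ + _)%N; apply: eq_card => x; rewrite !inE.
  by case: (lab x == i); rewrite ?eqxx ?andbT ?andbF.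
by case xi: (lab x == i) => //=; rewrite (eqP xi) (negPf ij) andbF.
Qed.

Lemma scount_relabel_noop (V : finType) (lab : V -> nat) (S : V -> bool) i j l :
  (i = j \/ forall x, lab x != i) ->
  scount (fun x => if lab x == i then j else lab x) S l = scount lab S l.
Proof.
move=> H; apply: eq_card => x; rewrite !inE; case: (lab x =P i) => // xi.
by case: H => [ij|/(_ x)]; rewrite xi ?eqxx // ij.
Qed.

Lemma scount_union (V1 V2 : finType) (l1 : V1 -> nat) (l2 : V2 -> nat) (S : V1 + V2 -> bool) l :
  scount (fun x => match x with inl a => l1 a | inr b => l2 b end) S l =
  (scount l1 (fun a => S (inl a)) l + scount l2 (fun b => S (inr b)) l)%N.
Proof.
rewrite /scount -!sum1_card big_mkcond big_sumType /=.
by congr (_ + _)%N; rewrite -big_mkcond.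
Qed.

Lemma labels_le_top e : labels_le k e -> forall x : eval e, (label x <= k)%N.
Proof. by case: e => [?|???|????|??] []. Qed.

Lemma label_absent e i j : labels_le k (Relabel i j e) -> active k i j = false ->
  i = j \/ forall x : eval e, label x != i.
Proof.
case=> H /= /labels_le_top He1 act.
case: (eqVneq i j) => [->|ij]; first by left.
right => x; apply/eqP => xi; move: act; rewrite /active ij andbT.
have := H x; rewrite /= xi eqxx => ->.
by have := He1 x; rewrite xi => ->.
Qed.

Lemma okf_scount e P S l : labels_le k e ->
  (okf P S).2 l -> (1 < scount (@label (eval e)) S l)%N.
Proof.
elim: e P S l => [i|i j e1 IH|i j ij e1 IH|e1 IH1 e2 IH2] P S l //.
- move=> He; have He1 : labels_le k e1 by case: He.
  rewrite /=; case act: (active k i j).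
    have ij : i != j by case/and3P: act.
    rewrite scount_relabel //; case: ifP => // li; case: ifP => // lj; last exact: IH.
    by case/orP => /(IH _ _ _ He1) => H; apply: leq_trans H _; [exact: leq_addr|exact: leq_addl].
  rewrite scount_relabel_noop; first exact: IH.
  exact: label_absent He act.
- case=> _ He1 /=; case: ifP => _; first exact: IH.
  rewrite /=; case: (eqVneq l i) => [->|_]; first by case/orP => //; exact: IH.
  by case: (eqVneq l j) => [->|_]; [case/orP => //; exact: IH | exact: IH].
case=> _ [He1 He2] /=; rewrite scount_union.
by case/orP => [/(IH1 _ _ _ He1)|/(IH2 _ _ _ He2)] => H; apply: leq_trans H _;
  [exact: leq_addr|exact: leq_addl].
Qed.

Lemma consistentU (V : finType) (E E1 E2 : rel V) kp :
  (forall x y, E x y = E1 x y || E2 x y) ->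
  consistent E kp = consistent E1 kp && consistent E2 kp.
Proof.
move=> EE; apply/forallP/andP => [H|[/forallP H1 /forallP H2] x].
  by split; apply/forallP => x; apply/forallP => y; apply/implyP => xy;
    have := forallP (H x) y; rewrite EE xy ?orbT.
apply/forallP => y; rewrite EE; apply/implyP => /orP[] xy.
  by have := forallP (H1 x) y; rewrite xy.
by have := forallP (H2 x) y; rewrite xy.
Qed.

Lemma pair_prodU (V : finType) (E E1 E2 : rel V) kp :
  (forall x y, E x y = E1 x y || E2 x y) -> (forall x y, ~~ (E1 x y && E2 x y)) ->
  pair_prod E kp = pair_prod E1 kp * pair_prod E2 kp.
Proof.
move=> EE E12; rewrite /pair_prod -big_split; apply: eq_bigr => x _.
rewrite -big_split; apply: eq_bigr => y _ /=; rewrite EE.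
by case: (E1 x y) (E2 x y) (E12 x y) => [] [] //= _; rewrite ?mul1r ?mulr1.
Qed.

(** Below the join, [later_join] hides every pair between the classes [i] and [j], even edges that
    exist already; so the two parts are disjoint and no edge weight is squared. *)
Lemma edgeP_join P i j (ij : i != j) e x y : (forall a b, P a b = P b a) ->
  @edgeP P (Join ij e) x y =
  @edgeP (later_join P i j) e x y ||
  (~~ P i j && new_pair (@label (eval e)) i j x y).
Proof.
move=> Psym; rewrite /edgeP /later_join /new_pair.
have -> : @adj (eval (Join ij e)) x y = [|| @adj (eval e) x y,
   (@label (eval e) x == i) && (@label (eval e) y == j) |
   (@label (eval e) x == j) && (@label (eval e) y == i)] by [].
set A := @adj (eval e) x y.
change (@label (eval (Join ij e))) with (@label (eval e)).
case xl: ((label x == i) && (label y == j)) => /=.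
  by case/andP: xl => /eqP-> /eqP->; case: (A); case: (P i j).
case xl': ((label x == j) && (label y == i)) => /=.
  by case/andP: xl' => /eqP-> /eqP->; rewrite (Psym j i); case: (A); case: (P i j).
by rewrite !orbF andbF orbF.
Qed.

Lemma later_relabel_sym P i j : (forall a b, P a b = P b a) ->
  forall a b, later_relabel P i j a b = later_relabel P i j b a.
Proof. by move=> Psym a b; apply: Psym. Qed.

Lemma later_join_sym P i j : (forall a b, P a b = P b a) ->
  forall a b, later_join P i j a b = later_join P i j b a.
Proof.
move=> Psym a b; rewrite /later_join Psym; congr (_ || _).
by rewrite orbC andbC [X in _ || X]andbC.
Qed.

Lemma consistent_union P e1 e2 (kp : eval (Union e1 e2) -> option bool) :
  consistent (@edgeP P (Union e1 e2)) kp =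
  consistent (@edgeP P e1) (fun x => kp (inl x)) &&
  consistent (@edgeP P e2) (fun x => kp (inr x)).
Proof.
apply/forallP/andP => [H|[/forallP H1 /forallP H2] [] x]; last 2 first.
- apply/forallP => -[] y //; exact: (forallP (H1 x) y).
- apply/forallP => -[] y //; exact: (forallP (H2 x) y).
split; apply/forallP => x; apply/forallP => y.
  exact: (forallP (H (inl x)) (inl y)).
exact: (forallP (H (inr x)) (inr y)).
Qed.

Lemma full_weight_union P e1 e2 (kp : eval (Union e1 e2) -> option bool) :
  full_weight (@edgeP P (Union e1 e2)) kp =
  full_weight (@edgeP P e1) (fun x => kp (inl x)) *
  full_weight (@edgeP P e2) (fun x => kp (inr x)).
Proof.
rewrite /full_weight /pair_prod big_sumType /= [X in _ * X = _]big_sumType /=.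
under [X in _ * (X * _) = _]eq_bigr => x _.
  rewrite big_sumType /= [X in _ * X]big1 ?mulr1 //; over.
under [X in _ * (_ * X) = _]eq_bigr => x _.
  rewrite big_sumType /= [X in X * _]big1 ?mul1r //; over.
set a := \prod_i vert_term _ _; set b := \prod_i vert_term _ _.
by rewrite mulrACA.
Qed.

(** The verdict and the flags of [okf] depend on the vertex set alone. Summing over the colourings
    of a fixed set hence gives the verdict times a full [cut_sum]. *)
Lemma trm_spec e P (kp : eval e -> option bool) :
  (forall a b, P a b = P b a) -> labels_le k e ->
  let t := trm P kp in let r := okf P (fun x => isSome (kp x)) in
  (forall l, (t.2 l).1 = (scount (@label (eval e)) (fun x => kp x == Some false) l,
                          scount (@label (eval e)) (fun x => kp x == Some true) l)) /\
  (if r.1 && consistent (@edgeP P e) kp then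
     t.1 = full_weight (@edgeP P e) kp /\ (forall l, (t.2 l).2 = r.2 l)
   else t.1 = 0).
Proof.
elim: e P kp => [i|i j e1 IH|i j ij e1 IH|e1 IH1 e2 IH2] P kp Psym He.
- split=> [l|].
    rewrite /=; have E c : scount (fun=> i) (fun x => kp x == Some c) l =
        ((kp tt == Some c) && (l == i)) :> nat.
      rewrite (eq_sym l) /scount; case E: ((kp tt == Some c) && (i == l)).
        by apply: etrans (card1 tt); apply: eq_card => -[]; rewrite !inE E.
      by apply: eq_card0 => -[]; rewrite !inE E.
    by rewrite !E; case: (l == i); rewrite ?andbF //; case: (kp tt) => [[]|].
  rewrite [okf _ _]/= andTb.
  have -> : consistent (edgeP P (e:=Intro i)) kp.
    by apply/forallP => x; apply/forallP => y.
  split=> [|l] /=; last by case: (l == i) => //; case: (kp tt) => [[]|].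
  rewrite /full_weight /pair_prod [X in _ * X]big1 ?mulr1.
    by rewrite (bigD1 tt) //= big1 ?mulr1 // => -[].
  by move=> x _; rewrite big1.
- have He1 : labels_le k e1 by case: He.
  have [C W] := IH (later_relabel P i j) kp (later_relabel_sym i j Psym) He1.
  split=> [l|]; last first.
    rewrite -/(consistent (@edgeP (later_relabel P i j) e1) kp) in W *.
    move: W; rewrite [okf P _]/=; case: ifP => // _ [W F]; split=> // l /=.
    rewrite /st_relabel; case: ifP => // _; case: ifP => // _.
    by case: ifP => _; rewrite /= ?F.
  rewrite /=; case act: (active k i j); last first.
    by rewrite C !scount_relabel_noop //; exact: label_absent He act.
  have ij : i != j by case/and3P: act.
  rewrite !scount_relabel // /st_relabel.
  by case: ifP => // _; case: ifP => // _; rewrite /= !C.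
- have He1 : labels_le k e1 by case: He.
  have [C W] := IH (later_join P i j) kp (later_join_sym i j Psym) He1.
  set lab := @label (eval e1) in C W *.
  have EE x y := @edgeP_join P i j ij e1 x y Psym.
  rewrite [trm _ _]/= [okf _ _]/= -/lab.
  set S := (fun x => isSome (kp x)) in W *.
  set t := trm _ _ in C W *; set r := okf _ _ in W *.
  pose E1 := @edgeP (later_join P i j) e1.
  pose E2 : rel (eval e1) := fun x y => ~~ P i j && new_pair lab i j x y.
  have cU : consistent (@edgeP P (Join ij e1)) kp = consistent E1 kp && consistent E2 kp.
    exact: consistentU.
  have wU : full_weight (@edgeP P (Join ij e1)) kp = full_weight E1 kp * pair_prod E2 kp.
    have pU : pair_prod (@edgeP P (Join ij e1)) kp = pair_prod E1 kp * pair_prod E2 kp.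
      apply: pair_prodU => x y; first exact: EE.
      rewrite /E1 /E2 /edgeP /later_join /new_pair -/lab.
      by apply/negP => /andP[/andP[_ /norP[_ np]] /andP[_ n2]]; exact: (negP np n2).
    by rewrite /full_weight pU mulrA.
  (* A join without an edge between kept vertices affects neither consistency nor weight; this
     covers inactive joins, skipped ones, and empty classes. *)
  have trivial2 : (forall x y, E2 x y -> kp x = None \/ kp y = None) ->
      consistent E2 kp /\ pair_prod E2 kp = 1.
    move=> H; split.
      apply/forallP => x; apply/forallP => y; apply/implyP => /H[] ->//.
      by case: (kp x).
    rewrite /pair_prod big1 // => x _; rewrite big1 // => y _.
    by case: ifP => // /H[] ->//; case: (kp x).
  have skip : (forall x y, E2 x y -> kp x = None \/ kp y = None) ->
     if r.1 && consistent (@edgeP P (Join ij e1)) kp then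
       t.1 = full_weight (@edgeP P (Join ij e1)) kp /\ (forall l, (t.2 l).2 = r.2 l)
     else t.1 = 0.
    by move=> /trivial2[c2 p2]; rewrite cU wU c2 p2 andbT mulr1.
  case act: (active k i j) => /=; last first.
    split; first exact: C.
    apply: skip => x y /andP[_ xy]; exfalso.
    move: act; rewrite /active ij andbT => /negP; apply.
    have := labels_le_top He1 x; have := labels_le_top He1 y; rewrite -/lab.
    by case/orP: xy => /andP[/eqP-> /eqP->] -> ->.
  case Pij: (P i j) => /=.
    by split; [exact: C | apply: skip => x y; rewrite /E2 Pij].
  have fin2 l : r.1 && consistent E1 kp -> (t.2 l).2 -> (1 < (t.2 l).1.1 + (t.2 l).1.2)%N.
    move=> rc; move: W; rewrite -/E1 rc => -[_ F].
    by rewrite F C /= -scountE; exact: okf_scount.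
  have cnt l : ((t.2 l).1.1 + (t.2 l).1.2)%N = scount lab S l by rewrite C /= -scountE.
  rewrite /join_term; case mtE: (mt _ _ _) => [[w s] s'] /=.
  have [sE s'E] : s.1 = (t.2 i).1 /\ s'.1 = (t.2 j).1.
    by have := mt_counts (t.2 i) (t.2 j); rewrite mtE => -[].
  split.
    move=> l; rewrite /upd_st; case: eqP => [->|_]; first by rewrite s'E C.
    by case: eqP => [->|_]; [rewrite sE C | exact: C].
  have noS l : scount lab S l = 0%N -> forall x, lab x == l -> kp x = None.
    move/eqP => Sl x xl; case kx: (kp x) => [c|] //; exfalso.
    move: Sl; apply/negP; rewrite -lt0n; apply/card_gt0P; exists x.
    by rewrite inE xl /S kx.
  have [rc1|rc1] := boolP (r.1 && consistent E1 kp); last first.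
    have t0 : t.1 = 0 by move: W; rewrite -/E1 (negPf rc1).
    have -> : (if (scount lab S i == 0%N) || (scount lab S j == 0%N) then r
      else ([&& r.1, ~~ r.2 i, ~~ r.2 j & (scount lab S i == 1%N) || (scount lab S j == 1%N)],
       fun l => if l == i then (1 < scount lab S i)%N || r.2 i
                else if l == j then (1 < scount lab S j)%N || r.2 j else r.2 l)).1
       && consistent (@edgeP P (Join ij e1)) kp = false.
      apply/negbTE; apply: contra rc1; rewrite cU.
      by case: ifP => _ /andP[r1 /andP[-> _]]; rewrite andbT //; case/andP: r1.
    by rewrite t0 mul0r.
  have fi := fin2 i rc1; have fj := fin2 j rc1.
  case zero: ((scount lab S i == 0%N) || (scount lab S j == 0%N)).
    move: (mt_empty fi fj); rewrite !cnt zero mtE => /(_ isT)[-> -> ->].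
    rewrite mulr1.
    have -> : upd_st (upd_st t.2 i (t.2 i)) j (t.2 j) = t.2.
      by apply: functional_extensionality => l; rewrite /upd_st; case: eqP => [->//|_]; case: eqP => [->|].
    apply: skip => x y; rewrite /E2 Pij /= => xy.
    case/orP: zero => /eqP /noS z; case/orP: xy => /andP[xi yj];
      by [left; apply: z | right; apply: z].
  move: (W); rewrite -/E1 rc1 => -[tW tF].
  case/andP: (rc1) => r1 c1.
  have /norP[a0 b0] := negbT zero; rewrite -!lt0n -!cnt in a0 b0.
  have := mt_join a0 b0; rewrite mtE cnt cnt !tF !C /=.
  have E2E : E2 =2 new_pair lab i j by move=> x y; rewrite /E2 Pij.
  have c2E : consistent E2 kp = consistent (new_pair lab i j) kp.
    by apply: eq_forallb => x; apply: eq_forallb => y; rewrite E2E.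
  rewrite cU c1 c2E new_consistent r1 /=.
  have cE c l : scount lab (fun x => kp x == Some c) l = ccount lab kp c l by [].
  rewrite !cE.
  set nc := (_ || _) && (_ || _); rewrite [nc && _]andbC.
  rewrite -!andbA; case: ifP => [|_ ->]; last by rewrite mulr0.
  case/and4P=> nfi nfj ab1 ncT [wE fs fs'] /=; split.
    rewrite wU -tW wE; congr (_ * _).
    rewrite /pair_prod; under eq_bigr => x _ do under eq_bigr => y _ do rewrite E2E.
    rewrite !scountE.
    move: a0 b0 ncT; rewrite !C /= !cE /nc.
    case ciE: (ccount lab kp true i) => [|m] a0 b0 ncT.
      have cj : ccount lab kp true j = 0%N by case/andP: ncT => /orP[/eqP z|/eqP->] _ //; move: a0; rewrite z.
      by rewrite (@new_weight _ _ _ _ _ _ _ false) // cj !addn0.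
    have [ci cj] : ccount lab kp false i = 0%N /\ ccount lab kp false j = 0%N.
      case/andP: ncT => n1 /orP[//|/eqP cj]; split=> //; move: b0; rewrite cj.
      by case/orP: n1 => /eqP ->.
    by rewrite (@new_weight _ _ _ _ _ _ _ true) // ci cj !add0n ciE.
  move=> l; rewrite /upd_st; case: (eqVneq l j) => [->|lj].
    by rewrite eq_sym (negPf ij) fs' (negPf nfj) orbF.
  by case: (eqVneq l i) => [_|_]; rewrite ?tF // fs (negPf nfi) orbF.
have [He1 He2] : labels_le k e1 /\ labels_le k e2 by case: He => _ [].
have [C1 W1] := IH1 P (fun x => kp (inl x)) Psym He1.
have [C2 W2] := IH2 P (fun x => kp (inr x)) Psym He2.
split.
  by move=> l; rewrite /= C1 C2 /= !scount_union.
rewrite consistent_union full_weight_union [okf _ _]/= [trm _ _]/=.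
set r1 := okf _ _ in W1 *; set r2 := okf _ _ in W2 *.
case: ifP W1; last first.
  move=> /nandP H -> ; case: ifP => [|_]; last by rewrite mul0r.
  by case/and3P => /andP[r1T _] c1; case: H; rewrite ?r1T ?c1.
case/andP=> r1T c1 [-> F1]; case: ifP W2; last first.
  move=> /nandP H -> ; case: ifP => [|_]; last by rewrite mulr0.
  by case/and3P => /andP[_ r2T] _ c2; case: H; rewrite ?r2T ?c2.
by case/andP=> r2T c2 [-> F2]; rewrite r1T r2T c1 c2; split=> // l /=; rewrite F1 F2.
Qed.

End Semantics.

(** * Vertex sets discarded by the recurrence contain a 4-cycle *)

Definition C4_free (V : Type) (E : rel V) (S : V -> bool) : Prop :=
  forall a b x y, a <> b -> x <> y -> S a -> S b -> S x -> S y ->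
    E a x -> E a y -> E b x -> E b y -> False.

(* The meaning of a flag: one more join with a nonempty class would close a
   4-cycle. *)
Definition twins (V : Type) (E : rel V) (S : V -> bool) (lab : V -> nat) (l : nat) : Prop :=
  exists a b x, [/\ a <> b, S a, S b & S x] /\ [/\ lab a = l, lab b = l, E a x & E b x].

Lemma scount_gt1 (V : finType) (lab : V -> nat) S l :
  1 < scount lab S l -> exists a b, [/\ a <> b, S a, S b, lab a = l & lab b = l].
Proof.
case/card_gt1P => a [b []]; rewrite !inE => /andP[Sa /eqP la] /andP[Sb /eqP lb] /eqP ab.
by exists a, b.
Qed.

Lemma scount_gt0 (V : finType) (lab : V -> nat) S l :
  0 < scount lab S l -> exists a, S a /\ lab a = l.
Proof. by case/card_gt0P => a; rewrite !inE => /andP[Sa /eqP la]; exists a. Qed.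

(** A join rejects [S] in two cases. If both classes have two vertices, it creates a complete
    bipartite graph containing a 4-cycle. If a class is flagged, two of its vertices already have a
    common neighbour, and any vertex of the other class becomes a second one. *)
Lemma okf_C4_free k e P (S : eval e -> bool) :
  (forall a b, P a b = P b a) -> labels_le k e -> C4_free (@edgeP P e) S ->
  (okf k P S).1 /\
  forall l, (okf k P S).2 l -> twins (@edgeP P e) S (@label (eval e)) l.
Proof.
elim: e P S => [i|i j e1 IH|i j ij e1 IH|e1 IH1 e2 IH2] P S Psym He C4.
- by split.
- have He1 : labels_le k e1 by case: He.
  have [O T] := IH (later_relabel P i j) S (later_relabel_sym i j Psym) He1 C4.
  split=> //= l; case act: (active k i j).
    have /negPf ji : j != i by case/and3P: act => _ _; rewrite eq_sym.
    have [//|li] := eqVneq l i; have [->|lj] := eqVneq l j.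
      by case/orP => /T[a [b [x [? [la lb ? ?]]]]]; exists a, b, x; split=> //;
        split=> //=; rewrite ?la ?lb ?eqxx ?ji.
    move/T=> [a [b [x [? [la lb ? ?]]]]]; exists a, b, x; split=> //.
    by split=> //=; rewrite ?la ?lb (negPf li).
  move/T=> [a [b [x [? [la lb ax bx]]]]]; exists a, b, x; split=> //.
  have idl (z : eval e1) : (if label z == i then j else label z) = label z.
    have [<-|/(_ z)/negPf ->//] := label_absent He act.
    by case: (label z =P i) => [->|].
  by split=> //=; rewrite idl.
- have He1 : labels_le k e1 by case: He.
  pose E1 := @edgeP (later_join P i j) e1.
  have EE x y := @edgeP_join P i j ij e1 x y Psym.
  have sub x y : E1 x y -> @edgeP P (Join ij e1) x y by rewrite EE => xy; apply/orP; left.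
  have C41 : C4_free E1 S.
    by move=> a b x y ab xy Sa Sb Sx Sy *; apply: (C4 a b x y) => //; exact: sub.
  have [O T] := IH (later_join P i j) S (later_join_sym i j Psym) He1 C41.
  have T' l : (@okf k (later_join P i j) e1 S).2 l ->
      twins (@edgeP P (Join ij e1)) S (@label (eval e1)) l.
    move=> fl; have [a [b [x [? [? ? ? ?]]]]] := T l fl.
    by exists a, b, x; split=> //; split=> //; apply: sub.
  rewrite [okf _ _ _]/=; case: ifP => [_|/norP[/negbNE act /norP[nP /norP[a0 b0]]]]; first by split.
  have new x y : label x = i -> label y = j -> @edgeP P (Join ij e1) x y.
    by move=> xi yj; rewrite EE nP /new_pair xi yj !eqxx orbT.
  have new' x y : label x = i -> label y = j -> @edgeP P (Join ij e1) y x.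
    by move=> xi yj; rewrite EE nP /new_pair xi yj !eqxx !orbT.
  have old x y : E1 x y -> ~ new_pair (@label (eval e1)) i j x y.
    by rewrite /E1 /edgeP /later_join => /andP[_ /norP[_ /negP]].
  have [y0 [Sy0 y0j]] := scount_gt0 (etrans (lt0n _) b0).
  have [x0 [Sx0 x0i]] := scount_gt0 (etrans (lt0n _) a0).
  (* The old common neighbour [x] differs from [y0]: otherwise the edge from [a] to [x] would be
     among the pairs joined now, and these are hidden in [E1]. *)
  have Ti : ~~ (@okf k (later_join P i j) e1 S).2 i.
    apply/negP => fl; have [a [b [x [[ab Sa Sb Sx] [ai bi ax bx]]]]] := T i fl.
    apply: (C4 a b x y0) => //; try exact: sub; try exact: new.
    by move=> xy; apply: (old _ _ ax); rewrite /new_pair ai xy y0j !eqxx.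
  have Tj : ~~ (@okf k (later_join P i j) e1 S).2 j.
    apply/negP => fl; have [a [b [x [[ab Sa Sb Sx] [aj bj ax bx]]]]] := T j fl.
    apply: (C4 a b x x0) => //; try exact: sub; try exact: new'.
    by move=> xy; apply: (old _ _ ax); rewrite /new_pair aj xy x0i !eqxx orbT.
  have ab1 : (scount (@label (eval e1)) S i == 1) || (scount (@label (eval e1)) S j == 1).
    apply: contraT => /norP[a1 b1].
    have a2 : 1 < scount (@label (eval e1)) S i by move: a0 a1; case: (scount _ _ i) => [|[]].
    have b2 : 1 < scount (@label (eval e1)) S j by move: b0 b1; case: (scount _ _ j) => [|[]].
    have [a [b [ab Sa Sb ai bi]]] := scount_gt1 a2.
    have [x [y [xy Sx Sy xj yj]]] := scount_gt1 b2.
    by case: (C4 a b x y) => //; exact: new.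
  split=> [|l]; first by rewrite /= O Ti Tj ab1.
  rewrite /=; case: eqP => [->|_]; last case: eqP => [->|_]; last exact: T'.
    rewrite (negPf Ti) orbF => /scount_gt1[a [b [ab Sa Sb ai bi]]].
    by exists a, b, y0; split=> //; split=> //; exact: new.
  rewrite (negPf Tj) orbF => /scount_gt1[a [b [ab Sa Sb ai bi]]].
  by exists a, b, x0; split=> //; split=> //; exact: new'.
have [He1 He2] : labels_le k e1 /\ labels_le k e2 by case: He => _ [].
have [O1 T1] := IH1 P (fun x => S (inl x)) Psym He1 (fun a b x y ab xy =>
   C4 (inl a) (inl b) (inl x) (inl y) (fun e => ab (inl_inj e)) (fun e => xy (inl_inj e))).
have [O2 T2] := IH2 P (fun x => S (inr x)) Psym He2 (fun a b x y ab xy =>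
   C4 (inr a) (inr b) (inr x) (inr y) (fun e => ab (inr_inj e)) (fun e => xy (inr_inj e))).
split=> [|l] /=; first by rewrite O1 O2.
case/orP => [/T1|/T2] [a [b [x [[ab Sa Sb Sx] Q]]]].
  by exists (inl a), (inl b), (inl x); split=> //; split=> // -[].
by exists (inr a), (inr b), (inr x); split=> //; split=> // -[].
Qed.

Lemma acyc_C4_free (V : finType) (E : rel V) (S : {set V}) :
  symmetric E -> irreflexive E -> acyc E S -> C4_free E (fun x => x \in S).
Proof.
move=> Es Ei ac a b x y ab xy Sa Sb Sx Sy ax ay bx by_.
have ne v w : E v w -> v != w by apply: contraTneq => ->; rewrite Ei.
have := ac [:: a; x; b; y]; rewrite /= Sa Sb Sx Sy => /(_ isT).
rewrite !inE (negPf (ne _ _ ax)) (negPf (ne _ _ ay)) (introF eqP ab) (introF eqP xy).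
rewrite (eq_sym x) (negPf (ne _ _ bx)) (negPf (ne _ _ by_)) /=.
by rewrite ax (Es x) bx by_ (Es y) ay => /(_ isT isT).
Qed.

(** * Feedback vertex sets as complements of forests, and invariance under isomorphism *)

Lemma fvs_acyc (G : sgraph) (X : {set G}) :
  feedback_vertex_set X <-> acyc (@adj G) (~: X).
Proof.
rewrite /feedback_vertex_set; split.
  move/acyclicP => H p pS up cp.
  have {pS} [q pE] : exists q : seq (del_vertices X), p = map val q.
    elim: p pS {up cp} => [|x p IH] /=; first by exists [::].
    by case/andP=> xS /IH[q ->]; exists (Sub x xS :: q).
  rewrite pE size_map; apply: H; rewrite /ucycle -(map_inj_uniq val_inj) -pE up andbT.
  move: cp; rewrite pE; case: (q) => //= x r.
  by rewrite -map_rcons path_map.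
move=> ac; apply/acyclicP => q /andP[cq uq].
rewrite -(size_map val); apply: ac.
- by apply/allP => x /mapP[y _ ->]; exact: valP.
- by rewrite (map_inj_uniq val_inj).
by case: q cq {uq} => //= x r; rewrite -map_rcons path_map.
Qed.

Lemma num_fvs_iso (G H : sgraph) t : iso G H -> num_fvs G t = num_fvs H t.
Proof.
case=> f [g fK gK] fadj; rewrite /num_fvs.
have finj := can_inj fK.
rewrite -(card_imset _ (imset_inj finj)); apply: eq_card => Y; rewrite !inE.
apply/imsetP/andP => [[X]|[/fvs_acyc Y1 /eqP Y2]].
  rewrite inE => /andP[/fvs_acyc X1 /eqP X2] ->.
  rewrite card_imset // X2 eqxx; split=> //; apply/fvs_acyc => p pS up cp.
  rewrite -(size_map g); apply: X1.
  - apply/allP => x /mapP[y yp ->]; have := allP pS y yp; rewrite /= !inE.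
    by apply: contra => gyX; rewrite -(gK y) imset_f.
  - by rewrite map_inj_uniq //; exact: can_inj gK.
  case: p cp {pS up} => //= x p; rewrite -map_rcons path_map.
  by apply: sub_path => a b; rewrite /= -fadj !gK.
exists (g @: Y); last first.
  by rewrite -imset_comp (eq_imset _ gK) imset_id.
rewrite inE card_imset ?Y2 ?eqxx ?andbT; last exact: can_inj gK.
apply/fvs_acyc => p pS up cp; rewrite -(size_map f); apply: Y1.
- apply/allP => x /mapP[y yp ->]; have := allP pS y yp; rewrite /= !inE.
  by apply: contra => fyY; rewrite -(fK y) imset_f.
- by rewrite map_inj_uniq.
case: p cp {pS up} => //= x p; rewrite -map_rcons path_map.
by apply: sub_path => a b /=; rewrite fadj.
Qed.

(** * Feedback vertex sets as a coefficient *)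

Section Count.
Import GRing.Theory.
Local Open Scope ring_scope.

Definition later0 : rel nat := fun _ _ => false.

Lemma full_weight_supp N (V : finType) (E : rel V) (kp : {ffun V -> option bool}) :
  full_weight N E kp = ('X * u N ^+ 2) ^+ #|~: supp kp| * cut_weight E (u N) kp.
Proof.
rewrite /full_weight /cut_weight mulrA; congr (_ * _).
rewrite -prodr_const [X in X * _]big_mkcond -big_split /=; apply: eq_bigr => x _.
by rewrite !inE; case: (kp x) => [c|]; rewrite /= ?mul1r ?mulr1.
Qed.

(** Stated over ring variables so that [ring] is not run on the concrete polynomials of
    [dp_count]. *)
Lemma expand_cut_sum (A : comNzRingType) (a b r X Y Z T : A) :
  a * (X * Y * (b * Z + T * r)) = a * b * (X * Y * Z) + a * (X * r) * (Y * T).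
Proof. ring. Qed.

(** At the index with all digits 5 every class passes with value 1, so that the entry is the plain
    sum of the weights of all colourings, up to a multiple of [h]. *)
Lemma dp_count k e t q : labels_le k e -> (t <= #|eval e|)%N ->
  (forall l, (l <= k)%N -> q l = 5%N) ->
  (dp #|eval e|.+1 k later0 e q)`_(2 * #|eval e|.+1 * #|eval e| + t) =
  (num_fvs (eval e) t)%:R :> 'F_2.
Proof.
move=> He; set G := eval e; set n := #|G|; set N := n.+1 => tn q5.
have [g _ ->] := dp_expand N later0 He.
have pf5 tau : pf N k tau q = 1.
  rewrite /pf big1_seq // => l; rewrite mem_iota => /q5 ->.
  by rewrite /phi /= !wt5 !expr1n mulr1.
(* The error is divisible by [h], whose exponent 2N(n+1) is above 2Nn + t. *)
rewrite coefD [X in _ + X](_ : _ = 0) ?addr0; last first.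
  rewrite mulrC coefMXn; case: ltnP => //; rewrite /hexp; nia.
set E := edgeP later0 (e:=e).
have EE : E =2 @adj G by move=> x y; rewrite /E /edgeP andbT.
have Es : symmetric E by move=> x y; rewrite !EE adj_sym.
have Ei : irreflexive E by move=> x; rewrite EE adj_irr.
pose okS (S : {set G}) := (okf k later0 (e:=e) (fun x => x \in S)).1.
have -> : \sum_(kp : {ffun G -> option bool}) tv N k (trm N k later0 kp) q
   = \sum_(S : {set G}) (okS S)%:R * (('X * u N ^+ 2) ^+ #|~: S| * cut_sum E (u N) S).
  rewrite (partition_big (@supp G) predT) //=; apply: eq_bigr => S _.
  rewrite mulrA mulr_sumr [RHS]big_mkcondr; apply: eq_bigr => kp /eqP kS.
  rewrite /tv pf5 mulr1.
  have [_] := @trm_spec N k e later0 kp (fun _ _ => erefl) He.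
  have -> : (fun x => isSome (kp x)) = (fun x => x \in S).
    by apply: functional_extensionality => x; rewrite -kS inE.
  rewrite -/(okS S); case: (okS S); last by move=> ->; rewrite !mul0r; case: ifP.
  rewrite andTb mul1r -/E; case: ifP => _ //; case=> -> _.
  by rewrite full_weight_supp kS.
pose a S := feedback_vertex_set (~: S : {set G}).
have aP S : a S <-> acyc E S.
  rewrite /a fvs_acyc setCK; split=> ac p pS up cp; apply: ac => //.
    by rewrite -(eq_cycle EE).
  by rewrite (eq_cycle EE).
have char2 := char2.
(* The deleted vertices raise the leading term of every forest to the same power u^(2n); the
   remaining power of X is their number. *)
have step S : ((okS S)%:R * (('X * u N ^+ 2) ^+ #|~: S| * cut_sum E (u N) S))`_(2 * N * n + t)
   = ((a S) && (#|~: S| == t))%:R.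
  have [b [r [bE ->]]] := @cut_sum_acyc G E _ (u N) Es Ei char2 S.
  have cS : (#|S| + #|~: S| = n)%N by rewrite cardsC.
  rewrite (_ : (okS S)%:R * (_ * _) = 'X^(2 * N * n + #|~: S|) *+ (okS S && b) +
     (okS S)%:R * ('X^#|~: S| * r) * 'X^(N * (2 * n).+1)); last first.
    rewrite -mulnb -(mulr_natl 'X^_) natrM.
    have uE m : u N ^+ m = 'X^(N * m) by rewrite /u exprM.
    have E1 : (N * (2 * n).+1 = N * (2 * #|~: S|) + N * (2 * #|S|).+1)%N by rewrite -cS; lia.
    have E2 : (2 * N * n + #|~: S| = #|~: S| + N * (2 * #|~: S|) + N * (2 * #|S|))%N by rewrite -cS; lia.
    have X1 : 'X^(N * (2 * n).+1) = u N ^+ (2 * #|~: S|) * u N ^+ (2 * #|S|).+1 :> {poly 'F_2}.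
      by rewrite !uE -exprD E1.
    have X2 : 'X^(2 * N * n + #|~: S|) = 'X^#|~: S| * u N ^+ (2 * #|~: S|) * u N ^+ (2 * #|S|) :> {poly 'F_2}.
      by rewrite !uE -!exprD E2.
    rewrite X1 X2 exprMn -exprM.
    exact: expand_cut_sum.
  (* One further factor [u] shifts beyond the coefficient, since t <= n < N. *)
  rewrite coefD coefMXn (_ : (_ < _)%N) ?addr0; last by rewrite /N; lia.
  rewrite coefMn coefXn eqn_add2l -mulrnA mulnb andbC; congr (_%:R).
  rewrite (eq_sym t); congr nat_of_bool; congr (_ && _).
  have ba : b = a S by apply/idP/idP => [/bE/aP|/aP/bE].
  rewrite -ba; case bT: b; rewrite ?andbT ?andbF //.
  (* A forest has no 4-cycle, so the recurrence never discards it and [okS S] holds. *)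
  have ac : acyc E S by apply/bE; rewrite bT.
  by case: (@okf_C4_free k e later0 _ (fun _ _ => erefl) He (acyc_C4_free Es Ei ac)).
rewrite coef_sum (eq_bigr _ (fun S _ => step S)) -natr_sum; congr (_%:R).
rewrite /num_fvs -sum1_card [RHS]big_mkcond (reindex_inj (@setC_inj G)) /=.
by apply: eq_bigr => X _; rewrite inE /a setCK; case: ifP.
Qed.
End Count.

(** * Degrees of the table entries *)

Section Degree.
Import GRing.Theory.
Local Open Scope ring_scope.
Variable N : nat.
Hypothesis N_gt0 : (0 < N)%N.
Notation R := {poly 'F_2}.

Definition mono_le (a b c : nat) (m : mono) : bool :=
  [&& m.1.1 <= a, m.1.2 <= b & m.2 <= c]%N.

Lemma size_peval a b c l : all (mono_le a b c) l ->
  (size (peval N l) <= (a + 2 * N * b + hexp N * c).+1)%N.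
Proof.
move=> /allP H; rewrite /peval big_seq.
elim/big_ind: _ => [|p q hp hq|m /H /and3P[ha hb hc]].
- by rewrite size_poly0.
- by apply: leq_trans (size_polyD _ _) _; rewrite geq_max hp.
rewrite size_polyXn ltnS /mexp.
by apply: leq_add; [apply: leq_add => //|]; rewrite leq_mul2l ?hb ?hc orbT.
Qed.

Lemma leaf_mono_le d : all (mono_le 1 3 1) (leaf_l d).
Proof.
rewrite /leaf_l /w_l; case: (d == 5%N) => //.
by case: (d == (1 + false)%N); case: (d == (3 + false)%N);
   case: (d == (1 + true)%N); case: (d == (3 + true)%N).
Qed.

Lemma w_mono_le d c : all (mono_le 0 2 1) (w_l d c).
Proof.
by rewrite /w_l; case: c; case: ifP => // _; case: ifP => // _; case: ifP.
Qed.

Lemma pmul_mono_le a b c a' b' c' l l' :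
  all (mono_le a b c) l -> all (mono_le a' b' c') l' ->
  all (mono_le (a + a') (b + b') (c + c')) (pmul l l').
Proof.
move=> /allP H /allP H'; apply/allP => _ /allpairsP[[m m'] /= [/H h1 /H' h2 ->]].
case/and3P: h1 => *; case/and3P: h2 => *.
by rewrite /mono_le /=; apply/and3P; split; apply: leq_add.
Qed.

Lemma mono_le_weaken a b c a' b' c' l : (a <= a')%N -> (b <= b')%N -> (c <= c')%N ->
  all (mono_le a b c) l -> all (mono_le a' b' c') l.
Proof.
move=> ha hb hc; apply: sub_all => m /and3P[*].
by apply/and3P; split; [exact: leq_trans ha|exact: leq_trans hb|exact: leq_trans hc].
Qed.

(** Edge weights carry no [h], so even the product of three lists has exponent at most 2 in [h], the
    very power that [tjoin] divides out. *)
Lemma join_mono_le d d' t : t \in join_l d d' -> all (mono_le 0 6 2) t.2.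
Proof.
have e_le c : all (mono_le 0 2 1) (edge_l c) by case: c.
have h_le : all (mono_le 0 2 1) h_l by [].
have crossP a b w : all (mono_le 0 6 2) w -> t \in cross a b w -> all (mono_le 0 6 2) t.2.
  by move=> ww; rewrite !inE => /or4P[] /eqP->.
have pm l l' : all (mono_le 0 2 1) l -> all (mono_le 0 2 1) l' ->
    all (mono_le 0 6 2) (pmul l l').
  by move=> H H'; apply: mono_le_weaken (pmul_mono_le H H').
have w3 c : all (mono_le 0 6 2) (pmul (pmul (w_l d c) (w_l d' c)) (edge_l c)).
  case: (eqVneq d 5%N) => [->|d5].
    have := pmul_mono_le (pmul_mono_le (isT : all (mono_le 0 0 0) (w_l 5 c)) (w_mono_le d' c))
      (_ : all (mono_le 0 2 0) (edge_l c)).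
    by move=> H; apply: mono_le_weaken (H _) => //; case: (c).
  have := pmul_mono_le (pmul_mono_le (w_mono_le d c) (w_mono_le d' c))
      (_ : all (mono_le 0 2 0) (edge_l c)).
  by move=> H; apply: mono_le_weaken (H _) => //; case: (c).
have colorP c : t \in join_color d d' c -> all (mono_le 0 6 2) t.2.
  rewrite /join_color !mem_cat => /or3P[]; first exact: crossP.
    case: ifP => // _; rewrite mem_cat => /orP[]; apply: crossP; apply: pm => //;
      exact: w_mono_le.
  case: ifP => // _; rewrite mem_cat => /orP[]; apply: crossP; apply: pm => //;
      exact: w_mono_le.
rewrite /join_l mem_cat => /orP[|]; last by rewrite mem_cat => /orP[]; exact: colorP.
by rewrite !inE => /or3P[] /eqP->.
Qed.

(** The weights have degree at most [12 * N + 2 * hexp], and the division takes [2 * hexp] back. *)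
Lemma size_tjoin F i j m : (forall q, size (F q : R) <= m)%N ->
  forall q, (size (tjoin N F i j q) <= m + 12 * N)%N.
Proof.
move=> Fm q; rewrite /tjoin size_drop_poly leq_subLR.
rewrite big_seq; elim/big_ind: _ => [|p p' hp hp'|t tl].
- by rewrite size_poly0.
- by apply: leq_trans (size_polyD _ _) _; rewrite geq_max hp.
apply: leq_trans (size_polyMleq _ _) _.
have := size_peval (join_mono_le tl); set x := size _ => hx.
have := Fm (upd (upd q i t.1.1) j t.1.2); set y := size _ => hy.
by move: hx hy; move: (hexp N) => hh; clear; lia.
Qed.

(** Sizes add up at a union and grow by a fixed amount at a join, so they stay linear in the length
    of the code. The rate [6 * N * N] per word pays for a leaf (two words) and for a join (three
    words). *)
Lemma size_dp k P e q : (size (dp N k P e q) <= 6 * N * N * size (encode_expr e))%N.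
Proof.
elim: e P q => [i|i j e1 IH|i j ij e1 IH|e1 IH1 e2 IH2] P q /=.
- apply: leq_trans (size_peval (leaf_mono_le _)) _; rewrite /hexp.
  by have := leq_pmulr N N_gt0; have := N_gt0; clear; lia.
- by apply: leq_trans (IH _ _) _; rewrite leq_mul2l size_cat leq_addr orbT.
- have IH' q' := IH (later_join P i j) q'.
  case: ifP => _.
    apply: leq_trans (size_tjoin _ _ IH' q) _; rewrite size_cat /= mulnDr leq_add2l.
    by have := leq_pmulr N N_gt0; have := N_gt0; clear; lia.
  by apply: leq_trans (IH' _) _; rewrite leq_mul2l size_cat leq_addr orbT.
apply: leq_trans (size_polyMleq _ _) _; rewrite !size_cat !mulnDr.
apply: leq_trans (leq_pred _) _; rewrite addnA.
by apply: leq_trans _ (leq_addr _ _); apply: leq_add.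
Qed.

End Degree.

(** * Table indices in base six *)

Definition dig (q l : nat) : nat := q %/ 6 ^ l %% 6.
Definition updn (q i a : nat) : nat := q - dig q i * 6 ^ i + a * 6 ^ i.

Lemma exp6_gt0 i : 0 < 6 ^ i. Proof. by rewrite expn_gt0. Qed.

Lemma dig_decomp q i :
  q = (q %/ 6 ^ i.+1) * 6 ^ i.+1 + dig q i * 6 ^ i + q %% 6 ^ i.
Proof.
rewrite {1}(divn_eq q (6 ^ i)); congr (_ + _).
rewrite {1}(divn_eq (q %/ 6 ^ i) 6) mulnDl; congr (_ + _).
by rewrite -divnMA -expnSr expnS mulnA.
Qed.

Lemma updnE q i a : updn q i a =
  (q %/ 6 ^ i.+1) * 6 ^ i.+1 + a * 6 ^ i + q %% 6 ^ i.
Proof.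
rewrite /updn {1}(dig_decomp q i).
by rewrite -addnA addnCA [dig q i * _ + _]addnC addnK addnAC.
Qed.

Lemma dig_digits hi a lo i l : lo < 6 ^ i -> a < 6 ->
  dig (hi * 6 ^ i.+1 + a * 6 ^ i + lo) l =
  if l == i then a else if l < i then dig lo l else hi %/ 6 ^ (l - i.+1) %% 6.
Proof.
move=> lo6 a6; rewrite /dig.
have E : hi * 6 ^ i.+1 + a * 6 ^ i = (hi * 6 + a) * 6 ^ i.
  by rewrite mulnDl expnS mulnA.
case: (ltngtP l i) => [li|il|->].
- have [m ->] : exists m, i = m.+1 + l by exists (i - l).-1; lia.
  rewrite [in LHS]expnS [6 * _]mulnC.
  have -> : hi * (6 ^ (m.+1 + l) * 6) + a * 6 ^ (m.+1 + l) = (hi * 6 + a) * 6 ^ m * 6 * 6 ^ l.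
    by rewrite addSn expnS expnD; ring.
  by rewrite divnMDl ?exp6_gt0 // modnMDl.
- have -> : l = i.+1 + (l - i.+1) by rewrite subnKC.
  rewrite addKn expnD divnMA; congr (_ %/ _ %% 6).
  rewrite -addnA divnMDl ?exp6_gt0 // divn_small ?addn0 //.
  rewrite expnS; apply: (@leq_trans (a.+1 * 6 ^ i)); first by rewrite mulSn addnC ltn_add2r.
  by rewrite leq_mul2r a6 orbT.
by rewrite E divnMDl ?exp6_gt0 // divn_small // addn0 modnMDl modn_small.
Qed.

Lemma dig_lt q l : dig q l < 6. Proof. by rewrite /dig ltn_mod. Qed.

Lemma dig_updn q i a : a < 6 -> dig (updn q i a) = upd (dig q) i a.
Proof.
move=> a6; apply: functional_extensionality => l.
have lo6 : q %% 6 ^ i < 6 ^ i by rewrite ltn_mod exp6_gt0.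
rewrite updnE (dig_digits _ _ lo6 a6) /upd; case: eqP => // li.
by rewrite [in RHS](dig_decomp q i) (dig_digits _ _ lo6 (dig_lt q i)) (introF eqP li).
Qed.

Lemma updn_lt q i a k : q < 6 ^ k.+1 -> i <= k -> a < 6 -> updn q i a < 6 ^ k.+1.
Proof.
move=> qk ik a6; rewrite updnE.
have lo6 : q %% 6 ^ i < 6 ^ i by rewrite ltn_mod exp6_gt0.
have E : 6 ^ k.+1 = 6 ^ (k - i) * 6 ^ i.+1 by rewrite -expnD addnS subnK.
have hi : q %/ 6 ^ i.+1 < 6 ^ (k - i) by rewrite ltn_divLR ?exp6_gt0 // -E.
rewrite E; apply: leq_trans (_ : (q %/ 6 ^ i.+1).+1 * 6 ^ i.+1 <= _); last first.
  by rewrite leq_mul2r hi orbT.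
rewrite mulSn -addnA addnC ltn_add2r expnS.
apply: (@leq_trans (a.+1 * 6 ^ i)); first by rewrite mulSn addnC ltn_add2r.
by rewrite leq_mul2r a6 orbT.
Qed.

(** * Coefficients as sums of naturals modulo 2 *)

Section Cells.
Import GRing.Theory.
Local Open Scope ring_scope.
Notation R := {poly 'F_2}.

Definition bit (p : R) (m : nat) : nat := nat_of_ord (p`_m)%R.

Lemma bit_lt2 p m : (bit p m < 2)%N. Proof. exact: ltn_ord. Qed.

Lemma F2_mod (z : 'F_2) (m : nat) : m%:R = z -> (m %% 2)%N = z.
Proof. by move=> <-; rewrite val_Fp_nat. Qed.

Lemma F2_natK (z : 'F_2) : (z : nat)%:R = z.
Proof. exact: natr_Zp. Qed.

Lemma bit_peval N l m : ((\sum_(x <- l) (m == mexp N x)) %% 2)%N = bit (peval N l) m.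
Proof.
apply: F2_mod; rewrite natr_sum /peval coef_sum; apply: eq_bigr => x _.
by rewrite coefXn.
Qed.

(** The two comparisons are those the machine makes: the first guards the truncated subtraction, the
    second keeps the access within the [D] cells of an entry, beyond which all coefficients are
    0. *)
Lemma bit_tjoin N (F : table) i j q m D : (forall q, size (F q) <= D)%N ->
  ((\sum_(t <- join_l (q i) (q j)) \sum_(x <- t.2)
    (mexp N x <= m + 2 * hexp N) * (m + 2 * hexp N - mexp N x < D) *
    bit (F (upd (upd q i t.1.1) j t.1.2)) (m + 2 * hexp N - mexp N x)) %% 2)%N =
  bit (tjoin N F i j q) m.
Proof.
move=> FD; apply: F2_mod; rewrite /tjoin coef_drop_poly coef_sum natr_sum.
apply: eq_bigr => t _; rewrite natr_sum /peval mulr_suml coef_sum.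
apply: eq_bigr => x _; rewrite coefXnM.
case: (leqP (mexp N x) (m + 2 * hexp N)) => [le|lt] /=; last by rewrite !mul0n.
rewrite mul1n; case: ltnP => sD /=; first by rewrite mul1n F2_natK.
by rewrite mul0n nth_default //; apply: leq_trans (FD _) sD.
Qed.

Lemma bit_mul (p q : R) m :
  ((\sum_(0 <= r < m.+1) bit p r * bit q (m - r)) %% 2)%N = bit (p * q) m.
Proof.
apply: F2_mod; rewrite natr_sum coefM big_mkord; apply: eq_bigr => r _.
by rewrite natrM !F2_natK.
Qed.
End Cells.

(** * A program logic for the word RAM *)

Notation smem := Defs.mem.

Definition nvars := 64.

(* Registers from [nvars] on are the evaluation stack of expressions. *)
Definition user (s : state) : state :=
  State (fun x => if x < nvars then reg s x else 0) (smem s).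

Definition bdd (W : nat) (s : state) : Prop :=
  (forall x, reg s x <= W) /\ (forall a, smem s a <= W).

Inductive expr :=
| EV of nat
| EC of nat
| EB of binop & expr & expr
| EL of expr.

Fixpoint ev (s : state) (e : expr) : nat :=
  match e with
  | EV x => reg s x
  | EC c => c
  | EB o a b => binop_eval o (ev s a) (ev s b)
  | EL a => smem s (ev s a)
  end.

Fixpoint ecost (e : expr) : nat :=
  match e with
  | EV _ => 2
  | EC _ => 1
  | EB _ a b => ecost a + (ecost b + 1)
  | EL a => ecost a + 1
  end.

(** These operations never exceed their left operand, so [esafe] has to bound only the results of
    the others; an unbounded result would leave the machine stuck. *)
Definition shrinking (o : binop) : bool :=
  match o with Defs.Sub | Div => true | _ => false end.

Fixpoint esafe (W : nat) (s : state) (e : expr) : Prop :=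
  match e with
  | EV x => x < nvars
  | EC c => c <= W
  | EB o a b => [/\ esafe W s a, esafe W s b &
      if shrinking o then True else binop_eval o (ev s a) (ev s b) <= W]
  | EL a => esafe W s a
  end.

(** Register [t] receives the value, registers above it are scratch. The machine has no register
    move, hence the addition to a cleared register. *)
Fixpoint comp (t : nat) (e : expr) : cmd :=
  match e with
  | EV x => Seq (Const t 0) (Op Add t t x)
  | EC c => Const t c
  | EB o a b => Seq (comp t a) (Seq (comp t.+1 b) (Op o t t t.+1))
  | EL a => Seq (comp t a) (Read t t)
  end.

Lemma bdd_set_reg W s x v : bdd W s -> v <= W -> bdd W (set_reg s x v).
Proof. by case=> r m vW; split=> // y /=; rewrite /upd; case: ifP. Qed.

Lemma bdd_set_mem W s a v : bdd W s -> v <= W -> bdd W (set_mem s a v).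
Proof. by case=> r m vW; split=> // y /=; rewrite /upd; case: ifP. Qed.

Lemma ev_le W s e : bdd W s -> esafe W s e -> ev s e <= W.
Proof.
case=> r m; elim: e => [x|c|o a IHa b IHb|a IHa] //=.
case=> /IHa ha /IHb hb; case: o => //= _; first by rewrite leq_subLR (leq_trans ha) // leq_addl.
exact: leq_trans (leq_div _ _) ha.
Qed.

Lemma bdd_user W s : bdd W s -> bdd W (user s).
Proof. by case=> r m; split=> // x /=; case: ifP. Qed.

Lemma comp_ok W e t s : nvars <= t -> bdd W s -> esafe W (user s) e ->
  exists s', [/\ exec W (comp t e) s (ecost e) s', smem s' = smem s,
    forall x, x < t -> reg s' x = reg s x, reg s' t = ev (user s) e & bdd W s'].
Proof.
elim: e t s => [x|c|o a IHa b IHb|a IHa] t s ht bs /=.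
- move=> xn; have xt : x < t := leq_trans xn ht.
  have E0 : exec W (Const t 0) s 1 (set_reg s t 0) by constructor.
  have v : upd (reg s) t 0 t + upd (reg s) t 0 x = reg s x.
    by rewrite /upd eqxx (ltn_eqF xt).
  have vW : reg s x <= W by case: bs.
  exists (set_reg (set_reg s t 0) t (reg s x)); split=> //.
  + have E1 : exec W (Op Add t t x) (set_reg s t 0) 1
       (set_reg (set_reg s t 0) t (binop_eval Add (upd (reg s) t 0 t) (upd (reg s) t 0 x))).
      by constructor; rewrite /= v.
    by have := exec_seq E0 E1; rewrite /= v.
  + by move=> y yt; rewrite /= /upd (ltn_eqF yt).
  + by rewrite /= /upd eqxx xn.
  + by apply: bdd_set_reg => //; apply: bdd_set_reg.
- move=> cW; exists (set_reg s t c); split=> //; first by constructor.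
  + by move=> y yt; rewrite /= /upd (ltn_eqF yt).
  + by rewrite /= /upd eqxx.
  + exact: bdd_set_reg.
- case=> sa sb so.
  have [s1 [e1 m1 r1 v1 b1]] := IHa t s ht bs sa.
  have us1 : user s1 = user s.
    rewrite /user m1; congr State; apply: functional_extensionality => x.
    by case: ifP => // xn; rewrite r1 //; apply: leq_trans ht.
  rewrite -us1 in sb.
  have [s2 [e2 m2 r2 v2 b2]] := IHb t.+1 s1 (leqW ht) b1 sb.
  have v : binop_eval o (reg s2 t) (reg s2 t.+1) = binop_eval o (ev (user s) a) (ev (user s) b).
    by rewrite r2 // v1 v2 us1.
  have oW : binop_eval o (ev (user s) a) (ev (user s) b) <= W.
    rewrite us1 in sb; apply: (@ev_le W (user s) (EB o a b)); first exact: bdd_user.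
    by split.
  exists (set_reg s2 t (binop_eval o (ev (user s) a) (ev (user s) b))); split.
  + apply: exec_seq e1 _; apply: exec_seq e2 _; rewrite -v; constructor; by rewrite v.
  + by rewrite /= m2 m1.
  + by move=> x xt; rewrite /= /upd (ltn_eqF xt) r2 ?r1 // ltnW.
  + by rewrite /= /upd eqxx.
  + exact: bdd_set_reg.
move=> sa; have [s1 [e1 m1 r1 v1 b1]] := IHa t s ht bs sa.
exists (set_reg s1 t (smem s1 (reg s1 t))); split=> //.
+ by apply: exec_seq e1 _; constructor.
+ by move=> x xt; rewrite /= /upd (ltn_eqF xt) r1.
+ by rewrite /= /upd eqxx v1 m1.
+ by apply: bdd_set_reg => //; case: b1.
Qed.

Lemma user_comp t s s' : nvars <= t ->
  smem s' = smem s -> (forall x, x < t -> reg s' x = reg s x) -> user s' = user s.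
Proof.
move=> ht ms rs; rewrite /user ms; congr State; apply: functional_extensionality => x.
by case: ifP => // xn; rewrite rs //; apply: leq_trans ht.
Qed.

(** Total correctness with cost, up to the contents of the evaluation stack: the command must
    succeed from every bounded machine state whose visible part is [s]. *)
Definition ok (W : nat) (c : cmd) (s : state) (Q : nat -> state -> Prop) : Prop :=
  forall s0, user s0 = s -> bdd W s0 ->
    exists T s', [/\ exec W c s0 T s', bdd W s' & Q T (user s')].

Definition Asg (x : nat) (e : expr) : cmd :=
  Seq (comp nvars e) (Seq (Const nvars.+1 0) (Op Add x nvars nvars.+1)).
Definition Sto (a e : expr) : cmd :=
  Seq (comp nvars a) (Seq (comp nvars.+1 e) (Write nvars nvars.+1)).
Definition IfE (e : expr) (c1 c2 : cmd) : cmd :=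
  Seq (comp nvars e) (If nvars c1 c2).
Definition WhileE (e : expr) (c : cmd) : cmd :=
  Seq (comp nvars e) (While nvars (Seq c (comp nvars e))).
Definition For (x y : nat) (c : cmd) : cmd :=
  Seq (Asg x (EC 0))
    (WhileE (EB Defs.Sub (EV y) (EV x)) (Seq c (Asg x (EB Add (EV x) (EC 1))))).

Section Rules.
Variable W : nat.
Implicit Types (s : state) (Q : nat -> state -> Prop).

Lemma ok_conseq c s Q Q' : ok W c s Q -> (forall T s', bdd W s' -> Q T s' -> Q' T s') -> ok W c s Q'.
Proof.
move=> H QQ s0 us b0; have [T [s' [e b q]]] := H s0 us b0.
by exists T, s'; split=> //; apply: QQ => //; apply: bdd_user.
Qed.

Lemma ok_bdd c s Q : (bdd W s -> ok W c s Q) -> ok W c s Q.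
Proof. by move=> H s0 us b0; apply: H => //; rewrite -us; apply: bdd_user. Qed.

Lemma ok_seq c1 c2 s Q :
  ok W c1 s (fun T1 s1 => ok W c2 s1 (fun T2 s2 => Q (T1 + T2) s2)) ->
  ok W (Seq c1 c2) s Q.
Proof.
move=> H s0 us b0; have [T1 [s1 [e1 b1 H1]]] := H s0 us b0.
have [T2 [s2 [e2 b2 q]]] := H1 s1 erefl b1.
by exists (T1 + T2), s2; split=> //; apply: exec_seq e1 e2.
Qed.

Lemma ok_skip s Q : Q 1 s -> ok W Skip s Q.
Proof. by move=> q s0 us b0; exists 1, s0; split; [constructor | | rewrite us]. Qed.

Lemma user_set_reg s x v : x < nvars -> user (set_reg s x v) = set_reg (user s) x v.
Proof.
move=> xn; congr State; apply: functional_extensionality => y /=.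
by rewrite /upd; case: eqP => // ->; rewrite xn.
Qed.

Lemma ok_asg x e s Q : x < nvars -> esafe W s e ->
  Q (ecost e + 2) (set_reg s x (ev s e)) -> ok W (Asg x e) s Q.
Proof.
move=> xn se q s0 us b0; rewrite -us in se q.
have [s1 [e1 m1 r1 v1 b1]] := comp_ok (leqnn nvars) b0 se.
have vW : ev (user s0) e <= W by apply: ev_le se; apply: bdd_user.
pose s2 := set_reg s1 nvars.+1 0.
have v : reg s2 nvars + reg s2 nvars.+1 = ev (user s0) e.
  by rewrite /= /upd eqxx ltn_eqF // v1 addn0.
exists (ecost e + 2), (set_reg s2 x (ev (user s0) e)); split.
- apply: exec_seq e1 _; apply: (@exec_seq _ _ s2 _ _ _ 1 1); first by constructor.
  by rewrite -v; constructor; rewrite /= v.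
- by apply: bdd_set_reg => //; apply: bdd_set_reg.
- suff -> : user (set_reg s2 x (ev (user s0) e)) = set_reg (user s0) x (ev (user s0) e) by [].
  rewrite user_set_reg //; congr set_reg.
  apply: (@user_comp nvars) => // y yn; rewrite /= /upd ltn_eqF ?r1 //.
  exact: leqW.
Qed.

Lemma ok_sto a e s Q : esafe W s a -> esafe W s e ->
  Q (ecost a + (ecost e + 1)) (set_mem s (ev s a) (ev s e)) -> ok W (Sto a e) s Q.
Proof.
move=> sa se q s0 us b0; rewrite -us in sa se q.
have [s1 [e1 m1 r1 v1 b1]] := comp_ok (leqnn nvars) b0 sa.
have us1 : user s1 = user s0 by apply: (@user_comp nvars).
rewrite -us1 in se; have [s2 [e2 m2 r2 v2 b2]] := comp_ok (leqnSn nvars) b1 se.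
have us2 : user s2 = user s0 by rewrite -us1; apply: (@user_comp nvars.+1).
have vW : ev (user s0) e <= W by rewrite -us1; apply: ev_le se; apply: bdd_user.
exists (ecost a + (ecost e + 1)), (set_mem s2 (ev (user s0) a) (ev (user s0) e)); split.
- apply: exec_seq e1 _; apply: exec_seq e2 _.
  rewrite -us1 -v2 us1 -v1 -(r2 nvars) //; by constructor.
- exact: bdd_set_mem.
- suff -> : user (set_mem s2 (ev (user s0) a) (ev (user s0) e))
     = set_mem (user s0) (ev (user s0) a) (ev (user s0) e) by [].
  by rewrite -us2.
Qed.

Lemma ok_if e c1 c2 s Q : esafe W s e ->
  (ev s e != 0 -> ok W c1 s (fun T s' => Q (ecost e + T.+1) s')) ->
  (ev s e = 0 -> ok W c2 s (fun T s' => Q (ecost e + T.+1) s')) ->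
  ok W (IfE e c1 c2) s Q.
Proof.
move=> se H1 H2 s0 us b0; rewrite -us in se H1 H2.
have [s1 [e1 m1 r1 v1 b1]] := comp_ok (leqnn nvars) b0 se.
have us1 : user s1 = user s0 by apply: (@user_comp nvars).
have [z|nz] := eqVneq (ev (user s0) e) 0.
  have [T [s2 [e2 b2 q]]] := H2 z s1 us1 b1.
  exists (ecost e + T.+1), s2; split=> //; apply: exec_seq e1 _.
  by apply: exec_if_zero => //; rewrite v1 z.
have [T [s2 [e2 b2 q]]] := H1 nz s1 us1 b1.
exists (ecost e + T.+1), s2; split=> //; apply: exec_seq e1 _.
by apply: exec_if_nonzero => //; rewrite v1.
Qed.

Lemma ok_while0 e c s Q : esafe W s e -> ev s e = 0 -> Q (ecost e + 1) s ->
  ok W (WhileE e c) s Q.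
Proof.
move=> se z q s0 us b0; rewrite -us in se z q.
have [s1 [e1 m1 r1 v1 b1]] := comp_ok (leqnn nvars) b0 se.
have us1 : user s1 = user s0 by apply: (@user_comp nvars).
exists (ecost e + 1), s1; split=> //; last by rewrite us1.
by apply: exec_seq e1 _; apply: exec_while_zero; rewrite v1 z.
Qed.

Lemma ok_while1 e c s Q : esafe W s e -> ev s e != 0 ->
  ok W c s (fun T1 s1 => ok W (WhileE e c) s1 (fun T2 s2 => Q (ecost e + (T1 + T2).+1) s2)) ->
  ok W (WhileE e c) s Q.
Proof.
move=> se nz H s0 us b0; rewrite -us in se nz H.
have [s1 [e1 m1 r1 v1 b1]] := comp_ok (leqnn nvars) b0 se.
have us1 : user s1 = user s0 by apply: (@user_comp nvars).
have [T1 [s2 [e2 b2 H2]]] := H s1 us1 b1.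
have [T2 [s3 [e3 b3 q]]] := H2 s2 erefl b2.
exists (ecost e + (T1 + T2).+1), s3; split=> //.
(* The test that opens the remaining loop is the one executed at the end of the compiled body;
   splitting the run moves it there. *)
inversion e3 as [| | | | |? sm ? ? ? Ta Tb ea eb| | | |]; subst.
apply: exec_seq e1 _; rewrite addnA.
apply: exec_while_nonzero eb; first by rewrite v1.
exact: exec_seq e2 ea.
Qed.

(** A round costs 5 for the test, 1 for the branch and 6 for the increment besides the body, hence
    [Tb + 12]; initialisation and last test cost 9. The counter fits into a word because the bound
    [n] is itself held in register [y]. *)
Lemma ok_for (I : nat -> state -> Prop) n Tb x y c s Q :
  x < nvars -> y < nvars -> 0 < W -> I 0 (set_reg s x 0) ->
  (forall i s, I i s -> reg s x = i /\ reg s y = n) ->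
  (forall i s, i < n -> I i s -> ok W c s
     (fun T s' => [/\ T <= Tb, reg s' x = i & I i.+1 (set_reg s' x i.+1)])) ->
  (forall T s, T <= n * (Tb + 12) + 9 -> I n s -> Q T s) ->
  ok W (For x y c) s Q.
Proof.
move=> xn yn W0 I0 Ixy Ic Qn.
apply: ok_seq; apply: ok_asg => //=.
suff H m : forall i s, n - i = m -> I i s ->
    ok W (WhileE (EB Defs.Sub (EV y) (EV x)) (Seq c (Asg x (EB Add (EV x) (EC 1))))) s
      (fun T s' => T <= m * (Tb + 12) + 6 /\ (i <= n -> I n s')).
  apply: ok_conseq (H (n - 0) 0 _ erefl I0) _ => T s1 _ [hT In].
  by apply: Qn; [rewrite subn0 in hT; lia | exact: In].
elim: m => [|m IH] i s1 im Ii; have [rx ry] := Ixy _ _ Ii.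
  apply: ok_while0 => //=; first by rewrite rx ry.
  split=> // hi; suff <- : i = n by [].
  by apply/eqP; rewrite eqn_leq hi -subn_eq0 im.
have hin : i < n by rewrite -subn_gt0 im.
apply: ok_while1 => //=; first by rewrite rx ry im.
apply: ok_bdd => bs; have nW : n <= W by rewrite -ry; case: bs.
apply: ok_seq; apply: ok_conseq (Ic i s1 hin Ii) _ => T1 s2 _ [hT1 rx2 Ii1].
apply: ok_asg => //=.
  by rewrite rx2; split=> //; rewrite addn1 (leq_trans hin).
rewrite rx2 addn1.
have im1 : n - i.+1 = m by lia.
apply: ok_conseq (IH _ _ im1 Ii1) _ => T2 s3 _ [hT2 In].
by split; [lia | move=> _; apply: In].
Qed.

End Rules.

Notation "x +! y" := (EB Add x y) (at level 50, left associativity).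
Notation "x -! y" := (EB Defs.Sub x y) (at level 50, left associativity).
Notation "x *! y" := (EB Mul x y) (at level 40, left associativity).
Notation "x /! y" := (EB Div x y) (at level 40, left associativity).
Notation "'$' x" := (EV x) (at level 0, x at level 0, format "$ x").
Notation "'#!' c" := (EC c) (at level 0, c at level 0, format "#! c").
Notation "c1 ;! c2" := (Seq c1 c2) (at level 92, right associativity).

(** Tests with value 0 or 1, obtained from truncated subtraction, so that case distinctions become
    products. *)
Definition Eeq (a b : expr) : expr := #!1 -! ((a -! b) +! (b -! a)).
Definition Ele (a b : expr) : expr := #!1 -! (a -! b).
Definition Elt (a b : expr) : expr := #!1 -! (#!1 -! (b -! a)).
Definition esum (T : Type) (l : seq T) (f : T -> expr) : expr :=
  foldr (fun x e => f x +! e) (#!0) l.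
Definition Emod (x c : expr) : expr := x -! c *! (x /! c).

Lemma ev_Eeq s a b : ev s (Eeq a b) = (ev s a == ev s b).
Proof. by rewrite /=; case: eqP; lia. Qed.

Lemma ev_Ele s a b : ev s (Ele a b) = (ev s a <= ev s b).
Proof. by rewrite /=; case: leqP; lia. Qed.

Lemma ev_Elt s a b : ev s (Elt a b) = (ev s a < ev s b).
Proof. by rewrite /=; case: ltnP; lia. Qed.

Lemma ev_Emod s x c : ev s (Emod x c) = ev s x %% ev s c.
Proof. by rewrite /= {1}(divn_eq (ev s x) (ev s c)) mulnC addKn. Qed.

Lemma ev_esum s (T : Type) (l : seq T) f : ev s (esum l f) = \sum_(x <- l) ev s (f x).
Proof. by elim: l => [|x l IH]; rewrite ?big_nil ?big_cons // -IH. Qed.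

Lemma ev_mul s x y : ev s (x *! y) = ev s x * ev s y. Proof. by []. Qed.

Section Expr.
Variables (W : nat) (s : state).
Hypotheses (bs : bdd W s) (W_gt0 : 0 < W).

Lemma esafe_Eeq a b : esafe W s a -> esafe W s b -> esafe W s (Eeq a b).
Proof.
move=> sa sb; have := ev_le bs sa; have := ev_le bs sb; rewrite /= => hb ha.
by do !split=> //; lia.
Qed.

Lemma esafe_Ele a b : esafe W s a -> esafe W s b -> esafe W s (Ele a b).
Proof. by []. Qed.

Lemma esafe_Elt a b : esafe W s a -> esafe W s b -> esafe W s (Elt a b).
Proof. by []. Qed.

Lemma esafe_Emod x c : esafe W s x -> esafe W s c -> esafe W s (Emod x c).
Proof.
move=> sx sc; have := ev_le bs sx => hx; split=> //; split=> //=.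
by apply: leq_trans hx; rewrite mulnC leq_divM.
Qed.

Lemma esafe_mulb x y : esafe W s x -> esafe W s y -> ev s x <= 1 -> esafe W s (x *! y).
Proof.
move=> sx sy x1; split=> //=; have := ev_le bs sy; apply: leq_trans.
by rewrite -[leqRHS]mul1n leq_mul2r x1 orbT.
Qed.

Lemma esafe_esum (T : eqType) (l : seq T) f : (forall x, x \in l -> esafe W s (f x)) ->
  \sum_(x <- l) ev s (f x) <= W -> esafe W s (esum l f).
Proof.
elim: l => [|x l IH] //= H; rewrite big_cons => S; split; first by apply: H; rewrite mem_head.
  by apply: IH => [y yl|]; [apply: H; rewrite inE yl orbT | apply: leq_trans S; apply: leq_addl].
by rewrite ev_esum.
Qed.

End Expr.

Ltac regs := rewrite /= /upd /=.

(* Registers: 1 k, 2 t, 3 n, 4 and 7 start and length of the expression,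
   5 2N, 6 2N^2, 8 the bound D on the sizes of table entries, 9 6^(k+1), 10 the
   size Z = 6^(k+1) D of a slot, 11 start of the slots, 12 end of the stack of
   slots, 13 position in the expression, 14-16 opcode and operands i and j,
   17-18 6^i and 6^j, 19 the slot of the result, 20 a buffer slot; for the cell
   at hand, 31 its number, 32 the table index, 33 the exponent, 34-35 the digits
   of the index at i and j. *)
Definition Pow (out x : nat) : cmd :=
  Asg out (#!1) ;! For 30 x (Asg out ($out *! #!6)).

Section Macros.
Variable W : nat.
Hypothesis W_gt1 : 10 < W.

Lemma ok_pow out x s Q : 13 < out < 30 -> x < 30 -> x != out -> 6 ^ reg s x <= W ->
  (forall T s', T <= 40 * (reg s x).+1 -> reg s' out = 6 ^ reg s x ->
     (forall y, y != out -> y < 30 -> reg s' y = reg s y) -> smem s' = smem s -> Q T s') ->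
  ok W (Pow out x) s Q.
Proof.
move=> /andP[o1 o2] x3 xo h6 H.
have on : out < nvars by apply: leq_trans o2 _.
apply: ok_seq; apply: ok_asg => //=; first by lia.
apply: (ok_for (Tb := 20) (n := reg s x) (I := fun i s' => [/\ reg s' 30 = i, reg s' out = 6 ^ i,
  forall y, y != out -> y < 30 -> reg s' y = reg s y & smem s' = smem s])).
- by [].
- by apply: leq_trans x3 _.
- by lia.
- split; regs => //; first by rewrite (ltn_eqF o2) eqxx.
  by move=> y yo y3; rewrite (ltn_eqF y3) (negPf yo).
- by move=> i s' [r30 _ H' _]; split=> //; apply: H'.
- move=> i s' ix [r30 ro rs ms]; apply: ok_asg => //=.
    split=> //; first by lia.
    by rewrite ro -expnSr; apply: leq_trans h6; rewrite leq_exp2l.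
  split; regs => //; first by rewrite (gtn_eqF o2).
  split; regs => //.
  + by rewrite (ltn_eqF o2) eqxx ro expnSr.
  + by move=> y yo y3; rewrite (ltn_eqF y3) (negPf yo) rs.
move=> T s' hT [r30 ro rs ms]; apply: H => //=; lia.
Qed.

Definition in_slot (b Z x : nat) : bool := (b <= x) && (x < b + Z).

(** The body may rely only on memory outside the slot being filled, since an unspecified part of
    that slot is already overwritten. *)
Lemma ok_fill body s0 Tb f Q :
  reg s0 20 + reg s0 10 <= W ->
  (forall a s, a < reg s0 10 -> reg s 31 = a -> (forall x, x < 31 -> reg s x = reg s0 x) ->
    (forall x, ~~ in_slot (reg s0 20) (reg s0 10) x -> smem s x = smem s0 x) ->
    ok W body s (fun T s' => [/\ T <= Tb, forall x, x < 32 -> reg s' x = reg s x &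
      smem s' = upd (smem s) (reg s0 20 + a) (f a)])) ->
  (forall T s', T <= reg s0 10 * (Tb + 12) + 9 -> (forall x, x < 31 -> reg s' x = reg s0 x) ->
     (forall x, smem s' x = if in_slot (reg s0 20) (reg s0 10) x then f (x - reg s0 20) else smem s0 x) ->
     Q T s') ->
  ok W (For 31 10 body) s0 Q.
Proof.
move=> hW Hb HQ.
apply: (ok_for (Tb := Tb) (n := reg s0 10) (I := fun i s => [/\ reg s 31 = i,
  forall x, x < 31 -> reg s x = reg s0 x &
  forall x, smem s x = if in_slot (reg s0 20) i x then f (x - reg s0 20) else smem s0 x])) => //.
- by lia.
- split; regs => //; first by move=> x x31; rewrite (ltn_eqF x31).
  by move=> x; rewrite /in_slot addn0; case: leqP => // /leq_gtF ->.
- by move=> i s [r31 H _]; split=> //; apply: H.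
- move=> i s iZ [r31 rs ms].
  apply: ok_conseq (Hb i s iZ r31 rs _) _.
    move=> x; rewrite /in_slot ms => nx; case: ifP => // hx; exfalso; move: nx hx.
    rewrite /in_slot; lia.
  move=> T s' _ [hT rs' ms']; split=> //; first by rewrite rs'.
  split; regs => //; first by move=> x x31; rewrite (ltn_eqF x31) rs' ?rs // ltnW.
  move=> x; rewrite ms' /upd; case: eqP => [->|nx].
    by rewrite addKn /in_slot leq_addr ltn_add2l ltnSn.
  rewrite ms /in_slot; congr (if _ then _ else _); lia.
by move=> T s' hT [_ rs ms]; apply: HQ.
Qed.

Definition Copy : cmd := For 31 10 (Sto ($19 +! $31) (EL ($20 +! $31))).

Definition cell_body (E : expr) : cmd :=
  Asg 32 ($31 /! $8) ;! Asg 33 ($31 -! $32 *! $8) ;!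
  Asg 34 (Emod ($32 /! $17) (#!6)) ;! Asg 35 (Emod ($32 /! $18) (#!6)) ;!
  Asg 36 E ;! Sto ($20 +! $31) (Emod ($36) (#!2)).

Lemma ok_fill_cells E s0 f Q :
  reg s0 20 + reg s0 10 <= W ->
  (forall a s, a < reg s0 10 -> bdd W s -> reg s 31 = a ->
    (forall x, x < 31 -> reg s x = reg s0 x) ->
    reg s 32 = a %/ reg s0 8 -> reg s 33 = a %% reg s0 8 ->
    reg s 34 = a %/ reg s0 8 %/ reg s0 17 %% 6 ->
    reg s 35 = a %/ reg s0 8 %/ reg s0 18 %% 6 ->
    (forall x, ~~ in_slot (reg s0 20) (reg s0 10) x -> smem s x = smem s0 x) ->
    esafe W s E /\ ev s E %% 2 = f a) ->
  (forall T s', T <= reg s0 10 * (ecost E + 100) + 9 -> (forall x, x < 31 -> reg s' x = reg s0 x) ->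
     (forall x, smem s' x = if in_slot (reg s0 20) (reg s0 10) x then f (x - reg s0 20) else smem s0 x) ->
     Q T s') ->
  ok W (For 31 10 (cell_body E)) s0 Q.
Proof.
move=> hW HE HQ.
apply: (ok_fill (Tb := ecost E + 88) (f := f)) => //; last first.
  by move=> T s' hT; apply: HQ; lia.
move=> a s aZ r31 rs ms; apply: ok_bdd => bs.
have aW : a <= W by rewrite -r31; case: bs.
have W6 : 6 <= W by lia.
have W2 : 2 <= W by lia.
apply: ok_seq; apply: ok_asg => //.
apply: ok_seq; apply: ok_asg => //.
  split=> //; split=> //=; regs; rewrite r31; apply: leq_trans aW; exact: leq_divM.
apply: ok_seq; apply: ok_bdd => b1; apply: ok_asg => //; first by apply: (esafe_Emod b1).
apply: ok_seq; apply: ok_bdd => b2; apply: ok_asg => //; first by apply: (esafe_Emod b2).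
apply: ok_seq; apply: ok_bdd => b3.
move: b3; rewrite !ev_Emod /= /upd /= r31 !rs //; set s3 := set_reg _ 35 _ => b3.
have E33 : reg s3 33 = a %% reg s0 8.
  by rewrite /s3; regs; rewrite {1}(divn_eq a (reg s0 8)) addKn.
have [sE vE] : esafe W s3 E /\ ev s3 E %% 2 = f a.
  apply: HE => //.
  by move=> x x31; rewrite /s3; regs; rewrite !ltn_eqF ?rs //; lia.
apply: ok_asg => //; apply: ok_bdd => b4; apply: ok_sto.
- split=> //; rewrite /s3; regs; rewrite r31 rs //; lia.
- by apply: (esafe_Emod b4).
rewrite ev_Emod; split.
- rewrite /=; lia.
- by move=> x x31; rewrite /s3; regs; rewrite !ltn_eqF //; lia.
by rewrite -vE /s3; regs; rewrite r31 rs.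
Qed.

Lemma ok_copy s0 Q :
  reg s0 20 + reg s0 10 <= W -> reg s0 19 + reg s0 10 <= W ->
  (forall a, a < reg s0 10 -> ~~ in_slot (reg s0 19) (reg s0 10) (reg s0 20 + a)) ->
  (forall T s', T <= reg s0 10 * 100 + 9 -> (forall x, x < 31 -> reg s' x = reg s0 x) ->
     (forall x, smem s' x = if in_slot (reg s0 19) (reg s0 10) x then smem s0 (reg s0 20 + (x - reg s0 19)) else smem s0 x) ->
     Q T s') ->
  ok W Copy s0 Q.
Proof.
move=> hW1 hW2 dis HQ.
apply: (ok_for (Tb := 20) (n := reg s0 10) (I := fun i s => [/\ reg s 31 = i,
  forall x, x < 31 -> reg s x = reg s0 x &
  forall x, smem s x = if in_slot (reg s0 19) i x then smem s0 (reg s0 20 + (x - reg s0 19)) else smem s0 x])) => //.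
- by lia.
- split; regs => //; first by move=> x x31; rewrite (ltn_eqF x31).
  by move=> x; rewrite /in_slot addn0; case: leqP => // /leq_gtF ->.
- by move=> i s [r31 H _]; split=> //; apply: H.
- move=> i s iZ [r31 rs ms].
  apply: ok_sto; first by split=> //; rewrite /= r31 !rs //; lia.
    by split=> //; rewrite /= r31 !rs //; lia.
  split; rewrite /= ?r31 //.
  split=> //; regs; first by move=> x x31; rewrite (ltn_eqF x31) rs.
  move=> x; rewrite !rs //; case: eqP => [->|nx].
    rewrite addKn /in_slot leq_addr ltn_add2l ltnSn /=.
    have := dis i iZ; rewrite ms /in_slot; case: ifP => //; lia.
  rewrite ms /in_slot; congr (if _ then _ else _); lia.
move=> T s' hT [_ rs ms]; apply: HQ => //; lia.
Qed.

End Macros.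

(** * Table operations on the machine *)

Definition mexpE (m : mono) : expr :=
  #!(m.1.1) +! $5 *! #!(m.1.2) +! $6 *! #!(m.2).

(** The monomial lists depend on digits only, so they are unrolled over all digits into one
    expression of constant size, in which indicators select the digit at hand. *)
Definition leafE : expr :=
  esum (iota 0 6) (fun d => esum (leaf_l d) (fun m =>
    Eeq ($34) (#!d) *! Eeq ($33) (mexpE m))).

Definition relabelE : expr :=
  EL ($19 +! ((($32 -! $34 *! $17) +! $35 *! $17) *! $8 +! $33)).

Definition join_termE (d d' a b : nat) (m : mono) : expr :=
  Eeq ($34) (#!d) *! (Eeq ($35) (#!d') *!
    (Ele (mexpE m) ($33 +! #!2 *! $6) *! (Elt ($33 +! #!2 *! $6 -! mexpE m) ($8) *!
      EL ($19 +! ((((($32 -! $34 *! $17) +! #!a *! $17) -! $35 *! $18) +! #!b *! $18) *! $8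
           +! ($33 +! #!2 *! $6 -! mexpE m)))))).

Definition joinE : expr :=
  esum (iota 0 6) (fun d => esum (iota 0 6) (fun d' => esum (join_l d d') (fun t =>
    esum t.2 (fun m => join_termE d d' t.1.1 t.1.2 m)))).

(** The number of summands of [joinE]; as each of them is 0 or 1, it bounds the value before
    reduction modulo 2. *)
Definition join_size : nat :=
  \sum_(d <- iota 0 6) \sum_(d' <- iota 0 6) \sum_(t <- join_l d d') size t.2.

Arguments leafE : simpl never.
Arguments joinE : simpl never.
Arguments join_size : simpl never.
(** Keeps the definition accessible after [join_size] is made opaque, which prevents tactics from
    evaluating the sum over all 36 pairs of digits. *)
Lemma join_sizeE : join_size =
  \sum_(d <- iota 0 6) \sum_(d' <- iota 0 6) \sum_(t <- join_l d d') size t.2.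
Proof. by []. Qed.
Global Opaque join_size.

Definition cmd_intro : cmd :=
  Asg 20 ($12) ;! Pow 17 15 ;! For 31 10 (cell_body leafE) ;!
  Asg 12 ($12 +! $10) ;! Asg 13 ($13 +! #!2).

Definition cmd_unary (E : expr) : cmd :=
  Asg 20 ($12) ;! Asg 19 ($12 -! $10) ;! Pow 17 15 ;! Pow 18 16 ;!
  For 31 10 (cell_body E) ;! Copy.

Definition union_body : cmd :=
  Asg 32 ($31 /! $8) ;! Asg 33 ($31 -! $32 *! $8) ;! Asg 38 ($32 *! $8) ;!
  Asg 36 (#!0) ;!
  For 37 8 (Asg 36 ($36 +! Ele ($37) ($33) *!
     (EL ($19 +! $38 +! $37) *! EL ($12 +! $38 +! ($33 -! $37))))) ;!
  Sto ($20 +! $31) (Emod ($36) (#!2)).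

Definition cmd_union : cmd :=
  Asg 12 ($12 -! $10) ;! Asg 19 ($12 -! $10) ;! Asg 20 ($12 +! $10) ;!
  For 31 10 union_body ;! Copy ;! Asg 13 ($13 +! #!1).

Lemma ev_const s c : ev s (#!c) = c. Proof. by []. Qed.

Lemma term_le_sum (T : eqType) (F : T -> nat) (l : seq T) x : x \in l -> F x <= \sum_(y <- l) F y.
Proof. by move=> xl; rewrite (big_rem x) //= leq_addr. Qed.

Lemma sum_indicator (l : seq nat) d (F : nat -> nat) : uniq l -> d \in l ->
  \sum_(x <- l) (d == x) * F x = F d.
Proof.
move=> ul dl; rewrite (bigD1_seq d) //= eqxx mul1n big1 ?addn0 // => x.
by rewrite eq_sym => /negPf->.
Qed.

Section Ops.
Variables (W k N D Tb Lw : nat).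
Let pw := 6 ^ k.+1.
Let Z := pw * D.
Hypothesis N_gt0 : 0 < N.
Hypothesis D_big : 2 * hexp N + 12 * N + 10 <= 2 * D.
Hypothesis W_big : Tb + (Lw + 25) * Z <= W.
Hypothesis W_join : join_size + 20 <= W.

Definition consts (s : state) : Prop :=
  [/\ reg s 1 = k, reg s 5 = 2 * N, reg s 6 = hexp N, reg s 8 = D &
      [/\ reg s 9 = pw, reg s 10 = Z & reg s 11 = Tb]].

(* Cell [q D + p] of a slot holds the coefficient of X^p in the table entry at
   the base-6 digits of [q]. *)
Definition cell (F : table) (a : nat) : nat := bit (F (dig (a %/ D))) (a %% D).

Definition tab0 : table := fun=> 0%R.

Definition tabs (st : seq table) (m : nat -> nat) : Prop :=
  forall idx a, idx < size st -> a < Z -> m (Tb + idx * Z + a) = cell (nth tab0 st idx) a.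

Definition small (F : table) : Prop := forall q, size (F q) <= D.

Lemma D_gt0 : 0 < D. Proof. by move: D_big; case: D => //; lia. Qed.
Lemma pw_gt0 : 0 < pw. Proof. by rewrite expn_gt0. Qed.
Lemma k_pw : k < pw. Proof. by apply: ltn_trans (ltnSn k) _; apply: ltn_expl. Qed.
Lemma D_le_Z : D <= Z. Proof. by rewrite leq_pmull // pw_gt0. Qed.
Lemma pw_le_Z : pw <= Z. Proof. by rewrite leq_pmulr // D_gt0. Qed.
Lemma Z_gt0 : 0 < Z. Proof. exact: leq_trans D_gt0 D_le_Z. Qed.
Lemma Z_W : 25 * Z <= W.
Proof. by apply: leq_trans W_big; rewrite mulnDl addnA leq_addl. Qed.

Lemma cell_lt2 F a : cell F a < 2. Proof. exact: bit_lt2. Qed.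

Lemma tabs_push st F (m m' : nat -> nat) : tabs st m ->
  (forall x, x < Tb + size st * Z -> m' x = m x) ->
  (forall a, a < Z -> m' (Tb + size st * Z + a) = cell F a) -> tabs (rcons st F) m'.
Proof.
move=> H low HF idx a; rewrite size_rcons ltnS leq_eqVlt nth_rcons => /predU1P[->|lt] aZ.
  by rewrite ltnn eqxx HF.
have : idx.+1 * Z <= size st * Z by rewrite leq_mul2r lt orbT.
by rewrite lt mulSn => h; rewrite low ?H //; lia.
Qed.

Lemma tabs_pop st F m : tabs (rcons st F) m -> tabs st m.
Proof.
by move=> H idx a hi aZ; rewrite H // ?size_rcons ?ltnS 1?ltnW // nth_rcons hi.
Qed.

Lemma mexpE_ok (s : state) m : bdd W s -> reg s 5 = 2 * N -> reg s 6 = hexp N ->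
  mono_le 1 6 2 m -> esafe W s (mexpE m) /\ ev s (mexpE m) = mexp N m.
Proof.
move=> bs r5 r6 /and3P[m1 m2 m3].
have E : ev s (mexpE m) = mexp N m by rewrite /= r5 r6.
have DW : 25 * D <= W by apply: leq_trans Z_W; rewrite leq_mul2l D_le_Z orbT.
have h1 : 2 * N * m.1.2 <= 2 * N * 6 by rewrite leq_mul2l m2 orbT.
have h2 : hexp N * m.2 <= hexp N * 2 by rewrite leq_mul2l m3 orbT.
split=> //; move: D_big h1 h2; rewrite /= r5 r6; move: (hexp N) (hexp N * m.2) (2 * N * m.1.2).
move=> h h' n' *.
by do !split=> //; lia.
Qed.

Lemma leafE_ok s d p : bdd W s -> reg s 5 = 2 * N -> reg s 6 = hexp N ->
  reg s 34 = d -> reg s 33 = p -> d < 6 ->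
  esafe W s leafE /\ ev s leafE %% 2 = bit (peval N (leaf_l d)) p.
Proof.
move=> bs r5 r6 r34 r33 d6.
have mo d' m : m \in leaf_l d' -> esafe W s (mexpE m) /\ ev s (mexpE m) = mexp N m.
  move=> ml; apply: mexpE_ok => //; exact: (allP (@mono_le_weaken 1 3 1 1 6 2 _ isT isT isT (leaf_mono_le d')) m ml).
have W20 : 20 <= W by apply: leq_trans W_join; rewrite leq_addl.
have W1 : 0 < W by lia.
have tE d' m : m \in leaf_l d' -> d' < 6 ->
  esafe W s (Eeq ($34) (#!d') *! Eeq ($33) (mexpE m)) /\
  ev s (Eeq ($34) (#!d') *! Eeq ($33) (mexpE m)) = (d == d') * (p == mexp N m).
  move=> ml d'6; have [sm em] := mo _ _ ml; split; last first.
    by rewrite ev_mul !ev_Eeq em /= r34 r33.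
  apply: esafe_mulb => //; last by rewrite ev_Eeq leq_b1.
    by apply: esafe_Eeq => //=; lia.
  exact: esafe_Eeq.
have iE d' : d' < 6 -> ev s (esum (leaf_l d') (fun m => Eeq ($34) (#!d') *! Eeq ($33) (mexpE m)))
    = (d == d') * \sum_(m <- leaf_l d') (p == mexp N m).
  move=> d'6; rewrite ev_esum big_distrr big_seq [RHS]big_seq; apply: eq_bigr => m ml.
  by have [_ ->] := tE d' m ml d'6.
have oE : ev s leafE = \sum_(m <- leaf_l d) (p == mexp N m).
  rewrite /leafE ev_esum -(@sum_indicator (iota 0 6) d
    (fun d' => \sum_(m <- leaf_l d') (p == mexp N m))) ?iota_uniq ?mem_iota //.
  by apply: eq_big_seq => d'; rewrite mem_iota => /iE.
have cnt d' : \sum_(m <- leaf_l d') (p == mexp N m) <= 10.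
  apply: (@leq_trans (size (leaf_l d'))).
    rewrite -sum1_size; apply: leq_sum => m _; exact: leq_b1.
  rewrite /leaf_l /w_l; case: (d' == 5) => //.
  by case: (d' == 1 + false); case: (d' == 3 + false);
    case: (d' == 1 + true); case: (d' == 3 + true).
split; last by rewrite oE bit_peval.
apply: esafe_esum => [d'|].
  rewrite mem_iota => d'6; apply: esafe_esum => [m ml|]; first by case: (tE d' m ml d'6).
  rewrite -ev_esum iE //; case: (d == d') => //; rewrite mul1n.
  by apply: leq_trans (cnt _) _; lia.
rewrite -ev_esum -/leafE oE; apply: leq_trans (cnt _) _; lia.
Qed.

Lemma join_digits_lt d d' t : d < 6 -> d' < 6 -> t \in join_l d d' -> (t.1.1 < 6) && (t.1.2 < 6).
Proof.
move=> d6 d'6; have crossP a b w : a < 6 -> b < 6 -> t \in cross a b w -> (t.1.1 < 6) && (t.1.2 < 6).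
  by move=> a6 b6; rewrite !inE => /or4P[] /eqP->; apply/andP; split.
have colorP c : t \in join_color d d' c -> (t.1.1 < 6) && (t.1.2 < 6).
  rewrite /join_color !mem_cat => /or3P[]; first by apply: crossP; case: c.
    by case: ifP => // _; rewrite mem_cat => /orP[]; apply: crossP; case: c.
  by case: ifP => // _; rewrite mem_cat => /orP[]; apply: crossP; case: c.
rewrite /join_l mem_cat => /orP[|]; last by rewrite mem_cat => /orP[]; exact: colorP.
by rewrite !inE => /or3P[] /eqP->; apply/andP; split.
Qed.

Section JoinExpr.
Variables (s : state) (F : table) (i j q p src : nat).
Hypotheses (bs : bdd W s) (ik : i <= k) (jk : j <= k) (ij : i != j)
  (r5 : reg s 5 = 2 * N) (r6 : reg s 6 = hexp N) (r8 : reg s 8 = D)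
  (r17 : reg s 17 = 6 ^ i) (r18 : reg s 18 = 6 ^ j) (r19 : reg s 19 = src)
  (r32 : reg s 32 = q) (r33 : reg s 33 = p) (r34 : reg s 34 = dig q i)
  (r35 : reg s 35 = dig q j) (qpw : q < pw) (pD : p < D)
  (srcW : src <= Tb + Lw * Z)
  (mF : forall x, x < Z -> smem s (src + x) = cell F x) (sF : small F).

Let jv (t : nat * nat * seq mono) (m : mono) : nat :=
  (mexp N m <= p + 2 * hexp N) * (p + 2 * hexp N - mexp N m < D) *
  bit (F (upd (upd (dig q) i t.1.1) j t.1.2)) (p + 2 * hexp N - mexp N m).

Lemma jv_le1 t m : jv t m <= 1.
Proof.
rewrite /jv; have := bit_lt2 (F (upd (upd (dig q) i t.1.1) j t.1.2)) (p + 2 * hexp N - mexp N m).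
by case: (mexp N m <= _); case: (_ - _ < D) => /= hb; rewrite ?mul0n ?mul1n // -ltnS.
Qed.

Lemma pow_le_pw l : l <= k -> 6 ^ l <= pw.
Proof. by move=> lk; rewrite leq_exp2l // ltnW. Qed.

(** While two digits are exchanged, the index is bounded crudely by [11 * pw]; the 25 spare slots in
    the word bound leave room for this. *)
Lemma join_addr_ok a b m : a < 6 -> b < 6 -> mono_le 1 6 2 m ->
  esafe W s (EL ($19 +! ((((($32 -! $34 *! $17) +! #!a *! $17) -! $35 *! $18) +! #!b *! $18) *! $8
           +! ($33 +! #!2 *! $6 -! mexpE m)))).
Proof.
move=> a6 b6 mm; have [sm em] := mexpE_ok bs r5 r6 mm.
have pi := pow_le_pw ik; have pj := pow_le_pw jk.
have h1 : dig q i * 6 ^ i <= 5 * pw by apply: leq_mul => //; rewrite -ltnS dig_lt.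
have h2 : dig q j * 6 ^ j <= 5 * pw by apply: leq_mul => //; rewrite -ltnS dig_lt.
have h3 : a * 6 ^ i <= 5 * pw by apply: leq_mul.
have h4 : b * 6 ^ j <= 5 * pw by apply: leq_mul.
have PZ := pw_le_Z; have DZ := D_le_Z; have ZW := Z_W.
have h5 : q - dig q i * 6 ^ i + a * 6 ^ i - dig q j * 6 ^ j + b * 6 ^ j <= 11 * pw by lia.
have h6 : (q - dig q i * 6 ^ i + a * 6 ^ i - dig q j * 6 ^ j + b * 6 ^ j) * D <= 11 * Z.
  by rewrite mulnA leq_mul2r h5 orbT.
have Hh : 2 * hexp N <= 2 * D by apply: leq_trans D_big; rewrite -addnA leq_addr.
have WB : Tb + Lw * Z + 25 * Z <= W by rewrite -addnA -mulnDl.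
have W20 : 20 <= W by apply: leq_trans W_join; rewrite leq_addl.
rewrite [esafe _ _ _]/= -/(mexpE m).
move: em; rewrite /= => em.
rewrite !(r5, r6, r8, r17, r18, r19, r32, r33, r34, r35).
move: h1 h2 h3 h4 h5 h6; set x1 := dig q i * _; set x2 := dig q j * _.
set x3 := a * _; set x4 := b * _; set x5 := _ * D => h1 h2 h3 h4 h5 h6.
have := sm; rewrite /= r5 r6 => -[[s1 [_ s2 s3] s4] [_ s5 s6] s7].
by do !split=> //; lia.
Qed.

Lemma join_term_ok d d' t m : d < 6 -> d' < 6 -> t \in join_l d d' -> m \in t.2 ->
  esafe W s (join_termE d d' t.1.1 t.1.2 m) /\
  ev s (join_termE d d' t.1.1 t.1.2 m) = (dig q i == d) * ((dig q j == d') * jv t m).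
Proof.
move=> d6 d'6 tl ml; have /andP[a6 b6] := join_digits_lt d6 d'6 tl.
have mm : mono_le 1 6 2 m.
  exact: (allP (@mono_le_weaken 0 6 2 1 6 2 _ isT isT isT (join_mono_le tl)) m ml).
have sA := join_addr_ok a6 b6 mm; have [sm em] := mexpE_ok bs r5 r6 mm.
have W20 : 20 <= W by apply: leq_trans W_join; rewrite leq_addl.
have W1 : 0 < W by lia.
have Hh : 2 * hexp N <= 2 * D by apply: leq_trans D_big; rewrite -addnA leq_addr.
have DZ := D_le_Z; have ZW := Z_W.
have eP : ev s ($33 +! #!2 *! $6) = p + 2 * hexp N by rewrite /= r33 r6.
have sP : esafe W s ($33 +! #!2 *! $6).
  by rewrite /= r33 r6; do !split=> //; lia.
rewrite /join_termE; set A := EL _ in sA *.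
have eI : ev s ($33 +! #!2 *! $6 -! mexpE m) = p + 2 * hexp N - mexp N m.
  by rewrite -em -eP.
have sI : esafe W s ($33 +! #!2 *! $6 -! mexpE m) by split.
split.
  apply: (esafe_mulb bs); [|apply: (esafe_mulb bs); [|apply: (esafe_mulb bs); [|apply: (esafe_mulb bs)|]|]|].
  - by apply: (esafe_Eeq bs) => //=; lia.
  - by apply: (esafe_Eeq bs) => //=; lia.
  - exact: (esafe_Ele W1).
  - exact: (esafe_Elt W1).
  - exact: sA.
  - by rewrite ev_Elt leq_b1.
  - by rewrite ev_Ele leq_b1.
  - by rewrite ev_Eeq leq_b1.
  - by rewrite ev_Eeq leq_b1.
rewrite !ev_mul !ev_Eeq ev_Ele ev_Elt em eP eI /jv.
rewrite [ev s ($34)]/= [ev s ($35)]/= [ev s ($8)]/= r34 r35 r8 !ev_const.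
case: eqP => [di|_]; last by rewrite !mul0n.
case: eqP => [dj|_]; last by rewrite !mul0n.
rewrite !mul1n; case: (mexp N m <= _); last by rewrite !mul0n.
rewrite !mul1n; case: ltnP => ix; last by rewrite !mul0n.
rewrite !mul1n.
have -> : ev s A = smem s (src + (updn (updn q i t.1.1) j t.1.2 * D + (p + 2 * hexp N - mexp N m))).
  rewrite /A [LHS]/= -/(mexpE m) r5 r6 r8 r17 r18 r19 r32 r33 r34 r35 -/(mexp N m).
  rewrite /updn -/(updn q i t.1.1).
  by have -> : dig (updn q i t.1.1) j = dig q j
    by rewrite dig_updn // /upd eq_sym (negPf ij).
have ux : updn (updn q i t.1.1) j t.1.2 < pw by do !apply: updn_lt.
rewrite mF; last first.
  apply: (@leq_trans ((updn (updn q i t.1.1) j t.1.2).+1 * D)); first by rewrite mulSn addnC ltn_add2r.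
  by rewrite leq_mul2r ux orbT.
by rewrite /cell divnMDl ?D_gt0 // divn_small // addn0 modnMDl modn_small // !dig_updn.
Qed.

Lemma joinE_ok : esafe W s joinE /\ ev s joinE %% 2 = bit (tjoin N F i j (dig q)) p.
Proof.
pose tv d d' t := (dig q i == d) * ((dig q j == d') * \sum_(m <- t.2) jv t m).
have W20 : join_size <= W by apply: leq_trans W_join; rewrite leq_addr.
have e1 d d' t : d < 6 -> d' < 6 -> t \in join_l d d' ->
    ev s (esum t.2 (fun m => join_termE d d' t.1.1 t.1.2 m)) = tv d d' t.
  move=> d6 d'6 tl; rewrite ev_esum /tv !big_distrr; apply: eq_big_seq => m ml.
  by have [_ ->] := join_term_ok d6 d'6 tl ml.
have e2 d d' : d < 6 -> d' < 6 ->
    ev s (esum (join_l d d') (fun t => esum t.2 (fun m => join_termE d d' t.1.1 t.1.2 m)))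
    = (dig q i == d) * ((dig q j == d') * \sum_(t <- join_l d d') \sum_(m <- t.2) jv t m).
  move=> d6 d'6; rewrite ev_esum !big_distrr; apply: eq_big_seq => t tl; exact: e1.
have e3 d : d < 6 ->
    ev s (esum (iota 0 6) (fun d' => esum (join_l d d') (fun t => esum t.2 (fun m => join_termE d d' t.1.1 t.1.2 m))))
    = (dig q i == d) * \sum_(t <- join_l d (dig q j)) \sum_(m <- t.2) jv t m.
  move=> d6; rewrite ev_esum -(@sum_indicator (iota 0 6) (dig q j)
     (fun d' => \sum_(t <- join_l d d') \sum_(m <- t.2) jv t m)) ?iota_uniq ?mem_iota ?dig_lt //.
  rewrite big_distrr; apply: eq_big_seq => d'; rewrite mem_iota => d'6; exact: e2.
have e4 : ev s joinE = \sum_(t <- join_l (dig q i) (dig q j)) \sum_(m <- t.2) jv t m.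
  rewrite /joinE ev_esum -(@sum_indicator (iota 0 6) (dig q i)
     (fun d => \sum_(t <- join_l d (dig q j)) \sum_(m <- t.2) jv t m)) ?iota_uniq ?mem_iota ?dig_lt //.
  by apply: eq_big_seq => d; rewrite mem_iota => d6; exact: e3.
have c1 t : \sum_(m <- t.2) jv t m <= size t.2.
  by rewrite -sum1_size; apply: leq_sum => m _; exact: jv_le1.
have c2 d d' : \sum_(t <- join_l d d') \sum_(m <- t.2) jv t m <= \sum_(t <- join_l d d') size t.2.
  by apply: leq_sum => t _; exact: c1.
have jsE : join_size = \sum_(d <- iota 0 6) \sum_(d' <- iota 0 6) \sum_(t <- join_l d d') size t.2.
  exact: join_sizeE.
have c4 d d' : d < 6 -> d' < 6 -> \sum_(t <- join_l d d') size t.2 <= join_size.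
  move=> d6 d'6; rewrite jsE.
  have d'I : d' \in iota 0 6 by rewrite mem_iota.
  have dI : d \in iota 0 6 by rewrite mem_iota.
  apply: leq_trans (term_le_sum (fun d' => \sum_(t <- join_l d d') size t.2) d'I) _.
  exact: (term_le_sum (fun d => \sum_(d' <- iota 0 6) \sum_(t <- join_l d d') size t.2) dI).
have c3 d d' : d < 6 -> d' < 6 -> \sum_(t <- join_l d d') \sum_(m <- t.2) jv t m <= W.
  by move=> d6 d'6; apply: leq_trans (c2 _ _) (leq_trans (c4 _ _ d6 d'6) W20).
have b01 (x : bool) y z : y <= z -> x * y <= z by case: x; rewrite ?mul1n ?mul0n.
split; last by rewrite e4; apply: bit_tjoin.
apply: esafe_esum => [d|]; last first.
  by rewrite -ev_esum -/joinE e4; apply: c3; exact: dig_lt.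
rewrite mem_iota => d6; apply: esafe_esum => [d'|]; last first.
  by rewrite -ev_esum e3 //; apply: (b01); apply: c3 => //; exact: dig_lt.
rewrite mem_iota => d'6; apply: esafe_esum => [t tl|]; last first.
  by rewrite -ev_esum e2 //; apply: (b01); apply: (b01); apply: c3.
apply: esafe_esum => [m ml|]; first by case: (join_term_ok d6 d'6 tl ml).
rewrite -ev_esum e1 //; apply: (b01); apply: (b01); apply: leq_trans (c1 _) _.
apply: leq_trans (leq_trans (c4 _ _ d6 d'6) W20).
exact: (term_le_sum (fun t => size t.2) tl).
Qed.

End JoinExpr.

Lemma W_gt10 : 10 < W.
Proof. by apply: leq_trans W_join; rewrite addnC ltn_addr. Qed.

Lemma dig_cell a : a < Z -> (a %/ D < pw) && (a %% D < D).
Proof. by move=> aZ; rewrite ltn_mod D_gt0 ltn_divLR ?D_gt0 // aZ. Qed.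

Lemma slot_le m : m <= Lw + 2 -> Tb + m * Z + 20 * Z <= W.
Proof.
move=> hm; have := W_big; have : m * Z <= (Lw + 2) * Z by rewrite leq_mul2r hm orbT.
rewrite !mulnDl; lia.
Qed.

Definition KI : nat := ecost leafE + 400.

Lemma ok_intro st s Q : consts s -> reg s 12 = Tb + size st * Z -> reg s 15 <= k ->
  tabs st (smem s) -> size st <= Lw -> reg s 13 + 2 <= W ->
  (forall T s', T <= KI * Z -> (forall x, x < 12 -> reg s' x = reg s x) ->
     (forall x, x < Tb -> smem s' x = smem s x) ->
     reg s' 12 = Tb + (size st).+1 * Z -> reg s' 13 = reg s 13 + 2 ->
     tabs (rcons st (fun q => peval N (leaf_l (q (reg s 15))))) (smem s') -> Q T s') ->
  ok W cmd_intro s Q.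
Proof.
move=> [r1 r5 r6 r8 [r9 r10 r11]] r12 ik tb sL pcW HQ.
have Wg := W_gt10; have W1 : 1 < W by lia.
have sW : Tb + size st * Z + 20 * Z <= W by apply: slot_le; rewrite (leq_trans sL) // leq_addr.
have Zg := Z_gt0; have PZ := pw_le_Z; have DZ := D_le_Z; have kpw := k_pw.
apply: ok_seq; apply: ok_asg => //.
apply: ok_seq; apply: ok_pow => //; first by regs; apply: leq_trans (pow_le_pw ik) _; lia.
move=> T1 s1 hT1 r17 rs1 ms1.
have R1 x : x < 30 -> x != 17 -> x != 20 -> reg s1 x = reg s x.
  by move=> x3 x17 x20; rewrite rs1 //; regs; rewrite (negPf x20).
have r20 : reg s1 20 = Tb + size st * Z by rewrite rs1 //; regs.
have m1 : smem s1 = smem s by rewrite ms1.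
pose F : table := fun q => peval N (leaf_l (q (reg s 15))).
apply: ok_seq; apply: (ok_fill_cells Wg (f := cell F)) => //.
- by rewrite r20 R1 // r10; lia.
- move=> a s2; rewrite R1 // r10 => aZ b2 r31 rs2 r32 r33 r34 r35 ms2.
  have /andP[qpw pD] := dig_cell aZ.
  have E8 : reg s1 8 = D by rewrite R1.
  rewrite E8 in r33 r34.
  apply: (@leafE_ok s2 (dig (a %/ D) (reg s 15)) (a %% D) b2) => //.
  - by rewrite rs2 ?R1.
  - by rewrite rs2 ?R1.
  - by rewrite r34 r17 /dig; regs.
  - exact: dig_lt.
move=> T2 s2 hT2 rs2 ms2.
have R2 x : x < 30 -> x != 17 -> x != 20 -> reg s2 x = reg s x.
  by move=> x3 x17 x20; rewrite rs2 ?R1 //; apply: ltn_trans x3 _.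
apply: ok_seq; apply: ok_asg => //.
  by split=> //; rewrite /= !R2 // r12 r10; lia.
apply: ok_asg => //.
  by split=> //; regs; rewrite R2.
have low x : x < Tb + size st * Z -> smem s2 x = smem s x.
  by move=> hx; rewrite ms2 /in_slot r20 leqNgt hx m1.
apply: HQ.
- rewrite R1 // r10 in hT2; rewrite /KI; move: hT1 hT2; regs.
  move: (leq_ltn_trans ik kpw) PZ Zg; move: (reg s 15) (ecost leafE) (Z) (pw) => x e z p; clear; lia.
- by move=> x x12; regs; rewrite !ltn_eqF ?R2 //; lia.
- by move=> x xT; apply: low; apply: leq_trans xT (leq_addr _ _).
- by regs; rewrite !R2 // r12 r10 mulSn -addnA [size st * Z + _]addnC.
- by regs; rewrite R2.
apply: tabs_push tb low _ => a aZ; regs; rewrite ms2 /in_slot r20 R1 // r10 leq_addr ltn_add2l aZ /=.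
by rewrite addKn.
Qed.

(** The new table is built in the free slot above the stack and only then copied over its argument,
    because a cell may depend on argument cells at other indices. *)
Lemma ok_unary E st0 F F' s Q : consts s -> reg s 12 = Tb + (size st0).+1 * Z ->
  reg s 15 <= k -> reg s 16 <= k -> tabs (rcons st0 F) (smem s) -> size st0 < Lw ->
  (forall a s', a < Z -> bdd W s' -> consts s' ->
     reg s' 17 = 6 ^ reg s 15 -> reg s' 18 = 6 ^ reg s 16 ->
     reg s' 19 = Tb + size st0 * Z -> reg s' 32 = a %/ D -> reg s' 33 = a %% D ->
     reg s' 34 = dig (a %/ D) (reg s 15) -> reg s' 35 = dig (a %/ D) (reg s 16) ->
     (forall x, x < Z -> smem s' (Tb + size st0 * Z + x) = cell F x) ->
     esafe W s' E /\ ev s' E %% 2 = cell F' a) ->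
  (forall T s', T <= (ecost E + 600) * Z -> (forall x, x < 14 -> reg s' x = reg s x) ->
     (forall x, x < Tb -> smem s' x = smem s x) ->
     tabs (rcons st0 F') (smem s') -> Q T s') ->
  ok W (cmd_unary E) s Q.
Proof.
move=> [r1 r5 r6 r8 [r9 r10 r11]] r12 ik jk tb sL HE HQ.
have Wg := W_gt10; have W1 : 1 < W by lia.
have sW : Tb + (size st0).+1 * Z + 20 * Z <= W by apply: slot_le; rewrite (leq_trans sL) // leq_addr.
have Zg := Z_gt0; have PZ := pw_le_Z; have DZ := D_le_Z; have kpw := k_pw.
apply: ok_seq; apply: ok_asg => //.
apply: ok_seq; apply: ok_asg => //.
apply: ok_seq; apply: ok_pow => //; first by regs; apply: leq_trans (pow_le_pw ik) _; lia.
move=> T1 s1 hT1 r17 rs1 ms1.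
have R1 x : x < 30 -> x != 17 -> x != 19 -> x != 20 -> reg s1 x = reg s x.
  by move=> x3 x17 x19 x20; rewrite rs1 //; regs; rewrite (negPf x20) (negPf x19).
have r20 : reg s1 20 = Tb + (size st0).+1 * Z by rewrite rs1 //; regs.
have r19 : reg s1 19 = Tb + size st0 * Z by rewrite rs1 //; regs; rewrite r12 r10 mulSn; lia.
apply: ok_seq; apply: ok_pow => //; first by rewrite R1 //; apply: leq_trans (pow_le_pw jk) _; lia.
move=> T2 s2 hT2 r18 rs2 ms2.
have R2 x : x < 30 -> x != 17 -> x != 18 -> x != 19 -> x != 20 -> reg s2 x = reg s x.
  by move=> x3 x17 x18 x19 x20; rewrite rs2 ?R1.
have m2 : smem s2 = smem s by rewrite ms2 ms1.
have Q17 : reg s2 17 = 6 ^ reg s 15 by rewrite rs2 // r17; regs.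
have Q18 : reg s2 18 = 6 ^ reg s 16 by rewrite r18 R1.
have Q19 : reg s2 19 = Tb + size st0 * Z by rewrite rs2.
have Q20 : reg s2 20 = Tb + (size st0).+1 * Z by rewrite rs2.
have mF x : x < Z -> smem s (Tb + size st0 * Z + x) = cell F x.
  by move=> xZ; rewrite tb ?size_rcons // nth_rcons ltnn eqxx.
have E8 : reg s2 8 = D by rewrite R2.
have E10 : reg s2 10 = Z by rewrite R2.
apply: ok_seq; apply: (ok_fill_cells Wg (f := cell F')) => //.
- by rewrite Q20 E10; lia.
- move=> a s3; rewrite E10 E8 Q17 Q18 Q20 => aZ b3 r31 rs3 r32 r33 r34 r35 ms3.
  apply: HE => //; try by rewrite rs3.
    by split; [| | | |split]; rewrite rs3 // R2.
  move=> x xZ; rewrite ms3 ?m2 ?mF //; rewrite /in_slot mulSn; lia.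
move=> T3 s3 hT3 rs3 ms3.
have {rs3} R3 x : x < 30 -> reg s3 x = reg s2 x.
  by move=> x3; rewrite rs3 //; apply: ltn_trans x3 _.
have G10 : reg s3 10 = Z by rewrite R3.
have G19 : reg s3 19 = Tb + size st0 * Z by rewrite R3.
have G20 : reg s3 20 = Tb + (size st0).+1 * Z by rewrite R3.
rewrite Q20 E10 in ms3 hT3.
apply: (ok_copy Wg).
- by rewrite G20 G10; lia.
- rewrite G19 G10; move: sW; rewrite mulSn; lia.
- move=> a; rewrite G19 G20 G10 /in_slot mulSn; lia.
rewrite G19 G20 G10 => T4 s4 hT4 rs4 ms4.
have low x : x < Tb + size st0 * Z -> smem s4 x = smem s x.
  by move=> hx; rewrite ms4 ifN ?ms3 ?ifN ?m2 // /in_slot ?mulSn; lia.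
apply: HQ.
- have E16 : reg s1 16 = reg s 16 by rewrite R1.
  move: (leq_ltn_trans ik kpw) (leq_ltn_trans jk kpw) PZ Zg hT1 hT2 hT3 hT4.
  rewrite E16; regs; move: (reg s 15) (reg s 16) (ecost E) (Z) (pw) => x1 x2 e z p.
  clear; lia.
- move=> x x14; have ne m : 13 < m -> x != m by move=> hm; rewrite neq_ltn (leq_trans x14 hm).
  have lt m : 13 < m -> x < m by move=> hm; apply: leq_trans x14 hm.
  by rewrite rs4 ?R3 ?R2 ?lt ?ne.
- by move=> x xT; apply: low; apply: leq_trans xT (leq_addr _ _).
apply: (tabs_push (tabs_pop tb) low) => a aZ; rewrite ms4 /in_slot leq_addr ltn_add2l aZ /=.
rewrite addKn ms3 /in_slot leq_addr ltn_add2l aZ /=.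
by rewrite addKn.
Qed.

Lemma ok_relabel st0 F s Q : consts s -> reg s 12 = Tb + (size st0).+1 * Z ->
  reg s 15 <= k -> reg s 16 <= k -> tabs (rcons st0 F) (smem s) -> size st0 < Lw ->
  (forall T s', T <= (ecost relabelE + 600) * Z -> (forall x, x < 14 -> reg s' x = reg s x) ->
     (forall x, x < Tb -> smem s' x = smem s x) ->
     tabs (rcons st0 (fun q => F (upd q (reg s 15) (q (reg s 16))))) (smem s') -> Q T s') ->
  ok W (cmd_unary relabelE) s Q.
Proof.
move=> cs r12 ik jk tb sL; apply: (ok_unary (F := F)) => // a s' aZ b' [c1 c5 c6 c8 _] r17 r18 r19 r32 r33 r34 r35 mF.
have /andP[qpw pD] := dig_cell aZ; set q := a %/ D in qpw r32 r34 r35 *.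
set i := reg s 15 in ik r17 r34 *; set j := reg s 16 in jk r18 r35 *.
have pi := pow_le_pw ik; have PZ := pw_le_Z; have DZ := D_le_Z; have ZW := Z_W.
have sW : Tb + (size st0) * Z + 20 * Z <= W by apply: slot_le; rewrite (leq_trans (ltnW sL)) // leq_addr.
have d5 : dig q j <= 5 by rewrite -ltnS dig_lt.
have h1 : dig q i * 6 ^ i <= 5 * pw by apply: leq_mul => //; rewrite -ltnS dig_lt.
have h3 : dig q j * 6 ^ i <= 5 * pw by apply: leq_mul.
have ux : updn q i (dig q j) < pw by apply: updn_lt => //; exact: dig_lt.
have uD : updn q i (dig q j) * D + a %% D < Z.
  apply: (@leq_trans ((updn q i (dig q j)).+1 * D)); first by rewrite mulSn addnC ltn_add2r.
  by rewrite leq_mul2r ux orbT.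
have eE : ev s' relabelE = cell F (updn q i (dig q j) * D + a %% D).
  by rewrite /relabelE /= r19 r32 r34 r17 r35 c8 r33 mF.
rewrite eE; split; last first.
  rewrite modn_small ?cell_lt2 // /cell divnMDl ?D_gt0 // [_ %% D %/ D]divn_small // addn0.
  by rewrite modnMDl modn_mod dig_updn ?dig_lt.
rewrite /relabelE /= r19 r32 r34 r17 r35 c8 r33.
move: uD; rewrite /updn; set X := dig q i * _; set Y := dig q j * _ => uD.
by do !split=> //; lia.
Qed.

Lemma ok_join st0 F s Q : consts s -> reg s 12 = Tb + (size st0).+1 * Z ->
  active k (reg s 15) (reg s 16) -> tabs (rcons st0 F) (smem s) -> size st0 < Lw ->
  small F ->
  (forall T s', T <= (ecost joinE + 600) * Z -> (forall x, x < 14 -> reg s' x = reg s x) ->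
     (forall x, x < Tb -> smem s' x = smem s x) ->
     tabs (rcons st0 (tjoin N F (reg s 15) (reg s 16))) (smem s') -> Q T s') ->
  ok W (cmd_unary joinE) s Q.
Proof.
move=> cs r12 /and3P[ik jk ij] tb sL sF HQ.
apply: (@ok_unary joinE st0 F (tjoin N F (reg s 15) (reg s 16)) s Q cs r12 ik jk tb sL _ HQ).
move=> a s' aZ b' [c1 c5 c6 c8 _] r17 r18 r19 r32 r33 r34 r35 mF.
have /andP[qpw pD] := dig_cell aZ.
apply: (@joinE_ok s' F _ _ _ _ (Tb + size st0 * Z) b' ik jk ij c5 c6 c8 r17 r18 r19 r32 r33 r34 r35 qpw pD _ mF sF).
by rewrite leq_add2l leq_mul2r (ltnW sL) orbT.
Qed.

Lemma ok_union st0 F G s Q : consts s -> reg s 12 = Tb + (size st0).+2 * Z ->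
  tabs (rcons (rcons st0 F) G) (smem s) -> (size st0).+1 < Lw -> reg s 13 + 1 <= W ->
  (forall T s', T <= 300 * (Z * D) -> (forall x, x < 12 -> reg s' x = reg s x) ->
     (forall x, x < Tb -> smem s' x = smem s x) ->
     reg s' 12 = Tb + (size st0).+1 * Z -> reg s' 13 = reg s 13 + 1 ->
     tabs (rcons st0 (fun q => F q * G q)%R) (smem s') -> Q T s') ->
  ok W cmd_union s Q.
Proof.
move=> [r1 r5 r6 r8 [r9 r10 r11]] r12 tb sL pcW HQ.
have Wg := W_gt10; have W1 : 1 < W by lia.
have W2 : 2 <= W by lia.
have W0 : 0 < W by lia.
have sW : Tb + (size st0).+2 * Z + 20 * Z <= W by apply: slot_le; rewrite -addn1 leq_add // ltnW.
have Zg := Z_gt0; have DZ := D_le_Z; have Dg := D_gt0.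
set H := fun q => _ in HQ.
have mF x : x < Z -> smem s (Tb + size st0 * Z + x) = cell F x.
  by move=> xZ; rewrite tb ?size_rcons // !nth_rcons size_rcons ltnS leqnn ltnn eqxx.
have mG x : x < Z -> smem s (Tb + (size st0).+1 * Z + x) = cell G x.
  by move=> xZ; rewrite tb ?size_rcons //; rewrite !nth_rcons size_rcons ltnn eqxx.
apply: ok_seq; apply: ok_asg => //.
apply: ok_seq; apply: ok_asg => //.
apply: ok_seq; apply: ok_asg => //.
  split=> //; regs; rewrite r12 r10; lia.
set s1 := set_reg _ 20 _.
have R1 x : x != 12 -> x != 19 -> x != 20 -> reg s1 x = reg s x.
  by move=> *; rewrite /s1; regs; rewrite !ifN.
have e10 : reg s1 10 = Z by rewrite R1.
have e8 : reg s1 8 = D by rewrite R1.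
have e12 : reg s1 12 = Tb + (size st0).+1 * Z by rewrite /s1; regs; rewrite r12 r10 mulSn; lia.
have e19 : reg s1 19 = Tb + size st0 * Z by rewrite /s1; regs; rewrite r12 r10 !mulSn; lia.
have e20 : reg s1 20 = Tb + (size st0).+2 * Z by rewrite /s1; regs; rewrite r12 r10 !mulSn; lia.
have m1 : smem s1 = smem s by [].
move: s1 R1 e10 e8 e12 e19 e20 m1 => s1 R1 e10 e8 e12 e19 e20 m1.
apply: ok_seq; apply: (ok_fill Wg (f := cell H) (Tb := 60 + D * 60)).
- by rewrite e20 e10; lia.
- move=> a s2; rewrite e10 e20 => aZ r31 rs2 ms2; apply: ok_bdd => b2.
  have /andP[qpw pD] := dig_cell aZ; set q := a %/ D in qpw; set p := a %% D in pD.
  have qDZ : q * D + D <= Z by rewrite addnC -mulSn leq_mul2r qpw orbT.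
  have aE : a = q * D + p by exact: divn_eq.
  have mF2 x : x < D -> smem s2 (Tb + size st0 * Z + q * D + x) = bit (F (dig q)) x.
    move=> xD; rewrite ms2; last by rewrite /in_slot !mulSn; lia.
    rewrite m1 -addnA mF; last by lia.
    by rewrite /cell divnMDl // divn_small // addn0 modnMDl modn_small.
  have mG2 x : x < D -> smem s2 (Tb + (size st0).+1 * Z + q * D + x) = bit (G (dig q)) x.
    move=> xD; rewrite ms2; last by rewrite /in_slot !mulSn; lia.
    rewrite m1 -addnA mG; last by lia.
    by rewrite /cell divnMDl // divn_small // addn0 modnMDl modn_small.
  have DW : D <= W by lia.
  apply: ok_seq; apply: ok_asg => //.
  apply: ok_seq; apply: ok_asg => //.
    split=> //; split=> //; regs; rewrite r31 rs2 // e8 -/q; lia.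
  apply: ok_seq; apply: ok_asg => //.
    split=> //; regs; rewrite r31 rs2 // e8 -/q; lia.
  apply: ok_seq; apply: ok_asg => //.
  set s3 := set_reg _ 36 _.
  have R3 x : x < 32 -> reg s3 x = reg s2 x.
    by move=> x3; rewrite /s3; regs; rewrite !ltn_eqF //; lia.
  have f33 : reg s3 33 = p by rewrite /s3; regs; rewrite r31 rs2 // e8 -/q; lia.
  have f38 : reg s3 38 = q * D by rewrite /s3; regs; rewrite r31 rs2 // e8 -/q.
  have f36 : reg s3 36 = 0 by rewrite /s3; regs.
  have m3 : smem s3 = smem s2 by [].
  have f8 : reg s3 8 = D by rewrite R3 // rs2.
  have f12 : reg s3 12 = Tb + (size st0).+1 * Z by rewrite R3 // rs2.
  have f19 : reg s3 19 = Tb + size st0 * Z by rewrite R3 // rs2.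
  have f20 : reg s3 20 = Tb + (size st0).+2 * Z by rewrite R3 // rs2.
  have f31 : reg s3 31 = a by rewrite R3.
  have f10 : reg s3 10 = Z by rewrite R3 // rs2.
  move: s3 R3 f33 f38 f36 m3 f8 f12 f19 f20 f31 f10 => s3 R3 f33 f38 f36 m3 f8 f12 f19 f20 f31 f10.
  pose tm r := (r <= p) * (bit (F (dig q)) r * bit (G (dig q)) (p - r)).
  have tm1 r : tm r <= 1.
    rewrite /tm; have := bit_lt2 (F (dig q)) r; have := bit_lt2 (G (dig q)) (p - r).
    by case: (r <= p); case: (bit _ _) => [|[]] //; case: (bit _ _) => [|[]].
  apply: ok_seq; apply: (ok_for (Tb := 40) (n := D) (I := fun i s' => [/\ reg s' 37 = i,
     reg s' 36 = \sum_(0 <= r < i) tm r, forall x, x != 36 -> x != 37 -> reg s' x = reg s3 x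
     & smem s' = smem s2])) => //.
  + split; regs => //; first by rewrite big_geq.
    by move=> x x36 /negPf ->.
  + by move=> i s' [h37 _ hr _]; split=> //; rewrite hr // f8.
  + move=> i s' iD [g37 g36 gr gm]; apply: ok_bdd => b5.
    have sum_le j : \sum_(0 <= r < j) tm r <= j.
      rewrite -[leqRHS]muln1 -[in leqRHS](subn0 j) -sum_nat_const_nat.
      by apply: leq_sum => r _; exact: tm1.
    have eT : ev s' (Ele ($37) ($33) *! (EL ($19 +! $38 +! $37) *! EL ($12 +! $38 +! ($33 -! $37)))) = tm i.
      rewrite !ev_mul ev_Ele /= g37 !gr // f33 f19 f38 f12 gm mF2 //.
      case: (leqP i p) => ip; last by rewrite /tm leqNgt ip !mul0n.
      by rewrite mG2 /tm ?ip //; lia.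
    have sT : esafe W s' (Ele ($37) ($33) *! (EL ($19 +! $38 +! $37) *! EL ($12 +! $38 +! ($33 -! $37)))).
      have W1' : 0 < W by lia.
      have sA : esafe W s' (EL ($19 +! $38 +! $37)).
        by rewrite /= g37 !gr // f19 f38; do !split=> //; lia.
      have sB : esafe W s' (EL ($12 +! $38 +! ($33 -! $37))).
        by rewrite /= g37 !gr // f12 f38 f33; do !split=> //; rewrite ?mulSn in sW *; lia.
      apply: (esafe_mulb b5); [exact: (esafe_Ele W1')| |by rewrite ev_Ele leq_b1].
      apply: (esafe_mulb b5) => //; rewrite /= g37 !gr // f19 f38 gm mF2 //.
      by rewrite -ltnS bit_lt2.
    apply: ok_asg => //.
      split=> //; change (ev s' ($36) + ev s' (Ele ($37) ($33) *! (EL ($19 +! $38 +! $37) *!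
        EL ($12 +! $38 +! ($33 -! $37)))) <= W).
      by rewrite eT [ev _ _]/= g36; have := sum_le i; have := tm1 i; lia.
    have -> : ev s' ($36 +! Ele ($37) ($33) *! (EL ($19 +! $38 +! $37) *! EL ($12 +! $38 +! ($33 -! $37))))
       = \sum_(0 <= r < i.+1) tm r.
      change (ev s' ($36) + ev s' (Ele ($37) ($33) *! (EL ($19 +! $38 +! $37) *!
        EL ($12 +! $38 +! ($33 -! $37)))) = \sum_(0 <= r < i.+1) tm r).
      by rewrite eT [ev _ _]/= g36 big_nat_recr.
    split; regs => //; split; regs => //.
    by move=> x x36 x37; rewrite (negPf x36) (negPf x37) gr.
  move=> T4 s4 hT4 [g37 g36 gr gm]; apply: ok_bdd => b4.
  apply: ok_sto.
  + by split=> //; rewrite /= !gr // f20 f31; lia.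
  + by apply: (esafe_Emod b4).
  rewrite ev_Emod /=; split.
  + by move: hT4; regs; lia.
  + by move=> x x32; regs; rewrite gr ?R3 //; rewrite neq_ltn (leq_trans x32).
  + rewrite /= gm (gr 20) // (gr 31) // f20 f31 g36; congr (upd _ _ _).
    rewrite /cell -/q -/p /H -bit_mul.
    (* The inner loop always makes [D] rounds; those beyond [p] are masked by the comparison in
       [tm]. *)
    have tail : \sum_(p.+1 <= r < D) tm r = 0.
      rewrite big_nat_cond; apply: big1 => r /andP[/andP[pr _] _].
      by rewrite /tm leqNgt pr.
    rewrite (@big_cat_nat _ _ _ p.+1) //= tail addn0; congr (_ %% _).
    by apply: eq_big_nat => r /andP[_ rp]; rewrite /tm -ltnS rp mul1n.
rewrite e10 e20 => T2 s2 hT2 rs2 ms2.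
have g10 : reg s2 10 = Z by rewrite rs2.
have g19 : reg s2 19 = Tb + size st0 * Z by rewrite rs2.
have g20 : reg s2 20 = Tb + (size st0).+2 * Z by rewrite rs2.
apply: ok_seq; apply: (ok_copy Wg).
- by rewrite g20 g10; lia.
- rewrite g19 g10; move: sW; rewrite !mulSn; lia.
- move=> a; rewrite g19 g20 g10 /in_slot !mulSn; lia.
rewrite g19 g20 g10 => T3 s3 hT3 rs3 ms3.
apply: ok_asg => //.
  by split=> //; regs; rewrite rs3 // rs2 // R1.
have low x : x < Tb + size st0 * Z -> smem s3 x = smem s x.
  by move=> hx; rewrite ms3 ifN ?ms2 ?ifN ?m1 // /in_slot ?mulSn; lia.
apply: HQ.
- move: hT2 hT3 Zg Dg; regs; move: (Z) (D) => z d; clear; nia.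
- move=> x x12; have ne m : 11 < m -> x != m by move=> hm; rewrite neq_ltn (leq_trans x12 hm).
  have lt m : 11 < m -> x < m by move=> hm; apply: leq_trans x12 hm.
  by regs; rewrite (negPf (ne 13 _)) // rs3 ?rs2 ?R1 ?lt ?ne.
- by move=> x xT; apply: low; apply: leq_trans xT (leq_addr _ _).
- by regs; rewrite rs3 // rs2.
- by regs; rewrite rs3 // rs2 // R1.
apply: (tabs_push (tabs_pop (tabs_pop tb)) low) => a aZ; regs; rewrite ms3 /in_slot leq_addr ltn_add2l aZ /=.
rewrite addKn ms2 /in_slot leq_addr ltn_add2l aZ /=.
by rewrite addKn.
Qed.

End Ops.

(** * Postfix tokens and the search for later joins *)

Global Opaque joinE leafE relabelE.

Inductive tok := TI of nat | TR of nat & nat | TJ of nat & nat | TU.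

Definition tcode (t : tok) : seq nat :=
  match t with
  | TI i => [:: 1; i]
  | TR i j => [:: 2; i; j]
  | TJ i j => [:: 3; i; j]
  | TU => [:: 4]
  end.

Definition code (l : seq tok) : seq nat := flatten (map tcode l).

Fixpoint toks (e : cexpr) : seq tok :=
  match e with
  | Intro i => [:: TI i]
  | Relabel i j e1 => rcons (toks e1) (TR i j)
  | Join i j _ e1 => rcons (toks e1) (TJ i j)
  | Union e1 e2 => toks e1 ++ rcons (toks e2) TU
  end.

Lemma code_cat l l' : code (l ++ l') = code l ++ code l'.
Proof. by rewrite /code map_cat flatten_cat. Qed.

Lemma code_toks e : code (toks e) = encode_expr e.
Proof.
elim: e => [i|i j e1 IH|i j ij e1 IH|e1 IH1 e2 IH2] //=.
- by rewrite -cats1 code_cat IH.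
- by rewrite -cats1 code_cat IH.
- by rewrite -cats1 !code_cat IH1 IH2.
Qed.

Lemma size_code l : size l <= size (code l).
Proof.
elim: l => //= t l IH; rewrite /code /= size_cat -/(code l).
by case: t => *; rewrite /= ?addSn ?ltnS; lia.
Qed.

(* Follows the labels [a] and [b] of an expression on top of the stack through
   the remaining tokens; [d] counts the expressions above it. *)
Fixpoint scan (l : seq tok) (d a b : nat) : bool :=
  match l with
  | [::] => false
  | TI _ :: l' => scan l' d.+1 a b
  | TU :: l' => scan l' d.-1 a b
  | TR i j :: l' =>
      if d == 0 then scan l' 0 (if a == i then j else a) (if b == i then j else b)
      else scan l' d a b
  | TJ i j :: l' =>
      ((d == 0) && (((a == i) && (b == j)) || ((a == j) && (b == i)))) || scan l' d a b
  end.

(** A complete expression has the net effect of one push, and its unary operations act above the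
    tracked expression. *)
Lemma scan_toks e l d a b : scan (toks e ++ l) d a b = scan l d.+1 a b.
Proof.
elim: e l d a b => [i|i j e1 IH|i j ij e1 IH|e1 IH1 e2 IH2] l d a b //=.
- by rewrite cat_rcons IH.
- by rewrite cat_rcons IH.
- by rewrite -catA cat_rcons IH1 IH2.
Qed.

Definition later (l : seq tok) : rel nat := fun a b => scan l 0 a b.

Lemma later_TR l i j : later (TR i j :: l) = later_relabel (later l) i j.
Proof. by []. Qed.

Lemma later_TJ l i j : later (TJ i j :: l) = later_join (later l) i j.
Proof.
by do 2 apply: functional_extensionality => ?; rewrite /later /= orbC.
Qed.

(** Used for the left operand of a union, with the right one still to be read. For the right operand
    no such lemma is required: [0.-1 = 0] keeps the depth at 0. *)
Lemma later_toks e l : later (toks e ++ TU :: l) = later l.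
Proof. by do 2 apply: functional_extensionality => ?; rewrite /later scan_toks. Qed.

(** The bound [x <= size l] includes the cell after the code, where [nth] gives 0: the end
    marker. *)
Definition seg (m : nat -> nat) (p : nat) (l : seq nat) : Prop :=
  forall x, x <= size l -> m (p + x) = nth 0 l x.

Lemma seg_cat m p l l' : seg m p (l ++ l') -> seg m (p + size l) l'.
Proof.
move=> H x hx; rewrite -addnA H; last by rewrite size_cat leq_add2l.
by rewrite nth_cat ltnNge leq_addr /= addKn.
Qed.

Definition foundE : expr :=
  Eeq ($24) ($27) *! Eeq ($25) ($28) +! Eeq ($24) ($28) *! Eeq ($25) ($27).

Definition scan_body : cmd :=
  Asg 26 (EL ($22)) ;! Asg 27 (EL ($22 +! #!1)) ;! Asg 28 (EL ($22 +! #!2)) ;!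
  IfE (Eeq ($26) (#!1)) (Asg 23 ($23 +! #!1) ;! Asg 22 ($22 +! #!2))
  (IfE (Eeq ($26) (#!4)) (Asg 23 ($23 -! #!1) ;! Asg 22 ($22 +! #!1))
    (Asg 22 ($22 +! #!3) ;!
     IfE ($23) Skip
       (IfE (Eeq ($26) (#!2))
          (IfE (Eeq ($24) ($27)) (Asg 24 ($28)) Skip ;!
           IfE (Eeq ($25) ($27)) (Asg 25 ($28)) Skip)
          (Asg 21 (#!1 -! (#!1 -! $21) *! (#!1 -! foundE)))))).

Definition scan_loop : cmd := WhileE (EL ($22)) scan_body.

Definition cmd_scan : cmd :=
  Asg 21 (#!0) ;! Asg 22 ($13) ;! Asg 23 (#!0) ;! Asg 24 ($15) ;! Asg 25 ($16) ;!
  scan_loop.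

Section Scan.
Variable W : nat.
Hypothesis W_gt10 : 10 < W.

Lemma ok_asg' x e s Q v : x < nvars -> esafe W s e -> ev s e = v ->
  Q (ecost e + 2) (set_reg s x v) -> ok W (Asg x e) s Q.
Proof. by move=> xn se <- q; apply: ok_asg. Qed.

(** Three words are fetched whatever the opcode, possibly past the end of the code; the summand 3 in
    the address bound allows for it. *)
Lemma ok_scan_body t l d a b (f : bool) s Q :
  reg s 21 = f -> reg s 23 = d -> reg s 24 = a -> reg s 25 = b ->
  seg (smem s) (reg s 22) (code (t :: l)) -> reg s 22 + size (code (t :: l)) + 3 <= W ->
  d < W ->
  (forall T s' d' a' b' (f' : bool), T <= 180 ->
     reg s' 21 = f' -> reg s' 23 = d' -> reg s' 24 = a' -> reg s' 25 = b' ->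
     (forall x, x < 21 -> reg s' x = reg s x) -> smem s' = smem s ->
     reg s' 22 = reg s 22 + size (tcode t) -> d' <= d.+1 ->
     f' || scan l d' a' b' = f || scan (t :: l) d a b -> Q T s') ->
  ok W scan_body s Q.
Proof.
move=> r21 r23 r24 r25 sg hW dW HQ.
have W0 : 0 < W by lia. have W1 : 1 < W by lia. have W2 : 2 < W by lia. have W3 : 3 < W by lia.
have c0 : smem s (reg s 22) = nth 0 (tcode t) 0.
  by rewrite -[reg s 22]addn0 sg //; case: (t).
have scE : size (code (t :: l)) = size (tcode t) + size (code l) by rewrite /code /= size_cat.
have cn x : x < size (tcode t) -> smem s (reg s 22 + x) = nth 0 (tcode t) x.
  move=> hx; rewrite sg; last by rewrite scE (leq_trans (ltnW hx)) // leq_addr.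
  by rewrite /code /= nth_cat hx.
apply: ok_seq; apply: (@ok_asg' _ _ _ _ (nth 0 (tcode t) 0)) => //.
apply: ok_seq; apply: (@ok_asg' _ _ _ _ (smem s (reg s 22 + 1))) => //.
  by split=> //; regs; lia.
apply: ok_seq; apply: (@ok_asg' _ _ _ _ (smem s (reg s 22 + 2))) => //.
  by split=> //; regs; lia.
set s3 := set_reg _ 28 _.
have E26 : reg s3 26 = nth 0 (tcode t) 0 by [].
have E27 : reg s3 27 = smem s (reg s 22 + 1) by [].
have E28 : reg s3 28 = smem s (reg s 22 + 2) by [].
have E x : x < 26 -> reg s3 x = reg s x.
  by move=> hx; rewrite /s3; regs; rewrite !ltn_eqF //; lia.
have m3 : smem s3 = smem s by [].
have E22 : reg s3 22 = reg s 22 by rewrite E.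
have E23 : reg s3 23 = d by rewrite E.
have E24 : reg s3 24 = a by rewrite E.
have E25 : reg s3 25 = b by rewrite E.
have E21 : reg s3 21 = f by rewrite E.
move: s3 E26 E27 E28 E m3 E22 E23 E24 E25 E21 => s3 E26 E27 E28 E m3 E22 E23 E24 E25 E21.
have lowE x : x < 21 -> reg s3 x = reg s x by move=> hx; apply: E; apply: ltn_trans hx _.
apply: ok_bdd => b3.
have bW : b <= W by rewrite -E25; case: b3.
have aW : a <= W by rewrite -E24; case: b3.
have e27W : reg s3 27 <= W by case: b3.
have e28W : reg s3 28 <= W by case: b3.
have sEq x c : x < nvars -> c <= W -> esafe W s3 (Eeq ($x) (#!c)).
  by move=> *; apply: (esafe_Eeq b3).
have sEq2 x y : x < nvars -> y < nvars -> esafe W s3 (Eeq ($x) ($y)).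
  by move=> *; apply: (esafe_Eeq b3).
have op1 : ev s3 (Eeq ($26) (#!1)) = (nth 0 (tcode t) 0 == 1) by rewrite ev_Eeq /= E26.
have op4 : ev s3 (Eeq ($26) (#!4)) = (nth 0 (tcode t) 0 == 4) by rewrite ev_Eeq /= E26.
have neqs x : x < 21 -> [/\ (x == 21) = false, (x == 22) = false, (x == 23) = false, (x == 24) = false & (x == 25) = false].
  by move=> hx; split; rewrite ltn_eqF //; lia.
apply: ok_if; first by apply: sEq.
  rewrite op1; case: t sg hW c0 scE cn HQ op1 op4 E26 => [i|i j|i j|] // sg hW c0 scE cn HQ op1 op4 E26 _.
  apply: ok_seq; apply: (@ok_asg' _ _ _ _ d.+1) => //.
  - by split=> //=; rewrite E23 addn1.
  - by rewrite /= E23 addn1.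
  apply: ok_asg.
  - by [].
  - by split=> //; regs; rewrite E22; lia.
  apply: (HQ _ _ d.+1 a b f) => //; regs.
  - by move=> x /[dup] hx /neqs[_ -> -> _ _]; exact: lowE.
  - by rewrite E22.
rewrite op1 => nop1; apply: ok_if; first by apply: sEq.
  rewrite op4; case: t sg hW c0 scE cn HQ op1 op4 nop1 E26 => [i|i j|i j|] // sg hW c0 scE cn HQ op1 op4 nop1 E26 _.
  apply: ok_seq; apply: (@ok_asg' _ _ _ _ d.-1) => //.
  - by rewrite /= E23 subn1.
  apply: ok_asg.
  - by [].
  - by split=> //; regs; rewrite E22; lia.
  apply: (HQ _ _ d.-1 a b f) => //; regs.
  - by move=> x /[dup] hx /neqs[_ -> -> _ _]; exact: lowE.
  - by rewrite E22.
  - by apply: leq_trans (leq_pred _) _.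
rewrite op4 => nop4.
have st3 : size (tcode t) = 3 by case: (t) nop1 nop4.
rewrite cn ?st3 // in E27; rewrite cn ?st3 // in E28.
apply: ok_seq; apply: (@ok_asg' _ _ _ _ (reg s 22 + 3)) => //.
- by split=> //=; rewrite E22; lia.
- by rewrite /= E22.
apply: ok_if; first by [].
  regs; rewrite E23 => d0; apply: ok_skip; apply: (HQ _ _ d a b f) => //; regs.
  - by move=> x /[dup] hx /neqs[_ -> _ _ _]; exact: lowE.
  - by rewrite st3.
  by move: d0 st3; case: (t) => [i|i j|i j|] //= /negPf->.
regs; rewrite E23 => d0.
set s4 := set_reg s3 22 _.
have b4 : bdd W s4 by apply: bdd_set_reg => //; lia.
have op2 : ev s4 (Eeq ($26) (#!2)) = (nth 0 (tcode t) 0 == 2) by rewrite ev_Eeq; regs; rewrite E26.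
apply: ok_if; first by apply: (esafe_Eeq b4).
  rewrite op2; case: t sg hW c0 scE cn HQ op1 op4 nop1 nop4 E26 E27 E28 op2 st3 => [i|i j|i j|] // sg hW c0 scE cn HQ op1 op4 nop1 nop4 E26 E27 E28 op2 st3 _.
  rewrite /= in E27 E28.
  pose a' := if a == i then j else a; pose b' := if b == i then j else b.
  apply: ok_seq.
  pose s5 := set_reg s4 24 a'.
  have first : ok W (IfE (Eeq ($24) ($27)) (Asg 24 ($28)) Skip) s4
     (fun T s' => T <= 30 /\ s' = s5).
    apply: ok_if; first by apply: (esafe_Eeq b4).
      rewrite ev_Eeq; regs; rewrite E24 E27 => ai; apply: ok_asg => //; split=> //; regs.
      by rewrite /s5 /a' E28; move: ai; case: (a == i).
    rewrite ev_Eeq; regs; rewrite E24 E27 => ai; apply: ok_skip; split=> //.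
    rewrite /s5 /a'; move: ai; case: (a == i) => // _.
    congr State; apply: functional_extensionality => x; regs.
    by case: (x =P 24) => [->|].
  apply: ok_conseq first _ => T1 s' _ [hT1 ->] {s'}.
  have b5 : bdd W s5.
    by apply: bdd_set_reg => //; rewrite /a'; case: ifP => // _; rewrite -E28.
  pose s6 := set_reg s5 25 b'.
  have second : ok W (IfE (Eeq ($25) ($27)) (Asg 25 ($28)) Skip) s5
     (fun T s' => T <= 30 /\ s' = s6).
    apply: ok_if; first by apply: (esafe_Eeq b5).
      rewrite ev_Eeq; regs; rewrite E25 E27 => bi; apply: ok_asg => //; split=> //; regs.
      by rewrite /s6 /b' E28; move: bi; case: (b == i).
    rewrite ev_Eeq; regs; rewrite E25 E27 => bi; apply: ok_skip; split=> //.
    rewrite /s6 /b'; move: bi; case: (b == i) => // _.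
    congr State; apply: functional_extensionality => x; regs.
    by case: (x =P 25) => [->|].
  apply: ok_conseq second _ => T2 s' _ [hT2 ->] {s'}.
  apply: (HQ _ _ d a' b' f) => //.
  - by rewrite /=; lia.
  - by move=> x /[dup] hx /neqs[_ e22 _ e24 e25]; regs; rewrite e22 e24 e25; exact: lowE.
  - by rewrite /= d0 /a' /b'.
rewrite op2; case: t sg hW c0 scE cn HQ op1 op4 nop1 nop4 E26 E27 E28 op2 st3 => [i|i j|i j|] // sg hW c0 scE cn HQ op1 op4 nop1 nop4 E26 E27 E28 op2 st3 _.
rewrite /= in E27 E28.
pose fd := ((a == i) && (b == j)) || ((a == j) && (b == i)).
have evf : ev s4 (#!1 -! (#!1 -! $21) *! (#!1 -! foundE)) = f || fd.
  have -> : ev s4 (#!1 -! (#!1 -! $21) *! (#!1 -! foundE)) =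
     1 - (1 - reg s4 21) * (1 - (ev s4 (Eeq ($24) ($27)) * ev s4 (Eeq ($25) ($28)) +
        ev s4 (Eeq ($24) ($28)) * ev s4 (Eeq ($25) ($27)))) by [].
  rewrite !ev_Eeq; regs; rewrite E21 E24 E25 E27 E28 /fd.
  by case: (f); case: (a == i); case: (b == j); case: (a == j); case: (b == i).
apply: (@ok_asg' _ _ _ _ (f || fd)) => //.
  have sE x y : x < nvars -> y < nvars -> esafe W s4 (Eeq ($x) ($y)).
    by move=> *; apply: (esafe_Eeq b4).
  have sm x y x' y' : x < nvars -> y < nvars -> x' < nvars -> y' < nvars ->
      esafe W s4 (Eeq ($x) ($y) *! Eeq ($x') ($y')).
    by move=> *; apply: (esafe_mulb b4); rewrite ?ev_Eeq ?leq_b1 //; apply: sE.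
  have sf : esafe W s4 foundE.
    split; [exact: sm|exact: sm|].
    change (ev s4 (Eeq ($24) ($27)) * ev s4 (Eeq ($25) ($28)) +
        ev s4 (Eeq ($24) ($28)) * ev s4 (Eeq ($25) ($27)) <= W); rewrite !ev_Eeq.
    by do 4 case: (_ == _).
  split=> //; split; [by split | by split |].
  change ((1 - reg s4 21) * (1 - ev s4 foundE) <= W).
  by apply: (@leq_trans (1 * 1)) => //; apply: leq_mul; exact: leq_subr.
apply: (HQ _ _ d a b (f || fd)) => //.
- by move=> x /[dup] hx /neqs[e21 e22 _ _ _]; regs; rewrite e21 e22; exact: lowE.
- by rewrite /= d0 eqxx -orbA.
Qed.

Lemma ok_scan_loop l d a b (f : bool) s Q :
  reg s 21 = f -> reg s 23 = d -> reg s 24 = a -> reg s 25 = b ->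
  seg (smem s) (reg s 22) (code l) -> reg s 22 + size (code l) + 3 <= W ->
  d + size l <= W ->
  (forall T s', T <= 190 * (size l).+1 ->
     reg s' 21 = (f || scan l d a b) ->
     (forall x, x < 21 -> reg s' x = reg s x) -> smem s' = smem s -> Q T s') ->
  ok W scan_loop s Q.
Proof.
elim: l d a b f s Q => [|t l IH] d a b f s Q r21 r23 r24 r25 sg hW dW HQ.
  apply: ok_while0 => //=.
    by rewrite -[reg s 22]addn0 sg.
  by apply: HQ => //; rewrite orbF.
have c0 : smem s (reg s 22) = nth 0 (tcode t) 0.
  by rewrite -[reg s 22]addn0 sg //; case: (t).
apply: ok_while1 => //=; first by rewrite c0; case: (t).
apply: (ok_scan_body r21 r23 r24 r25 sg hW).
  by move: dW => /=; lia.
move=> T1 s1 d1 a1 b1 f1 hT1 q21 q23 q24 q25 low m1 q22 hd sc.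
have scE : size (code (t :: l)) = size (tcode t) + size (code l) by rewrite /code /= size_cat.
apply: (IH _ _ _ _ _ _ q21 q23 q24 q25).
- by rewrite m1 q22; apply: seg_cat; rewrite /code /= in sg.
- by rewrite q22; lia.
- by move: dW => /=; lia.
move=> T2 s2 hT2 w21 low2 m2; apply: HQ.
- by rewrite /=; lia.
- by rewrite w21 sc.
- by move=> x hx; rewrite low2 ?low.
- by rewrite m2.
Qed.

Lemma ok_scan l s Q :
  seg (smem s) (reg s 13) (code l) -> reg s 13 + size (code l) + 3 <= W ->
  (forall T s', T <= 190 * (size l).+1 + 40 ->
     reg s' 21 = later l (reg s 15) (reg s 16) ->
     (forall x, x < 21 -> reg s' x = reg s x) -> smem s' = smem s -> Q T s') ->
  ok W cmd_scan s Q.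
Proof.
move=> sg hW HQ.
do 5 (apply: ok_seq; apply: ok_asg => //).
apply: (@ok_scan_loop l 0 (reg s 15) (reg s 16) false) => //.
- by have := size_code l; lia.
move=> T s' hT r21 low ms; apply: HQ => //.
- by rewrite /=; lia.
- move=> x hx; rewrite low //; regs; rewrite !ltn_eqF //; lia.
Qed.

End Scan.

(** * The main loop *)

Definition activeE : expr :=
  Ele ($15) ($1) *! (Ele ($16) ($1) *! (#!1 -! Eeq ($15) ($16))).

Definition step_pair : cmd :=
  IfE activeE
    (IfE (Eeq ($14) (#!2)) (cmd_unary relabelE)
       (cmd_scan ;! IfE ($21) Skip (cmd_unary joinE)))
    Skip.

Definition main_body : cmd :=
  Asg 14 (EL ($13)) ;! Asg 15 (EL ($13 +! #!1)) ;! Asg 16 (EL ($13 +! #!2)) ;!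
  IfE (Eeq ($14) (#!1)) cmd_intro
    (IfE (Eeq ($14) (#!4)) cmd_union (Asg 13 ($13 +! #!3) ;! step_pair)).

Definition main_loop : cmd := WhileE (EL ($13)) main_body.

(** Bounds the cost of any token in units of [Z * D]. It is made opaque below, as its value involves
    the full unrolled expressions. *)
Definition KS : nat := KI + ecost relabelE + ecost joinE + 2000.

Lemma KS_bounds : [/\ KI + 100 <= KS, ecost relabelE + 800 <= KS & ecost joinE + 1800 <= KS].
Proof. by rewrite /KS; split; lia. Qed.

Lemma KS_ge500 : 500 <= KS.
Proof. by have [_ _ H] := KS_bounds; lia. Qed.

Global Opaque KI KS.

Section Main.
Variables (W k N D Tb Lw : nat) (R0 : nat -> nat).
Let pw := 6 ^ k.+1.
Let Z := pw * D.
Hypothesis N_gt0 : 0 < N.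
Hypothesis D_big : 2 * hexp N + 12 * N + 10 <= 2 * D.
Hypothesis D_deg : 6 * N * N * Lw <= D.
Hypothesis W_big : Tb + (Lw + 25) * Z <= W.
Hypothesis W_join : join_size + 20 <= W.

(** Code and end marker lie below the slots and so are never overwritten. A token has at least one
    word and adds at most one slot, hence stack height plus remaining code length never grows and
    [Lw] slots suffice. *)
Definition Inv (s : state) (l : seq tok) (st : seq table) : Prop :=
  [/\ [/\ consts k N D Tb s, forall x, x < 12 -> reg s x = R0 x,
      reg s 12 = Tb + size st * Z & tabs k D Tb st (smem s)],
      seg (smem s) (reg s 13) (code l), reg s 13 + size (code l) < Tb &
      size st + size (code l) <= Lw].

Lemma code_cons t l : code (t :: l) = tcode t ++ code l.
Proof. by []. Qed.

Lemma Inv_next s s' t l st st' : Inv s (t :: l) st ->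
  (forall x, x < 12 -> reg s' x = reg s x) ->
  (forall x, x < Tb -> smem s' x = smem s x) ->
  reg s' 12 = Tb + size st' * Z -> reg s' 13 = reg s 13 + size (tcode t) ->
  tabs k D Tb st' (smem s') -> size st' <= size st + size (tcode t) -> Inv s' l st'.
Proof.
case=> -[[c1 c5 c6 c8 [c9 c10 c11]] hR r12 tb] sg hT hL low ms r12' r13' tb' hst.
have sz : size (code (t :: l)) = size (tcode t) + size (code l) by rewrite code_cons size_cat.
split.
- split=> //; last by move=> x hx; rewrite low ?hR.
  by split; rewrite ?low //; split; rewrite ?low.
- move=> x hx; rewrite r13' ms; last by lia.
  by have := seg_cat (l := tcode t) (l' := code l) sg; apply.
- by rewrite r13'; lia.
- lia.
Qed.

Lemma ok_fetch s t l st Q : Inv s (t :: l) st ->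
  (forall s', Inv s' (t :: l) st -> reg s' 14 = nth 0 (tcode t) 0 ->
     (1 < size (tcode t) -> reg s' 15 = nth 0 (tcode t) 1) ->
     (2 < size (tcode t) -> reg s' 16 = nth 0 (tcode t) 2) ->
     ok W (IfE (Eeq ($14) (#!1)) cmd_intro
        (IfE (Eeq ($14) (#!4)) cmd_union (Asg 13 ($13 +! #!3) ;! step_pair))) s'
        (fun T s'' => Q (19 + T) s'')) ->
  ok W main_body s Q.
Proof.
move=> I H; case: (I) => -[cs hR r12 tb] sg hT hL.
have W0 : 0 < W by lia. have W1 : 1 < W by lia.
have Tw : Tb + 25 <= W.
  apply: leq_trans W_big; rewrite leq_add2l; apply: leq_trans (_ : 25 * 1 <= _) => //.
  by apply: leq_mul; [exact: leq_addl | exact: (Z_gt0 N_gt0 D_big W_big W_join)].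
have sz : size (code (t :: l)) = size (tcode t) + size (code l) by rewrite code_cons size_cat.
have cn x : x < size (tcode t) -> smem s (reg s 13 + x) = nth 0 (tcode t) x.
  move=> hx; rewrite sg; last by lia.
  by rewrite code_cons nth_cat hx.
have c0 : smem s (reg s 13) = nth 0 (tcode t) 0.
  by rewrite -[reg s 13]addn0 cn //; case: (t).
apply: ok_seq; apply: ok_asg => //.
apply: ok_seq; apply: ok_asg => //.
  by split=> //; regs; lia.
apply: ok_seq; apply: ok_asg => //.
  by split=> //; regs; lia.
set s3 := set_reg _ 16 _.
have E x : x < 14 -> reg s3 x = reg s x.
  by move=> hx; rewrite /s3; regs; rewrite !ltn_eqF //; lia.
have I3 : Inv s3 (t :: l) st.
  case: cs => c1 c5 c6 c8 [c9 c10 c11].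
  split; [split| by rewrite E | by rewrite E | by []].
  - by split; rewrite ?E //; split; rewrite ?E.
  - by move=> x hx; rewrite E ?hR //; apply: leq_trans hx _.
  - by rewrite E.
  - exact: tb.
apply: ok_conseq (H s3 I3 _ _ _) _.
- by rewrite /s3; regs.
- by move=> hx; rewrite /s3; regs; rewrite cn.
- by move=> hx; rewrite /s3; regs; rewrite cn.
by move=> T s' _; congr Q; rewrite /=; lia.
Qed.

(** Allows the running time to be overestimated before it is handed to a continuation. *)
Definition antitone (Q : nat -> state -> Prop) : Prop :=
  forall T T' s, T <= T' -> Q T' s -> Q T s.

(** The machine runs one flat loop over the tokens, so the induction on expressions is stated in
    continuation style: whatever the loop achieves on [rest] with the table of [e] pushed, it
    achieves from here. *)
Lemma ok_expr e : forall rest st s Q, antitone Q -> labels_le k e -> Inv s (toks e ++ rest) st ->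
  (forall T s', T <= size (toks e) * (KS * (Z * D)) ->
     Inv s' rest (rcons st (dp N k (later rest) e)) ->
     ok W main_loop s' (fun T' s'' => Q (T + T') s'')) ->
  ok W main_loop s Q.
Proof.
have Wg : 10 < W by exact: (W_gt10 W_join).
have W0 : 0 < W by lia. have W1 : 1 < W by lia. have W2 : 2 < W by lia. have W3 : 3 < W by lia.
have Zg : 0 < Z by exact: (Z_gt0 N_gt0 D_big W_big W_join).
have Dg : 0 < D by exact: (D_gt0 N_gt0 D_big W_big W_join).
have DZ : D <= Z by exact: D_le_Z.
have ZZD : Z <= Z * D by rewrite leq_pmulr.
have Tw : Tb + 25 <= W.
  apply: leq_trans W_big; rewrite leq_add2l; apply: leq_trans (_ : 25 * 1 <= _) => //.
  by apply: leq_mul; [exact: leq_addl | exact: Zg].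
have loop0 s t l st Q : Inv s (t :: l) st ->
    ok W main_body s (fun T1 s1 => ok W main_loop s1 (fun T2 s2 => Q (3 + (T1 + T2).+1) s2)) ->
    ok W main_loop s Q.
  move=> [[cs hR r12 tb] sg hT hL] H; apply: ok_while1 => //.
  by rewrite /= -[reg s 13]addn0 sg // code_cons; case: (t).
have sEq s x c : bdd W s -> x < nvars -> c <= W -> esafe W s (Eeq ($x) (#!c)).
  by move=> b *; apply: (esafe_Eeq b).
have mono a b c : a <= b -> a * c <= b * c by move=> h; rewrite leq_mul2r h orbT.
have LD : Lw <= D.
  by apply: leq_trans D_deg; apply: leq_pmull; rewrite !muln_gt0 N_gt0.
have D_ZD : D <= Z * D by rewrite leq_pmull.
have ZD1 : 0 < Z * D by rewrite muln_gt0 Zg Dg.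
(* Relabellings and joins share their machine code up to the choice of the cell expression, and are
   handled together. *)
have pair t i j l st F F' s Q : antitone Q -> Inv s (t :: l) (rcons st F) ->
    (t = TR i j \/ t = TJ i j) ->
    (small D F) ->
    (F' = if active k i j then
            (if t is TR _ _ then (fun q => F (upd q i (q j)))
             else if later l i j then F else tjoin N F i j) else F) ->
    (forall T s', T <= KS * (Z * D) -> Inv s' l (rcons st F') ->
      ok W main_loop s' (fun T' s'' => Q (T + T') s'')) ->
    ok W main_loop s Q.
  move=> aQ I tE sF F'E HQ.
  have tc : tcode t = [:: if t is TR _ _ then 2 else 3; i; j] by case: tE => ->.
  apply: (loop0 _ _ _ _ _ I); apply: (ok_fetch I) => s1 I1 r14 r15 r16.
  rewrite tc in r14 r15 r16.
  have {r15} r15 : reg s1 15 = i by rewrite r15.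
  have {r16} r16 : reg s1 16 = j by rewrite r16.
  apply: ok_bdd => b1; apply: ok_if; first exact: sEq.
    by rewrite ev_Eeq /= r14; case: (t).
  move=> _; apply: ok_if; first exact: sEq.
    by rewrite ev_Eeq /= r14; case: (t).
  move=> _; case: (I1) => -[[c1 c5 c6 c8 [c9 c10 c11]] hR r12 tb] sg hT hL.
  have szc : size (code (t :: l)) = 3 + size (code l) by rewrite code_cons size_cat tc.
  rewrite szc in hT hL; rewrite size_rcons in r12 hL.
  apply: ok_seq; apply: ok_asg => //.
    by split=> //; rewrite /=; lia.
  set s2 := set_reg s1 13 _.
  have R2 x : x != 13 -> reg s2 x = reg s1 x by move=> /negPf hx; rewrite /s2; regs; rewrite hx.
  have p13 : reg s2 13 = reg s1 13 + 3 by rewrite /s2; regs.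
  have m2 : smem s2 = smem s1 by [].
  move: s2 R2 p13 m2 => s2 R2 p13 m2.
  have cs2 : consts k N D Tb s2.
    by split; rewrite ?R2 //; split; rewrite ?R2.
  have I2 s3 F3 : (forall x, x < 14 -> reg s3 x = reg s2 x) ->
     (forall x, x < Tb -> smem s3 x = smem s2 x) ->
     tabs k D Tb (rcons st F3) (smem s3) -> Inv s3 l (rcons st F3).
    move=> low ms tb3; apply: (Inv_next I1) => //.
    - by move=> x hx; rewrite low ?R2 ?neq_ltn //; [rewrite (leq_trans hx) | apply: leq_trans hx _].
    - by move=> x hx; rewrite ms // m2.
    - by rewrite low // R2 // r12 size_rcons.
    - by rewrite low // p13 tc.
    - by rewrite !size_rcons leq_addr.
  have TK : 100 + 400 * (Z * D) <= KS * (Z * D).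
    have hk : 500 * (Z * D) <= KS * (Z * D) by apply: mono; exact: KS_ge500.
    by lia.
  apply: ok_bdd => b2.
  have sA : esafe W s2 (Ele ($16) ($1) *! (#!1 -! Eeq ($15) ($16))).
    apply: (esafe_mulb b2); [exact: (esafe_Ele W0)| |by rewrite ev_Ele leq_b1].
    by split=> //; apply: (esafe_Eeq b2).
  have eA : ev s2 activeE = active k i j.
    have e3 : ev s2 (#!1 -! Eeq ($15) ($16)) = 1 - (reg s2 15 == reg s2 16).
      by rewrite -(ev_Eeq s2 ($15) ($16)).
    rewrite /activeE !ev_mul e3 !ev_Ele /active.
    rewrite /= !R2 // r15 r16 c1.
    by case: (i <= k); case: (j <= k); case: (i == j).
  apply: ok_if.
  - by apply: (esafe_mulb b2); [exact: (esafe_Ele W0)|exact: sA|rewrite ev_Ele leq_b1].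
  - rewrite eA => ac; have {ac} act : active k i j by case: (active k i j) ac.
    rewrite act in F'E; have /and3P[ik jk ij] := act.
    have r12' : reg s2 12 = Tb + (size st).+1 * Z by rewrite R2.
    have tb2 : tabs k D Tb (rcons st F) (smem s2) by rewrite m2.
    have q15 : reg s2 15 = i by rewrite R2.
    have q16 : reg s2 16 = j by rewrite R2.
    apply: ok_if; first exact: sEq.
      rewrite ev_Eeq /= R2 // r14 => t2.
      have {tE} tE : t = TR i j by case: tE => // tE; move: t2; rewrite tE.
      rewrite tE in F'E.
      apply: (@ok_relabel W k N D Tb Lw N_gt0 D_big W_big W_join st F) => //.
      + by rewrite q15.
      + by rewrite q16.
      + lia.
      move=> T s3 hT3 low ms tb3; rewrite q15 q16 -F'E in tb3.
      have hI := I2 s3 F' low ms tb3.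
      apply: ok_conseq (HQ (T + 200) s3 _ hI) _.
        have [_ K2 _] := KS_bounds; have hk := mono _ _ (Z * D) K2.
        have hz : (ecost relabelE + 600) * Z <= (ecost relabelE + 600) * (Z * D) by rewrite leq_mul2l ZZD orbT.
        by rewrite mulnDl in hk; rewrite mulnDl in hz; rewrite mulnDl in hT3; lia.
      by move=> T' s' _; apply: aQ; rewrite /=; lia.
    rewrite ev_Eeq /= R2 // r14 => t2.
    have {tE} tE : t = TJ i j by case: tE => // tE; move: t2; rewrite tE.
    rewrite tE in F'E.
    have sg2 : seg (smem s2) (reg s2 13) (code l).
      move=> x hx; rewrite m2 p13; have := seg_cat (l := tcode t) (l' := code l) sg.
      by rewrite tc; apply.
    have lL : size l <= Lw by apply: leq_trans (size_code l) _; lia.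
    apply: ok_seq; apply: (@ok_scan W Wg l) => //.
      by rewrite p13; lia.
    rewrite q15 q16 => T1 s3 hT1 r21 low1 ms1.
    have cs3 : consts k N D Tb s3.
      by case: cs2 => ? ? ? ? [? ? ?]; split; rewrite ?low1 //; split; rewrite ?low1.
    have hT1' : T1 <= 190 * (Z * D) + 230.
      by apply: leq_trans hT1 _; rewrite mulnS; lia.
    apply: ok_bdd => b3; apply: ok_if => //.
      rewrite /= r21 => fd; apply: ok_skip.
      have fd' : later l i j by move: fd; case: (later l i j).
      rewrite fd' in F'E.
      have hI : Inv s3 l (rcons st F').
        apply: I2 => [x hx|x hx|]; [by rewrite low1 //; apply: leq_trans hx _ | by rewrite ms1|].
        by rewrite ms1 F'E.
      apply: ok_conseq (HQ (T1 + 200) s3 _ hI) _; first by lia.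
      by move=> T' s' _; apply: aQ; rewrite /=; lia.
    rewrite /= r21 => fd.
    have fd' : later l i j = false by move: fd; case: (later l i j).
    rewrite fd' in F'E.
    apply: (@ok_join W k N D Tb Lw N_gt0 D_big W_big W_join st F) => //.
    - by rewrite low1.
    - by rewrite !low1 // q15 q16.
    - by rewrite ms1.
    - lia.
    rewrite !low1 // q15 q16 -F'E => T2 s4 hT2 low2 ms2 tb4.
    have hI : Inv s4 l (rcons st F').
      apply: I2 => [x hx|x hx|] //; first by rewrite low2 ?low1 //; apply: leq_trans hx _.
      by rewrite ms2 // ms1.
    apply: ok_conseq (HQ (T1 + T2 + 200) s4 _ hI) _.
      have [_ _ K3] := KS_bounds; have hk := mono _ _ (Z * D) K3.
      have hz : (ecost joinE + 600) * Z <= (ecost joinE + 600) * (Z * D) by rewrite leq_mul2l ZZD orbT.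
      by rewrite mulnDl in hk; rewrite mulnDl in hz; rewrite mulnDl in hT2; lia.
    by move=> T' s' _; apply: aQ; rewrite /=; lia.
  rewrite eA => ac; have {ac} act : active k i j = false by case: (active k i j) ac.
  rewrite act in F'E; apply: ok_skip.
  have hI : Inv s2 l (rcons st F') by apply: I2 => //; rewrite m2 F'E.
  apply: ok_conseq (HQ 200 s2 _ hI) _; first by lia.
  by move=> T' s' _; apply: aQ; rewrite /=; lia.
have small_dp e' P : size (encode_expr e') <= Lw -> small D (dp N k P e').
  move=> he q; apply: leq_trans (size_dp N_gt0 _ _ _ _) _; apply: leq_trans D_deg.
  by rewrite leq_mul2l he orbT.
elim: e => [i|i j e1 IH|i j ij e1 IH|e1 IH1 e2 IH2] rest st s Q aQ He.
- move=> I HQ; apply: (loop0 _ _ _ _ _ I); apply: (ok_fetch I) => s1 I1 r14 r15 _.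
  apply: ok_bdd => b1; apply: ok_if; first exact: sEq.
    move=> _; case: (I1) => -[cs hR r12 tb] sg hT hL.
    have ik : i <= k by case: He => /(_ tt).
    apply: (@ok_intro W k N D Tb Lw N_gt0 D_big W_big W_join st) => //.
    + by rewrite r15.
    + by apply: leq_trans hL; exact: leq_addr.
    + by move: hT; rewrite /code /=; lia.
    move=> T s2 hT2 low ms q12 q13 tb2.
    apply: ok_conseq (HQ (T + 100) s2 _ _) _.
    + have [K1 _ _] := KS_bounds; have hk := mono _ _ (Z * D) K1.
      have hz : KI * Z <= KI * (Z * D) by rewrite leq_mul2l ZZD orbT.
      by rewrite mulnDl in hk; rewrite mul1n; lia.
    + apply: (Inv_next I1) => //; first by rewrite size_rcons.
        by rewrite r15 in tb2.
      by rewrite size_rcons /=; lia.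
    by move=> T' s' _; apply: aQ; rewrite /=; lia.
  by rewrite ev_Eeq /= r14.
- rewrite /= cat_rcons => I HQ; have He1 : labels_le k e1 by case: He.
  apply: (IH _ _ _ _ _ He1 I) => // T s' hT I'.
  rewrite later_TR in I'.
  apply: (@pair _ i j rest st _ _ s' _ _ I' _ _ erefl).
  + by move=> T1 T2 s1 h; apply: aQ; rewrite leq_add2l.
  + by left.
  + apply: small_dp; case: I => _ _ _; rewrite -code_toks code_cat size_cat; lia.
  move=> T2 s2 hT2 I2; apply: ok_conseq (HQ (T + T2) s2 _ _) _.
  + by rewrite size_rcons mulSn addnC leq_add.
  + by move: I2; congr Inv; congr rcons; apply: functional_extensionality => q; case: (active k i j).
  by move=> T' s3 _; rewrite addnA.
- rewrite /= cat_rcons => I HQ; have He1 : labels_le k e1 by case: He.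
  apply: (IH _ _ _ _ _ He1 I) => // T s' hT I'.
  rewrite later_TJ in I'.
  apply: (@pair _ i j rest st _ _ s' _ _ I' _ _ erefl).
  + by move=> T1 T2 s1 h; apply: aQ; rewrite leq_add2l.
  + by right.
  + apply: small_dp; case: I => _ _ _; rewrite -code_toks code_cat size_cat; lia.
  move=> T2 s2 hT2 I2; apply: ok_conseq (HQ (T + T2) s2 _ _) _.
  + by rewrite size_rcons mulSn addnC leq_add.
  + by move: I2; congr Inv; congr rcons; case: (active k i j) => //=; case: (later rest i j).
  by move=> T' s3 _; rewrite addnA.
rewrite /= -catA cat_rcons => I HQ; have [He1 He2] : labels_le k e1 /\ labels_le k e2 by case: He => _ [].
apply: (IH1 _ _ _ _ _ He1 I) => // T1 s1 hT1 I1; rewrite later_toks in I1.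
apply: (IH2 _ _ _ _ _ He2 I1).
  by move=> T T' s' h; apply: aQ; rewrite leq_add2l.
move=> T2 s2 hT2 I2.
have lU : later (TU :: rest) = later rest by [].
rewrite lU in I2.
apply: (loop0 _ _ _ _ _ I2); apply: (ok_fetch I2) => s3 I3 r14 _ _.
apply: ok_bdd => b3; apply: ok_if; first exact: sEq.
  by rewrite ev_Eeq /= r14.
move=> _; apply: ok_if; first exact: sEq; last by rewrite ev_Eeq /= r14.
move=> _; case: (I3) => -[cs hR r12 tb] sg hT hL.
have szU : size (code (TU :: rest)) = (size (code rest)).+1 by [].
rewrite !size_rcons szU in r12 hL; rewrite szU in hT.
apply: (@ok_union W k N D Tb Lw N_gt0 D_big W_big W_join st) tb _ _ _ => //.
- by lia.
- by lia.
move=> T s4 hT4 low ms q12 q13 tb4.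
apply: ok_conseq (HQ (T1 + T2 + (T + 100)) s4 _ _) _.
- have h5 : T + 100 <= KS * (Z * D).
    have hk : 500 * (Z * D) <= KS * (Z * D) by apply: mono; exact: KS_ge500.
    apply: leq_trans hk; apply: leq_trans (_ : 300 * (Z * D) + 200 * (Z * D) <= _); last by rewrite -mulnDl.
    by apply: leq_add => //; apply: leq_trans (_ : 200 * 1 <= _) => //; rewrite leq_mul2l.
  rewrite size_cat size_rcons; move: hT1 hT2 h5; clear; move: (KS * _) => v *.
  by rewrite mulnDl mulSn; lia.
- apply: (Inv_next I3) => //; first by rewrite size_rcons.
  by rewrite !size_rcons /=; lia.
by move=> T' s' _; apply: aQ; rewrite /=; lia.
Qed.

End Main.

(** * From the stored expression to the answer *)

Definition len_body : cmd :=
  IfE (Eeq (EL ($4 +! $7)) (#!1)) (Asg 7 ($7 +! #!2))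
    (IfE (Eeq (EL ($4 +! $7)) (#!4)) (Asg 7 ($7 +! #!1)) (Asg 7 ($7 +! #!3))).

Definition len_loop : cmd := WhileE (EL ($4 +! $7)) len_body.

Definition init_consts : cmd :=
  Asg 5 (#!2 *! ($3 +! #!1)) ;! Asg 6 ($5 *! ($3 +! #!1)) ;! Asg 7 (#!0) ;! len_loop ;!
  Asg 8 (#!3 *! $6 *! $7) ;! Pow 17 1 ;! Asg 9 ($17 *! #!6) ;! Asg 10 ($9 *! $8) ;!
  Asg 11 ($4 +! $7 +! #!1) ;! Asg 12 ($11) ;! Asg 13 ($4).

Definition cmd_count : cmd :=
  init_consts ;! main_loop ;!
  Asg 0 (EL ($11 +! (($9 -! #!1) *! $8 +! ($3 *! $5 +! $2)))).

(** The length is found by stepping over whole tokens: an operand can itself be 0, so the first zero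
    word need not be the end. *)
Lemma ok_len W l s Q : 10 < W -> seg (smem s) (reg s 4 + reg s 7) (code l) ->
  reg s 4 + reg s 7 + size (code l) + 4 <= W ->
  (forall T s', T <= 60 * (size l).+1 -> (forall x, x != 7 -> reg s' x = reg s x) ->
     smem s' = smem s -> reg s' 7 = reg s 7 + size (code l) -> Q T s') ->
  ok W len_loop s Q.
Proof.
move=> Wg; elim: l s Q => [|t l IH] s Q sg hW HQ.
  apply: ok_while0 => //.
  - by split=> //; rewrite /=; lia.
  - by rewrite /= -[reg s 4 + _]addn0 sg.
  by apply: HQ => //; rewrite addn0.
have c0 : smem s (reg s 4 + reg s 7) = nth 0 (tcode t) 0.
  by rewrite -[reg s 4 + _]addn0 sg //; case: (t).
have szc : size (code (t :: l)) = size (tcode t) + size (code l) by rewrite code_cons size_cat.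
have sA : esafe W s (EL ($4 +! $7)) by split=> //=; lia.
have W1 : 1 < W by lia. have W4 : 4 <= W by lia.
apply: ok_while1 => //; first by rewrite /= c0; case: (t).
apply: ok_bdd => bs.
have W0 : 0 < W by lia.
have step (d : nat) T0 : 0 < d <= 3 -> d = size (tcode t) -> T0 <= 40 ->
  ok W (Asg 7 ($7 +! #!d)) s (fun T1 s1 => ok W len_loop s1 (fun T2 s2 =>
    Q (ecost (EL ($4 +! $7)) + (T0 + T1 + T2).+1) s2)).
  move=> /andP[d0 d3] dE hT0; apply: ok_asg => //.
    by split=> //=; lia.
  set s1 := set_reg _ _ _.
  have r4 : reg s1 4 = reg s 4 by [].
  have r7 : reg s1 7 = reg s 7 + d by [].
  apply: IH.
  - by rewrite r4 r7 addnA dE; apply: seg_cat; rewrite -code_cons.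
  - by rewrite r4 r7; lia.
  move=> T s' hT low ms q7; apply: HQ.
  - by rewrite /=; lia.
  - by move=> x hx; rewrite low // /s1; regs; rewrite (negPf hx).
  - by rewrite ms.
  - by rewrite q7 r7 szc dE addnA.
apply: ok_if.
- exact: (esafe_Eeq bs W0 sA).
- rewrite ev_Eeq /= c0 => h; apply: ok_conseq (step 2 20 isT _ isT) _; first by case: (t) h.
  by move=> T1 s1 _ H1; apply: ok_conseq H1 _ => T2 s2 _ /=; congr Q; lia.
rewrite ev_Eeq /= c0 => h1; apply: ok_if.
- exact: (esafe_Eeq bs W0 sA).
- rewrite ev_Eeq /= c0 => h; apply: ok_conseq (step 1 40 isT _ isT) _; first by case: (t) h.
  by move=> T1 s1 _ H1; apply: ok_conseq H1 _ => T2 s2 _ /=; congr Q; lia.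
rewrite ev_Eeq /= c0 => h; apply: ok_conseq (step 3 40 isT _ isT) _; first by case: (t) h1 h.
by move=> T1 s1 _ H1; apply: ok_conseq H1 _ => T2 s2 _ /=; congr Q; lia.
Qed.

Lemma size_encode_expr_gt1 e : 1 < size (encode_expr e).
Proof.
by elim: e => [i|i j e1 IH|i j ij e1 IH|e1 IH1 e2 IH2] //=; rewrite !size_cat /=; lia.
Qed.

Lemma card_eval_gt0 e : 0 < #|eval e|.
Proof.
by elim: e => [i|i j e1 IH|i j ij e1 IH|e1 IH1 e2 IH2] //=; rewrite ?card_unit // card_sum addn_gt0 IH1.
Qed.

Lemma dig_top k l : l <= k -> dig (6 ^ k.+1 - 1) l = 5.
Proof.
move=> lk; rewrite /dig.
have -> : 6 ^ k.+1 - 1 = (6 ^ (k - l).+1 - 1) * 6 ^ l + (6 ^ l - 1).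
  have -> : k.+1 = (k - l).+1 + l by lia.
  rewrite expnD; have := exp6_gt0 l; have := exp6_gt0 (k - l).+1.
  move: (6 ^ l) (6 ^ _) => a b *; rewrite mulnBl mul1n.
  have : a <= b * a by rewrite leq_pmull.
  lia.
have gl := exp6_gt0 l.
rewrite divnMDl // divn_small ?addn0; last by rewrite subn1 prednK.
have ge := exp6_gt0 (k - l).
rewrite expnS; move: (6 ^ (k - l)) ge => x gx.
have -> : 6 * x - 1 = x.-1 * 6 + 5 by lia.
by rewrite modnMDl.
Qed.

Section CmdCount.
Variables (W k n t P : nat) (e : cexpr).
Let N := n.+1.
Let L := size (encode_expr e).
Let D := 3 * hexp N * L.
Let Z := 6 ^ k.+1 * D.
Let Tb := P + L + 1.
Hypothesis He : labels_le k e.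
Hypothesis card_e : #|eval e| = n.
Hypothesis tn : t <= n.
Hypothesis W_big : Tb + (L + 25) * Z <= W.
Hypothesis W_join : join_size + 20 <= W.

Lemma D_bounds : [/\ 2 * hexp N + 12 * N + 10 <= 2 * D, 6 * N * N * L <= D & 2 * N * n + t < D].
Proof.
have L2 : 1 < L := size_encode_expr_gt1 e.
have n1 : 0 < n by rewrite -card_e card_eval_gt0.
have nn : n <= n * n by rewrite leq_pmulr.
have h12 : 12 * N * N <= D.
  have -> : D = 6 * N * N * L by rewrite /D /hexp; ring.
  by have -> : 12 * N * N = 6 * N * N * 2 by [ring]; rewrite leq_mul2l L2 orbT.
split.
- by apply: (@leq_trans (2 * (12 * N * N))); rewrite /hexp /N; [nia|rewrite leq_mul2l h12].
- by rewrite /D /hexp; apply: eq_leq; ring.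
- by apply: leq_trans h12; rewrite /N; nia.
Qed.

Lemma ok_cmd_count s : reg s 1 = k -> reg s 2 = t -> reg s 3 = n -> reg s 4 = P ->
  seg (smem s) P (code (toks e)) ->
  ok W cmd_count s (fun T s' => T <= (L * KS + 2000) * (Z * D) /\
    reg s' 0 = num_fvs (eval e) t %% 2).
Proof.
move=> r1 r2 r3 r4 sg.
have [D_big D_deg pD] := D_bounds.
have N_gt0 : 0 < N by [].
have Zg : 0 < Z := Z_gt0 N_gt0 D_big W_big W_join.
have Dg : 0 < D := D_gt0 N_gt0 D_big W_big W_join.
have pwg : 0 < 6 ^ k.+1 by exact: exp6_gt0.
have DZ : D <= Z by rewrite leq_pmull.
have pZ : 6 ^ k.+1 <= Z by rewrite leq_pmulr.
have kp : k < 6 ^ k.+1 by apply: ltn_trans (ltnSn k) _; apply: ltn_expl.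
have Wg : 10 < W := W_gt10 W_join.
have LZ : L <= Z.
  by apply: leq_trans DZ; apply: leq_trans D_deg; apply: leq_pmull.
have ZW : 25 * Z <= W by apply: leq_trans W_big; rewrite mulnDl addnA leq_addl.
have TW : Tb + 25 * Z <= W by apply: leq_trans W_big; rewrite leq_add2l leq_mul2r leq_addl orbT.
have szL : size (code (toks e)) = L by rewrite code_toks.
have NW : hexp N <= D by lia.
have N2 : 2 * N <= hexp N by rewrite /hexp leq_pmulr.
have N1 : n + 1 = N by rewrite addn1.
have HH : 2 * N * N <= D by [].
have NZ : 2 * N * N <= W by lia.
apply: ok_seq; apply: ok_seq; apply: (@ok_asg' _ _ _ _ _ (2 * N)) => //.
- by do !split=> //=; rewrite ?r3 ?N1; lia.
- by rewrite /= r3 N1.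
apply: ok_seq; apply: (@ok_asg' _ _ _ _ _ (hexp N)) => //.
- by do !split=> //; regs; rewrite ?r3 ?N1 //; lia.
- by regs; rewrite r3 N1.
apply: ok_seq; apply: (@ok_asg' _ _ _ _ _ 0) => //.
set s1 := set_reg _ 7 0.
have E1 x : x < 5 -> reg s1 x = reg s x by move=> hx; rewrite /s1; regs; rewrite !ltn_eqF //; lia.
have [q5 q6 q7] : [/\ reg s1 5 = 2 * N, reg s1 6 = hexp N & reg s1 7 = 0] by [].
have m1 : smem s1 = smem s by [].
move: s1 E1 q5 q6 q7 m1 => s1 E1 q5 q6 q7 m1.
apply: ok_seq; apply: (@ok_len W (toks e)) => //.
- by rewrite m1 q7 E1 // r4 addn0.
- by rewrite q7 E1 // r4 addn0 szL; lia.
rewrite q7 add0n szL => T1 s2 hT1 low2 m2 w7.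
have E2 x : x < 5 -> reg s2 x = reg s x by move=> hx; rewrite low2 ?E1 // ltn_eqF //; lia.
have w5 : reg s2 5 = 2 * N by rewrite low2.
have w6 : reg s2 6 = hexp N by rewrite low2.
have m2' : smem s2 = smem s by rewrite m2.
move: s2 low2 m2 w7 E2 w5 w6 m2' => s2 _ _ w7 E2 w5 w6 m2.
apply: ok_seq; apply: (@ok_asg' _ _ _ _ _ D) => //.
- do !split=> //=; rewrite ?w6 ?w7 -/D; first by lia.
    by apply: leq_trans (_ : D <= _); [rewrite /D leq_pmulr //; have := size_encode_expr_gt1 e; lia|lia].
  by lia.
- by rewrite /= w6 w7.
set s3 := set_reg _ 8 D.
have E3 x : x < 8 -> reg s3 x = reg s2 x by move=> hx; rewrite /s3; regs; rewrite !ltn_eqF //; lia.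
have v8 : reg s3 8 = D by [].
have m3 : smem s3 = smem s by [].
move: s3 E3 v8 m3 => s3 E3 v8 m3.
have v1 : reg s3 1 = k by rewrite E3 // E2.
have pkW : 6 ^ k.+1 <= W by lia.
apply: ok_seq; apply: (ok_pow Wg) => //.
  by rewrite v1; apply: leq_trans pkW; rewrite leq_exp2l.
move=> T2 s4 hT2 u17 low4 m4; rewrite v1 in hT2 u17.
have E4 x : x < 17 -> reg s4 x = reg s3 x by move=> hx; rewrite low4 ?neq_ltn ?hx //; lia.
have u4 : reg s4 4 = P by rewrite E4 // E3 // E2.
have u7 : reg s4 7 = L by rewrite E4 // E3.
apply: ok_seq; apply: (@ok_asg' _ _ _ _ _ (6 ^ k.+1)) => //.
- by do !split=> //=; rewrite ?u17 -?expnSr; lia.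
- by rewrite /= u17 -expnSr.
apply: ok_seq; apply: (@ok_asg' _ _ _ _ _ Z) => //.
- by do !split=> //; regs; rewrite E4 // v8 -/Z; lia.
- by regs; rewrite E4 // v8.
apply: ok_seq; apply: (@ok_asg' _ _ _ _ _ Tb) => //.
- by do !split=> //; regs; rewrite ?u4 ?u7; lia.
- by regs; rewrite u4 u7.
apply: ok_seq; apply: (@ok_asg' _ _ _ _ _ Tb) => //.
apply: (@ok_asg' _ _ _ _ _ P) => //.
set s5 := set_reg _ 13 P.
have [z9 z10 z11 z12 z13] : [/\ reg s5 9 = 6 ^ k.+1, reg s5 10 = Z, reg s5 11 = Tb, reg s5 12 = Tb & reg s5 13 = P] by [].
have E5 x : x < 9 -> reg s5 x = reg s4 x by move=> hx; rewrite /s5; regs; rewrite !ltn_eqF //; lia.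
have m5 : smem s5 = smem s by rewrite -m3 -m4.
move: s5 z9 z10 z11 z12 z13 E5 m5 => s5 z9 z10 z11 z12 z13 E5 m5.
have E52 x : x < 8 -> reg s5 x = reg s2 x.
  by move=> hx; rewrite E5 ?E4 ?E3 //; lia.
have cs : consts k N D Tb s5.
  by split; [rewrite E52 ?E2|rewrite E52|rewrite E52|rewrite E5 ?E4|split].
have I5 : Inv k N D Tb L (reg s5) s5 (toks e ++ [::]) [::].
  split.
  - split=> //; by rewrite z12 addn0.
  - by rewrite cats0 m5 z13.
  - by rewrite cats0 z13 szL /Tb; lia.
  - by rewrite cats0 szL.
apply: ok_seq.
set final := Asg 0 _; set bound := (L * KS + 2000) * (Z * D).
(* The time already spent is built into the postcondition of the main loop, with 300 for the
   straight-line commands. *)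
pose Q T s' := ok W final s' (fun T3 s3 => T1 + T2 + 300 + T + T3 <= bound /\
  reg s3 0 = num_fvs (eval e) t %% 2).
have aQ : antitone Q.
  move=> T T' s' hT H; apply: ok_conseq H _ => T3 s6 _ [h ->]; split=> //.
  by apply: leq_trans h; rewrite leq_add2r leq_add2l.
have main : ok W main_loop s5 Q.
  apply: (ok_expr N_gt0 D_big D_deg W_big W_join aQ He I5) => T s6 hT.
  case=> -[[b1 b5 b6 b8 [b9 b10 b11]] hR b12 tb] sg6 _ _.
  have x3 : reg s6 3 = n by rewrite hR // E52 // E2.
  have x2 : reg s6 2 = t by rewrite hR // E52 // E2.
  apply: ok_while0 => //; first by rewrite /= -[reg s6 13]addn0 sg6.
  have addr : (6 ^ k.+1 - 1) * D + (n * (2 * N) + t) < Z.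
    apply: (@leq_trans ((6 ^ k.+1 - 1) * D + D)); first by rewrite ltn_add2l mulnC.
    by rewrite -mulSnr subn1 prednK.
  apply: ok_asg => //.
    by do !split=> //; rewrite /= ?b11 ?b9 ?b8 ?x3 ?b5 ?x2; move: addr ZW TW; move: (_ * D) (n * _) Z Tb; clear; lia.
  split; last first.
    regs; rewrite b11 b9 b8 x3 b5 x2.
    have := tb 0 _ _ addr; rewrite mul0n addn0 /= => -> //.
    have pE : n * (2 * N) + t = 2 * N * n + t by rewrite [n * _]mulnC.
    rewrite /cell divnMDl // modnMDl pE (divn_small pD) (modn_small pD) addn0.
    have := @dp_count k e t (dig (6 ^ k.+1 - 1)) He _ (@dig_top k).
    rewrite card_e => /(_ tn) dE; exact: esym (F2_mod (esym dE)).
  have tL : size (toks e) <= L by rewrite -szL size_code.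
  have hT' : T <= L * (KS * (Z * D)).
    by apply: leq_trans hT _; rewrite leq_mul2r tL orbT.
  have ZD : Z <= Z * D by rewrite leq_pmulr.
  have bE : bound = L * (KS * (Z * D)) + 2000 * (Z * D) by rewrite /bound mulnDl -(mulnA L).
  rewrite bE; move: (L * (KS * (Z * D))) hT' => x hT'.
  have : 60 * (size (toks e)).+1 <= 120 * (Z * D) by lia.
  have : 40 * k.+1 <= 40 * (Z * D) by lia.
  by move: (Z * D) hT1 hT2 (leq_trans Zg ZD) hT' => y; clear; rewrite /=; lia.
apply: ok_conseq main _ => T s6 _ H; apply: ok_conseq H _ => T3 s7 _ [h ->]; split=> //.
by apply: leq_trans h; rewrite /=; lia.
Qed.

End CmdCount.

(** * An expression with one label per vertex *)

Fixpoint chain (m : nat) : cexpr :=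
  if m is m'.+1 then Union (chain m') (Intro m) else Intro 0.

(** [Join] carries a proof of [i != j], which has to be produced from the computed test. *)
Definition joinx (i j : nat) (e : cexpr) : cexpr :=
  if sumbool_of_bool (i != j) is left h then Join h e else e.

Definition join_all (e : cexpr) (ps : seq (nat * nat)) : cexpr :=
  foldl (fun e p => joinx p.1 p.2 e) e ps.

Definition labeled_by (m : nat) (r : rel nat) (e : cexpr) : Prop :=
  [/\ injective (@label (eval e)), forall x : eval e, label x < m, #|eval e| = m &
      forall x y : eval e, adj x y = r (label x) (label y)].

Lemma labeled_chain m : labeled_by m.+1 (fun _ _ => false) (chain m).
Proof.
elim: m => [|m [inj lt card adjE]].
  by split=> [[] [] _||//=|] //; rewrite card_unit.
split=> /=.
- case=> [x|[]] [y|[]] //= h; first by congr inl; apply: inj.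
    by have := lt x; rewrite h ltnn.
  by have := lt y; rewrite -h ltnn.
- by case=> [x|[]] //=; apply: ltnW; rewrite ltnS.
- by rewrite card_sum card card_unit addn1.
by case=> [x|[]] [y|[]] /=.
Qed.

Lemma labels_le_chain m k : m <= k -> labels_le k (chain m).
Proof.
elim: m => [|m IH] mk /=; first by split.
split; last by split; [apply: IH; exact: ltnW | split].
case=> [x|[]] //=; have [_ lt _ _] := labeled_chain m.
by apply: leq_trans mk; apply: ltnW; apply: lt.
Qed.

Lemma toks_joinx i j e : i != j -> toks (joinx i j e) = rcons (toks e) (TJ i j).
Proof. by rewrite /joinx; case: sumbool_of_bool => [|->]. Qed.

Lemma toks_join_all e ps : all (fun p => p.1 != p.2) ps ->
  toks (join_all e ps) = toks e ++ [seq TJ p.1 p.2 | p <- ps].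
Proof.
elim: ps e => [|p ps IH] e /=; first by rewrite cats0.
by case/andP=> hp hps; rewrite IH // toks_joinx // cat_rcons.
Qed.

Lemma labeled_joinx m r e i j : i != j -> labeled_by m r e ->
  labeled_by m (fun a b => [|| r a b, (a == i) && (b == j) | (a == j) && (b == i)]) (joinx i j e).
Proof.
rewrite /joinx; case: sumbool_of_bool => [h|->] // _ [inj lt card adjE]; split=> //= x y.
by rewrite /join_adj adjE.
Qed.

Lemma labeled_join_all m r e ps : all (fun p => p.1 != p.2) ps -> labeled_by m r e ->
  labeled_by m (fun a b => [|| r a b, (a, b) \in ps | (b, a) \in ps]) (join_all e ps).
Proof.
elim: ps e r => [|[i j] ps IH] e r /=.
  by move=> _ [inj lt card adjE]; split=> // x y; rewrite adjE !in_nil !orbF.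
case/andP=> hp hps /(labeled_joinx hp)/(IH _ _ hps)[inj lt card adjE].
split=> // x y; rewrite adjE !inE !xpair_eqE [(label y == i) && _]andbC.
move: (r _ _) (_ && _) (_ && _) (_ \in _) (_ \in _) => b1 b2 b3 b4 b5.
by case: b1; case: b2; case: b3; case: b4; case: b5.
Qed.

Lemma labels_le_joinx k i j e : labels_le k e -> labels_le k (joinx i j e).
Proof.
by rewrite /joinx; case: sumbool_of_bool => // h H; split=> //; case: e H => [?|???|????|??] [].
Qed.

Lemma labels_le_join_all k e ps : labels_le k e -> labels_le k (join_all e ps).
Proof. by elim: ps e => //= p ps IH e H; apply: IH; apply: labels_le_joinx. Qed.

Lemma nth_allpairs (S T R : Type) (f : S -> T -> R) x0 y0 z0 (s : seq S) (t : seq T) a b :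
  a < size s -> b < size t ->
  nth z0 [seq f x y | x <- s, y <- t] (a * size t + b) = f (nth x0 s a) (nth y0 t b).
Proof.
elim: s a => [|x s IH] [|a] //= ha hb; rewrite nth_cat size_map.
  by rewrite mul0n add0n hb (nth_map y0).
by rewrite mulSn -addnA ltnNge leq_addr /= addKn IH.
Qed.

(** Positions of the ones among the first [i] cells of a matrix stored by rows. In an adjacency
    matrix each edge occurs in both orders, and its second join merely adds it again. *)
Definition pairs (n : nat) (chi : pred nat) (i : nat) : seq (nat * nat) :=
  [seq (c %/ n, c %% n) | c <- iota 0 i & chi c].

Lemma mem_pairs n chi a b : a < n -> b < n -> ((a, b) \in pairs n chi (n * n)) = chi (a * n + b).
Proof.
move=> an bn; have n0 : 0 < n := leq_ltn_trans (leq0n a) an.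
apply/mapP/idP => [[c]|h].
  by rewrite mem_filter => /andP[hc _] [-> ->]; rewrite -divn_eq.
exists (a * n + b); last by rewrite divnMDl // divn_small // addn0 modnMDl modn_small.
rewrite mem_filter h mem_iota /=; apply: (@leq_trans (a.+1 * n)); first by rewrite mulSn addnC ltn_add2r.
by rewrite add0n leq_mul2r an orbT.
Qed.

Definition graph_expr (n : nat) (chi : pred nat) : cexpr :=
  join_all (chain n.-1) (pairs n chi (n * n)).

Lemma size_flatten_code (l : seq tok) : size (code l) <= 3 * size l.
Proof.
elim: l => //= t l IH; rewrite code_cons size_cat mulnS leq_add //.
by case: t.
Qed.

Lemma size_toks_chain m : size (toks (chain m)) = (2 * m).+1.
Proof. by elim: m => //= m IH; rewrite size_cat IH /=; lia. Qed.

Lemma size_pairs n chi i : size (pairs n chi i) <= i.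
Proof. by rewrite size_map size_filter; apply: leq_trans (count_size _ _) _; rewrite size_iota. Qed.

Section GraphExpr.
Variables (G : sgraph) (x0 : G).
Let n := #|G|.

Definition matrix_entry (c : nat) : bool :=
  adj (nth x0 (enum G) (c %/ n)) (nth x0 (enum G) (c %% n)).

Lemma matrix_entry_neq i : all (fun p => p.1 != p.2) (pairs n matrix_entry i).
Proof.
apply/allP => _ /mapP[c hc ->]; move: hc; rewrite mem_filter => /andP[hc _] /=.
by apply: contraTneq hc; rewrite /matrix_entry => ->; rewrite adj_irr.
Qed.

Lemma iso_graph_expr : iso (eval (graph_expr n matrix_entry)) G.
Proof.
have n0 : 0 < n by apply/card_gt0P; exists x0.
have := labeled_join_all (matrix_entry_neq (n * n)) (labeled_chain n.-1).
rewrite prednK // -/(graph_expr n matrix_entry) => -[inj lt card adjE].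
pose f (x : eval (graph_expr n matrix_entry)) : G := nth x0 (enum G) (label x).
have sz : size (enum G) = n by rewrite -cardE.
exists f => [|x y].
  apply: inj_card_bij; last by rewrite card.
  move=> x y /eqP; rewrite nth_uniq ?sz ?enum_uniq ?lt // => /eqP; exact: inj.
have mE (z w : eval (graph_expr n matrix_entry)) : (label z, label w) \in pairs n matrix_entry (n * n) = adj (f z) (f w).
  by rewrite mem_pairs ?lt // /matrix_entry divnMDl // divn_small ?lt // addn0 modnMDl modn_small ?lt.
by rewrite adjE !mE /= (adj_sym (f y)) orbb.
Qed.

End GraphExpr.

(** * Writing the new expression into memory *)

Definition emit (a b c : expr) : cmd :=
  Sto ($40) a ;! Sto ($40 +! #!1) b ;! Sto ($40 +! #!2) c ;! Asg 40 ($40 +! #!3).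

(* The new expression overwrites the given one; the adjacency matrix, which starts
   at address 3, is still in place. *)
Definition cmd_build : cmd :=
  Sto ($4) (#!1) ;! Sto ($4 +! #!1) (#!0) ;! Asg 40 ($4 +! #!2) ;! Asg 42 ($3 -! #!1) ;!
  For 41 42 (emit (#!1) ($41 +! #!1) (#!4)) ;!
  Asg 42 ($3 *! $3) ;!
  For 41 42 (IfE (EL (#!3 +! $41)) (emit (#!3) ($41 /! $3) ($41 -! ($41 /! $3) *! $3)) Skip) ;!
  Sto ($40) (#!0) ;! Asg 1 ($3).

Definition written (s0 s : state) (P : nat) (l : seq nat) : Prop :=
  [/\ reg s 40 = P + size l, forall x, x < size l -> smem s (P + x) = nth 0 l x,
      forall a, a < P -> smem s a = smem s0 a & forall x, x < 40 -> reg s x = reg s0 x].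

(** The operands are evaluated between the stores, so their values are required for every memory. *)
Lemma ok_emit W s0 s P l a b c va vb vc Q : 2 < W -> written s0 s P l ->
  P + size l + 3 <= W ->
  (forall m, esafe W (State (reg s) m) a /\ ev (State (reg s) m) a = va) ->
  (forall m, esafe W (State (reg s) m) b /\ ev (State (reg s) m) b = vb) ->
  (forall m, esafe W (State (reg s) m) c /\ ev (State (reg s) m) c = vc) ->
  (forall T s', T <= 30 + ecost a + ecost b + ecost c ->
     written s0 s' P (l ++ [:: va; vb; vc]) ->
     (forall x, x != 40 -> reg s' x = reg s x) -> Q T s') ->
  ok W (emit a b c) s Q.
Proof.
case: s => r m W2 [/= r40 ml lo rs] hW ha hb hc HQ.
have W1 : 1 < W by lia.
have [sa ea] := ha m.
apply: ok_seq; apply: ok_sto => //; rewrite ea.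
rewrite /set_mem /=; set m1 := upd _ _ va; have [sb eb] := hb m1.
apply: ok_seq; apply: ok_sto => //.
  by do !split=> //=; rewrite ?r40; lia.
rewrite /set_mem /= -/m1 eb; set m2 := upd _ _ vb; have [sc ec] := hc m2.
apply: ok_seq; apply: ok_sto => //.
  by do !split=> //=; rewrite ?r40; lia.
rewrite /set_mem /= -/m2 ec; set m3 := upd _ _ vc.
apply: ok_asg => //.
  by do !split=> //=; rewrite ?r40; lia.
have E z : z < P + size l -> m3 z = m z.
  by move=> hz; rewrite /m3 /m2 /m1 /upd r40 !ltn_eqF //; lia.
have [E0 E1 E2] : [/\ m3 (P + size l) = va, m3 (P + size l + 1) = vb & m3 (P + size l + 2) = vc].
  rewrite /m3 /m2 /m1 /upd r40 !eqxx; split=> //.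
    by rewrite !ltn_eqF //; lia.
  by rewrite ltn_eqF ?addn1 ?addn2.
apply: HQ.
- by rewrite /=; lia.
- split; regs => //.
  + by rewrite r40 size_cat /=; lia.
  + move=> x; rewrite size_cat /= => hx; rewrite nth_cat.
    case: ltnP => xl; first by rewrite E ?ml // ltn_add2l.
    have [y yE] : exists y, x = size l + y by exists (x - size l); lia.
    rewrite yE addKn addnA; have : y < 3 by lia.
    by case: y {yE} => [|[|[|]]] //= _; rewrite ?addn0.
  + by move=> z hz; rewrite E ?lo //; lia.
  + by move=> x hx; rewrite (ltn_eqF hx) rs.
- by move=> x hx; rewrite /= /upd (negPf hx).
Qed.

Lemma written_set_reg s0 s P l x v : 40 < x -> written s0 s P l -> written s0 (set_reg s x v) P l.
Proof.
move=> hx [r40 ml lo rs]; split; regs => //; first by rewrite ltn_eqF.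
by move=> y hy; rewrite ltn_eqF ?rs //; exact: ltn_trans hy hx.
Qed.

Section Build.
Variables (W n : nat) (chi : pred nat).
Hypothesis n_gt0 : 0 < n.
Hypothesis chi_neq : forall c, c < n * n -> chi c -> c %/ n != c %% n.
Let P := 3 + n * n.
Hypothesis W_big : P + 3 * (2 * n + n * n) + 10 <= W.

Lemma pairsS i : pairs n chi i.+1 = pairs n chi i ++ (if chi i then [:: (i %/ n, i %% n)] else [::]).
Proof.
rewrite /pairs -addn1 iotaD add0n filter_cat map_cat /=; congr (_ ++ _).
by case: ifP.
Qed.

Lemma pairs_neq i : i <= n * n -> all (fun p => p.1 != p.2) (pairs n chi i).
Proof.
move=> hi; apply/allP => _ /mapP[c hc ->]; move: hc; rewrite mem_filter mem_iota => /andP[hc hci] /=.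
by apply: chi_neq => //; apply: leq_trans hi.
Qed.

Let lst i := code (toks (join_all (chain n.-1) (pairs n chi i))).

Lemma lst_size i : i <= n * n -> size (lst i) <= 3 * (2 * n + n * n).
Proof.
move=> hi; apply: leq_trans (size_flatten_code _) _; rewrite leq_mul2l /=.
rewrite toks_join_all ?pairs_neq // size_cat size_toks_chain size_map.
by have := size_pairs n chi i; lia.
Qed.

Lemma lstS i : i < n * n -> lst i.+1 = lst i ++ (if chi i then [:: 3; i %/ n; i %% n] else [::]).
Proof.
move=> hi; rewrite /lst !toks_join_all ?(pairs_neq hi) ?(pairs_neq (ltnW hi)) //.
by rewrite pairsS map_cat catA code_cat; congr (_ ++ _); case: (chi i).
Qed.

Lemma ok_cmd_build s Q : reg s 3 = n -> reg s 4 = P ->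
  (forall c, c < n * n -> smem s (3 + c) = chi c) ->
  (forall T s', T <= 500 * (n * n) -> reg s' 1 = n ->
     (forall x, 1 < x < 40 -> reg s' x = reg s x) ->
     seg (smem s') P (code (toks (graph_expr n chi))) -> Q T s') ->
  ok W cmd_build s Q.
Proof.
move=> r3 r4 mat HQ.
have [W1 W2 W3] : [/\ 0 < W, 1 < W & 3 < W] by split; lia.
have nn : n <= n * n by rewrite leq_pmull.
apply: ok_seq; apply: ok_sto => //.
apply: ok_seq; apply: ok_sto => //; first by do !split=> //=; rewrite r4; lia.
apply: ok_seq; apply: (@ok_asg' _ _ _ _ _ (P + 2)) => //.
- by do !split=> //=; rewrite r4; lia.
- by rewrite /= r4.
apply: ok_seq; apply: (@ok_asg' _ _ _ _ _ n.-1) => //.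
  by regs; rewrite r3 subn1.
set s1 := set_reg _ 42 _.
have w1 : written s s1 P (code (toks (chain 0))).
  apply: written_set_reg => //; split; regs; rewrite ?r4 //.
  - by case=> [|[|]] //= _; rewrite ?addn0 ?eqxx // ltn_eqF // addn1.
  - by move=> a ha; rewrite !ltn_eqF //; lia.
  - by move=> x hx; rewrite ltn_eqF.
have r42 : reg s1 42 = n.-1 by [].
move: s1 w1 r42 => s1 w1 r42.
apply: ok_seq; apply: (@ok_for W (fun i s' => [/\ written s s' P (code (toks (chain i))),
    reg s' 41 = i & reg s' 42 = n.-1]) n.-1 60) => //.
- by split=> //; apply: written_set_reg.
- by move=> i s' [].
- move=> i s' hi [wi r41 r42'].
  have cS : code (toks (chain i.+1)) = code (toks (chain i)) ++ [:: 1; i.+1; 4] by rewrite code_cat.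
  have sz : size (code (toks (chain i))) <= 3 * (2 * n).
    by apply: leq_trans (size_flatten_code _) _; rewrite size_toks_chain; lia.
  apply: (ok_emit (va := 1) (vb := i.+1) (vc := 4) (ltnW W3) wi) => //.
  + by lia.
  + by move=> m; split; rewrite /= ?r41 ?addn1 //; do !split=> //; lia.
  move=> T s'' hT wi' rs; rewrite rs //.
  split=> //; first by move: hT; rewrite /=; lia.
  split; regs; rewrite ?rs //.
  by rewrite cS; apply: written_set_reg.
move=> T1 s2 hT1 [w2 _ _].
have q3 : reg s2 3 = n by case: w2 => _ _ _ ->; [| done].
apply: ok_seq; apply: (@ok_asg' _ _ _ _ _ (n * n)) => //.
- by split=> //=; rewrite q3; lia.
- by rewrite /= q3.
have w3 : written s (set_reg s2 42 (n * n)) P (lst 0) by apply: written_set_reg.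
have q42 : reg (set_reg s2 42 (n * n)) 42 = n * n by [].
move: (set_reg _ 42 _) w3 q42 => s3 w3 q42.
apply: ok_seq; apply: (@ok_for W (fun i s' => [/\ written s s' P (lst i),
    reg s' 41 = i & reg s' 42 = n * n]) (n * n) 100) => //.
- by split=> //; apply: written_set_reg.
- by move=> i s' [].
- move=> i s' hi [wi r41 r42']; have sz := lst_size (ltnW hi).
  case: (wi) => _ _ lo rs; have q3' : reg s' 3 = n by rewrite rs.
  have eM : ev s' (EL (#!3 +! $41)) = chi i by rewrite /= r41 lo ?mat // /P; lia.
  apply: ok_if; first by split=> //=; rewrite ?r41; lia.
    rewrite eM => hc; have {hc} hc : chi i by case: (chi i) hc.
    apply: (ok_emit (va := 3) (vb := i %/ n) (vc := i %% n) (ltnW W3) wi) => //.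
    + by lia.
    + by move=> m; split=> //; exact: ltnW.
    + by move=> m; split; rewrite /= ?r41 ?q3'.
    + move=> m; split; rewrite /= ?r41 ?q3' //; last by rewrite {1}(divn_eq i n) addKn.
      by do !split=> //; apply: leq_trans (leq_divM _ _) _; lia.
    move=> T s'' hT; have := lstS hi; rewrite hc => <- wi' rs'; rewrite rs' //.
    split=> //; first by move: hT; rewrite /=; lia.
    split; regs; rewrite ?rs' //.
    by apply: written_set_reg.
  rewrite eM => hc; have {hc} hc : chi i = false by case: (chi i) hc.
  apply: ok_skip; split=> //; split; regs => //.
  by apply: written_set_reg => //; rewrite lstS // hc cats0.
move=> T2 s4 hT2 [w4 _ _].
have sz := lst_size (leqnn (n * n)).
case: (w4) => p40 ml lo rs.
(* The given expression may extend beyond the new one, so the end marker has to be written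
   explicitly. *)
apply: ok_seq; apply: ok_sto => //.
apply: ok_asg => //; apply: HQ.
- by move: hT1 hT2; rewrite /=; lia.
- by regs; rewrite rs.
- by move=> x /andP[h1 h2]; regs; rewrite gtn_eqF ?rs.
move=> x; rewrite leq_eqVlt => /predU1P[->|hx]; regs; rewrite p40.
  by rewrite eqxx nth_default.
by rewrite eqn_add2l ltn_eqF // ml.
Qed.

End Build.

(** * The whole program *)

(** The case [t > n] is answered by 0 at once, since the extraction of the coefficient relies on
    [t <= n]. *)
Definition prog : cmd :=
  Asg 1 (EL (#!0)) ;! Asg 2 (EL (#!1)) ;! Asg 3 (EL (#!2)) ;! Asg 4 (#!3 +! $3 *! $3) ;!
  IfE (Ele ($2) ($3)) (IfE (Ele ($3) ($1)) cmd_build Skip ;! cmd_count) (Asg 0 (#!0)).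

Lemma labels_le_k_labeled k e : all_k_labeled k e -> labels_le k e.
Proof.
have le (H : lgraph) : k_labeled k H -> forall x : H, label x <= k by move=> h x; case/andP: (h x).
elim: e => [i|i j e1 IH|i j ij e1 IH|e1 IH1 e2 IH2] /= [/le h].
- by [].
- by move=> /IH.
- by move=> /IH.
- by case=> /IH1 ? /IH2.
Qed.

Lemma size_encode_expr e : size (encode_expr e) <= 3 * num_ops e.
Proof.
by elim: e => [i|i j e1 IH|i j ij e1 IH|e1 IH1 e2 IH2] //=; rewrite !size_cat /=; lia.
Qed.

Lemma iso_card (G H : sgraph) : iso G H -> #|G| = #|H|.
Proof. by case=> f /bij_eq_card. Qed.

Lemma num_fvs_gt (G : sgraph) t : #|G| < t -> num_fvs G t = 0.
Proof.
move=> tn; apply: eq_card0 => X; rewrite inE; apply/negP => /andP[_ /eqP h].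
by move: tn; rewrite -h ltnNge max_card.
Qed.

Section Input.
Variables (G : sgraph) (k t : nat) (e : cexpr).
Let n := #|G|.
Let m0 := smem (init_state (encode_input G k t e)).

Lemma input_mem c : m0 (3 + c) =
  nth 0 ([seq nat_of_bool (adj x y) | x <- enum G, y <- enum G] ++ encode_expr e) c.
Proof. by []. Qed.

Lemma input_seg : seg m0 (3 + n * n) (code (toks e)).
Proof.
move=> x hx; rewrite code_toks -addnA input_mem nth_cat size_allpairs -cardE.
by rewrite ltnNge leq_addr addKn.
Qed.

Lemma input_matrix (x0 : G) c : c < n * n -> m0 (3 + c) = matrix_entry x0 c.
Proof.
move=> cn; rewrite input_mem nth_cat size_allpairs -cardE cn /matrix_entry -/n.
have n0 : 0 < n by move: cn; case: n.
rewrite {1}(divn_eq c n) {2}/n [#|G|]cardE (nth_allpairs _ x0 x0) -?cardE ?ltn_mod //.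
by rewrite ltn_divLR.
Qed.

Lemma input_bdd B : bdd (word_bound (encode_input G k t e) B) (init_state (encode_input G k t e)).
Proof.
split=> //= a; case: (ltnP a (size (encode_input G k t e))) => ha; last by rewrite nth_default.
by apply: leq_trans (leq_addr _ _); apply: leq_bigmax_seq => //; apply: mem_nth.
Qed.
End Input.

Section Program.
Variables (W : nat) (G : sgraph) (x0 : G) (k t : nat) (e : cexpr).
Let n := #|G|.
Let kk := if n <= k then n else k.
Let ee := if n <= k then graph_expr n (matrix_entry x0) else e.
Let P := 3 + n * n.
Let L := size (encode_expr ee).
Let D := 3 * hexp n.+1 * L.
Let Z := 6 ^ kk.+1 * D.
Hypothesis He : k_expression k e G.
Hypothesis W_build : P + 3 * (2 * n + n * n) + 10 <= W.
Hypothesis W_big : P + L + 1 + (L + 25) * Z <= W.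
Hypothesis W_join : join_size + 20 <= W.

Lemma used_expr : labels_le kk ee /\ iso (eval ee) G.
Proof.
rewrite /kk /ee; case: leqP => nk.
  by split; [apply/labels_le_join_all/labels_le_chain/leq_pred | apply: iso_graph_expr].
by case: He => h ?; split=> //; apply: labels_le_k_labeled.
Qed.

Lemma ok_prog : ok W prog (init_state (encode_input G k t e))
  (fun T s' => T <= 500 * (n * n) + (L * KS + 2000) * (Z * D) + 200 /\
     reg s' 0 = num_fvs G t %% 2).
Proof.
have [W0 W1 W2 W3] : [/\ 0 < W, 1 < W, 2 < W & 3 <= W] by split; lia.
have n_gt0 : 0 < n by apply/card_gt0P; exists x0.
have [leE isoE] := used_expr.
set s := init_state _.
have [m0 m1 m2] : [/\ smem s 0 = k, smem s 1 = t & smem s 2 = n] by [].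
apply: ok_seq; apply: (@ok_asg' _ _ _ _ _ k) => //.
apply: ok_seq; apply: (@ok_asg' _ _ _ _ _ t) => //.
apply: ok_seq; apply: (@ok_asg' _ _ _ _ _ n) => //.
apply: ok_seq; apply: (@ok_asg' _ _ _ _ _ P) => //.
  by do !split=> //; regs; lia.
set s1 := set_reg _ 4 P.
have [r1 r2 r3 r4] : [/\ reg s1 1 = k, reg s1 2 = t, reg s1 3 = n & reg s1 4 = P] by [].
have ms : smem s1 = smem s by [].
move: s1 r1 r2 r3 r4 ms => s1 r1 r2 r3 r4 ms.
apply: ok_if; first by [].
  rewrite ev_Ele /= r2 r3 => tn; have {tn} tn : t <= n by case: (t <= n) tn.
  apply: ok_seq.
  have pre : ok W (IfE (Ele ($3) ($1)) cmd_build Skip) s1 (fun T s' => [/\ T <= 500 * (n * n) + 50,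
      [/\ reg s' 1 = kk, reg s' 2 = t, reg s' 3 = n & reg s' 4 = P] &
      seg (smem s') P (code (toks ee))]).
    apply: ok_if; first by [].
      rewrite ev_Ele /= r1 r3 => nk; have {nk} nk : n <= k by case: (n <= k) nk.
      rewrite /kk /ee nk; apply: (@ok_cmd_build W n (matrix_entry x0)) => //.
      - move=> c hc h; have := matrix_entry_neq x0 (n * n) => /allP/(_ (c %/ n, c %% n)); apply.
        by apply/mapP; exists c => //; rewrite mem_filter h mem_iota.
      - by move=> c hc; rewrite ms; apply: input_matrix.
      move=> T s2 hT q1 rs sg; split=> //; first by rewrite /=; lia.
      by split=> //; rewrite rs.
    rewrite ev_Ele /= r1 r3 => nk; have {nk} nk : (n <= k) = false by case: (n <= k) nk.
    rewrite /kk /ee nk; apply: ok_skip; split=> //; first by rewrite /=; lia.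
    by rewrite ms; apply: input_seg.
  apply: ok_conseq pre _ => T1 s2 _ [hT1 [q1 q2 q3 q4] sg].
  have := @ok_cmd_count W kk n t P ee leE (iso_card isoE) tn W_big W_join s2 q1 q2 q3 q4 sg.
  move=> H; apply: ok_conseq H _ => T2 s3 _ [hT2 ->]; split; last by rewrite (num_fvs_iso _ isoE).
  by move: hT1 hT2; rewrite -/n -/L -/D -/Z; move: ((L * KS + 2000) * (Z * D)) => x; rewrite /=; lia.
rewrite ev_Ele /= r2 r3 => tn; have {tn} tn : n < t by rewrite ltnNge; case: (t <= n) tn.
apply: ok_asg => //; split; last by regs; rewrite num_fvs_gt.
by rewrite /=; lia.
Qed.

End Program.

(* Slots have 6^k poly(n) L cells and each cell takes time O(D). *)
Lemma resource_bounds a n L Z D K : 0 < a -> 0 < n -> 0 < L ->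
  Z <= 144 * (a * (n * n) * L) -> D <= 24 * (n * n * L) ->
  [/\ 3 + n * n + 3 * (2 * n + n * n) + 10 <= 30 * (a * n ^ 4 * L ^ 3),
      3 + n * n + L + 1 + (L + 25) * Z <= 4000 * (a * n ^ 4 * L ^ 3) &
      500 * (n * n) + (L * K + 2000) * (Z * D) + 200 <= 3500 * ((K + 2000) * (a * n ^ 4 * L ^ 3))].
Proof.
move=> a0 n0 L0 hZ hD; set X := a * n ^ 4 * L ^ 3.
pose Y := a * (n * n) * L * (n * n * L).
have XE : X = Y * L by rewrite /X /Y; ring.
have q0 : 0 < n * n by rewrite muln_gt0 n0.
have nq : n <= n * n by rewrite leq_pmulr.
have Y0 : 0 < Y by rewrite /Y !muln_gt0 a0 n0 L0.
have YX : Y <= X by rewrite XE leq_pmulr.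
have qY : n * n <= Y.
  have -> : Y = n * n * (a * L * (n * n * L)) by rewrite /Y; ring.
  by rewrite leq_pmulr // !muln_gt0 a0 n0 L0.
have LX : L <= X by rewrite XE leq_pmull.
have uY : a * (n * n) * L <= Y by rewrite leq_pmulr // !muln_gt0 n0 L0.
have ZX : Z <= 144 * X by apply: leq_trans hZ _; rewrite leq_mul2l (leq_trans uY YX).
have LZX : L * Z <= 144 * X.
  apply: leq_trans (_ : L * (144 * Y) <= _).
    by rewrite leq_mul2l (leq_trans hZ) ?orbT // leq_mul2l uY.
  by rewrite XE mulnCA [L * Y]mulnC.
have ZDY : Z * D <= 3456 * Y.
  apply: leq_trans (leq_mul hZ hD) _.
  by rewrite mulnACA.
split.
- by lia.
- by rewrite mulnDl; lia.
have LK : L * K + 2000 <= L * (K + 2000) by rewrite mulnDr leq_add2l leq_pmull.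
have m20 : 20 <= K + 2000 by apply: leq_trans (leq_addl _ _).
move: (K + 2000) LK m20 => m LK m20.
have LZD : (L * K + 2000) * (Z * D) <= 3456 * (m * X).
  apply: leq_trans (leq_mul LK ZDY) _.
  by rewrite XE mulnCA leq_mul2l /= [Y * L]mulnC mulnA [m * L]mulnC.
have mX : 20 * X <= m * X by rewrite leq_mul2r m20 orbT.
by move: (_ * (Z * D)) (m * X) LZD mX => x y; lia.
Qed.

(** This removes [k] from the polynomial factor: for [k < n] one has (nk)^d <= n^(2d), and otherwise
    the rebuilt expression has only quadratically many tokens. *)
Lemma size_used_expr (G : sgraph) (x0 : G) k d e (n := #|G|) : 0 < n ->
  num_ops e <= d * (n * k) ^ d ->
  size (encode_expr (if n <= k then graph_expr n (matrix_entry x0) else e))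
    <= (3 * d + 9) * n ^ (2 * d + 2).
Proof.
move=> n_gt0 ops; case: (leqP n k) => nk.
  rewrite -code_toks; apply: leq_trans (size_flatten_code _) _.
  rewrite /graph_expr toks_join_all ?matrix_entry_neq // size_cat size_toks_chain size_map.
  apply: leq_trans (_ : 9 * n ^ (2 * d + 2) <= _); last by rewrite leq_mul2r leq_addl orbT.
  rewrite -[9]/(3 * 3) -mulnA leq_mul2l /=.
  have h2 : n * n <= n ^ (2 * d + 2) by rewrite mulnn leq_pexp2l // leq_addl.
  have nn : n <= n * n by rewrite leq_pmulr.
  have := size_pairs n (matrix_entry x0) (n * n).
  by move: (n ^ _) h2 => y h2; lia.
apply: leq_trans (size_encode_expr _) _.
apply: leq_trans (_ : 3 * d * n ^ (2 * d + 2) <= _); last by rewrite leq_mul2r leq_addr orbT.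
rewrite -mulnA leq_mul2l /=; apply: leq_trans ops _; rewrite leq_mul2l; apply/orP; right.
apply: leq_trans (_ : (n ^ 2) ^ d <= _); last by rewrite -expnM leq_pexp2l // leq_addr.
by elim: (d) => // i IH; rewrite !(expnS _ i); apply: leq_mul => //; rewrite -mulnn leq_mul // ltnW.
Qed.

Lemma init_user l : user (init_state l) = init_state l.
Proof. by congr State; apply: functional_extensionality => x; case: ifP. Qed.

(* As usual, the given k-expression has a number of operations polynomial in n
   and k (otherwise it cannot even be read within the time bound): the constants
   C and c may depend on this polynomial, the algorithm P does not. *)
Theorem theorem1 :
  exists P : cmd, forall d : nat, exists C c : nat,
    forall (G : sgraph) (k t : nat) (e : cexpr),
      0 < t ->
      k_expression k e G ->
      num_ops e <= d * (#|G| * k) ^ d ->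
      computes_within P (encode_input G k t e)
        (num_fvs G t %% 2) (C * 6 ^ k * #|G| ^ c).
Proof.
(* Time and word size are at most a constant times 6^k n^4 L^3, where the code length [L] is at most
   (3d + 9) n^(2d + 2); the summand [join_size] secures the word bound. *)
exists prog => d; exists ((4000 * (KS + 2000) + join_size) * (3 * d + 9) ^ 3), (4 + (2 * d + 2) * 3).
move=> G k t e _ He ops; set n := #|G| in ops *; set B := _ * n ^ _.
have [_ isoG] := He.
have n_gt0 : 0 < n by rewrite /n -(iso_card isoG) card_eval_gt0.
have [x0 _] := card_gt0P n_gt0.
set kk := if n <= k then n else k.
set ee := if n <= k then graph_expr n (matrix_entry x0) else e.
set L := size (encode_expr ee).
have L_gt0 : 0 < L by apply: ltnW; apply: size_encode_expr_gt1.
have kkk : 6 ^ kk <= 6 ^ k by rewrite leq_exp2l // /kk; case: (leqP n k).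
have LB : L <= (3 * d + 9) * n ^ (2 * d + 2) := size_used_expr x0 n_gt0 ops.
pose D := 3 * hexp n.+1 * L; pose Z := 6 ^ kk.+1 * D.
have hD : D <= 24 * (n * n * L).
  have n2 : n.+1 * n.+1 <= 4 * (n * n).
    by rewrite (_ : 4 * (n * n) = (n + n) * (n + n)); [rewrite leq_mul // -addn1 leq_add2l | ring].
  have -> : D = 6 * (n.+1 * n.+1) * L by rewrite /D /hexp; ring.
  have -> : 24 * (n * n * L) = 6 * (4 * (n * n)) * L by ring.
  by rewrite leq_mul2r leq_mul2l n2 !orbT.
have hZ : Z <= 144 * (6 ^ k * (n * n) * L).
  rewrite /Z expnS; apply: leq_trans (leq_mul (leq_mul (leqnn 6) kkk) hD) _.
  by rewrite mulnACA -(mulnA (6 ^ k)); exact: leqnn.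
have [b1 b2 b3] := resource_bounds KS (exp6_gt0 k) n_gt0 L_gt0 hZ hD.
set X := _ * L ^ 3 in b1 b2 b3.
have X_gt0 : 0 < X by rewrite /X !muln_gt0 !expn_gt0 n_gt0 L_gt0.
have m_gt0 : 0 < KS + 2000 by rewrite addnS.
have XB : 4000 * ((KS + 2000) * X) + join_size * X <= B.
  have -> : B = (4000 * (KS + 2000) + join_size) *
      (6 ^ k * n ^ 4 * ((3 * d + 9) * n ^ (2 * d + 2)) ^ 3).
    rewrite /B expnMn -expnM (expnD n 4); move: (_ + join_size) (6 ^ k) (n ^ 4) (_ ^ 3) (n ^ _).
    by move=> *; ring.
  by rewrite mulnA -mulnDl leq_mul2l /X leq_mul2l leq_exp2r // LB !orbT.
have mX : X <= (KS + 2000) * X by rewrite leq_pmull.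
have jX : join_size <= join_size * X by rewrite leq_pmulr.
set W := word_bound (encode_input G k t e) B.
have BW : B <= W by rewrite /W /word_bound leq_addl.
move: (KS + 2000) (join_size * X) XB mX jX b3 m_gt0 => m jx XB mX jX b3 m_gt0.
have B4 : 4000 * (m * X) <= B by apply: leq_trans XB; apply: leq_addr.
have X4 : 4000 * X <= B by apply: leq_trans B4; rewrite leq_mul2l mX orbT.
have wb : 3 + n * n + 3 * (2 * n + n * n) + 10 <= W.
  apply: leq_trans BW; apply: leq_trans b1 (leq_trans _ X4).
  by rewrite leq_mul2r orbT.
have wg : 3 + n * n + L + 1 + (L + 25) * Z <= W.
  by apply: leq_trans BW; apply: leq_trans b2 X4.
have wj : join_size + 20 <= W.
  apply: leq_trans BW; apply: leq_trans XB; rewrite addnC; apply: leq_add jX.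
  apply: leq_trans (_ : 4000 * 1 <= _); first by [].
  by rewrite leq_mul2l (leq_trans X_gt0 mX) orbT.
have H := @ok_prog W G x0 k t e He wb wg wj.
have [T [s' [ex _ [hT r0]]]] := H _ (init_user _) (input_bdd G k t e B).
exists T, s'; split=> //.
apply: leq_trans hT _; apply: leq_trans b3 (leq_trans _ B4).
by rewrite leq_mul2r orbT.
Qed.
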